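(* Let $C\subset\mathbb{R}^{n+1}$ be a convex body of uniform geometry. Then any isoperimetric region in $C$ is bounded.
   Context: Here $n\ge 1$. A convex body is a closed convex subset of $\mathbb{R}^{n+1}$ with non-empty interior. $|E|$ is Lebesgue measure. For measurable $E\subset C$ the relative perimeter is $P_C(E)=\sup\{\int_E \mathrm{div}\,\xi\,dx:\ \xi$ a smooth vector field with compact support in $\mathrm{int}(C)$, $|\xi|\le 1\}$; the isoperimetric profile is $I_C(v)=\inf\{P_C(E): E\subset C\text{ measurable},|E|=v\}$, $v>0$; $E\subset C$ with $0<|E|<\infty$ is an isoperimetric region if $P_C(E)=I_C(|E|)$. Sets are considered up to Lebesgue null sets, so bounded means that $|E\setminus B(x_0,R)|=0$ for some $x_0$ and $R>0$. $C$ is of uniform geometry if it is unbounded and there is $r_0>0$ with $\inf_{x\in C}|C\cap\overline{B}(x,r_0)|>0$. *)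

(* Defs.v *)
From HB Require Import structures.
From mathcomp Require Import all_boot all_order all_algebra.
From mathcomp Require Import all_classical all_reals all_analysis.
Import Order.TTheory GRing.Theory Num.Theory.
Import numFieldNormedType.Exports.

Set Implicit Arguments.
Unset Strict Implicit.
Unset Printing Implicit Defensive.

Local Open Scope classical_set_scope.
Local Open Scope ring_scope.

Section euclidean.
Context {R : realType} {n : nat}.
Implicit Types x y : 'rV[R]_n.+1.

(* The library norm on row vectors is the sup norm (it induces the usual
   topology), hence this separate Euclidean norm. *)
Definition enorm x : R := Num.sqrt (\sum_i x ord0 i ^+ 2).

Definition eball x (r : R) : set 'rV[R]_n.+1 := [set y | enorm (y - x) < r].

Definition closed_eball x (r : R) : set 'rV[R]_n.+1 :=
  [set y | enorm (y - x) <= r].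

End euclidean.

Section lebesgue_outer.
Context (R : realType) (n : nat).
Implicit Types (A : set 'rV[R]_n.+1) (p : 'rV[R]_n.+1 * 'rV[R]_n.+1).

(* The pair (a, b) encodes the box ]a_0, b_0] x ... x ]a_n, b_n], which is
   empty, with volume 0, as soon as some b_i <= a_i. *)
Definition box p : set 'rV[R]_n.+1 :=
  [set x | forall i, p.1 ord0 i < x ord0 i <= p.2 ord0 i].

Definition box_volume p : R :=
  \prod_i Num.max 0 (p.2 ord0 i - p.1 ord0 i).

Definition lebesgue_outer A : \bar R :=
  ereal_inf [set (\sum_(k <oo) (box_volume (B k))%:E)%E |
    B in [set B : nat -> 'rV[R]_n.+1 * 'rV[R]_n.+1 |
            A `<=` \bigcup_k box (B k)]].

Let box_volume_ge0 p : (0 <= (box_volume p)%:E)%E.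
Proof. by rewrite lee_fin; apply: prodr_ge0 => i _; rewrite le_max lexx. Qed.

Let lebesgue_outer_ge0 A : (0 <= lebesgue_outer A)%E.
Proof.
by apply: le_ereal_inf_tmp => _ [B _ <-]; apply: nneseries_ge0 => k _ _.
Qed.

Let lebesgue_outer0 : lebesgue_outer set0 = 0%E.
Proof.
apply/eqP; rewrite eq_le lebesgue_outer_ge0 andbT.
apply: ereal_inf_lbound; exists (fun=> (0, 0)) => //=.
by apply: eseries0 => k _ _; rewrite /box_volume big_ord_recl/= subrr maxxx mul0r.
Qed.

Let le_lebesgue_outer :
  {homo lebesgue_outer : A B / A `<=` B >-> (A <= B)%E}.
Proof.
move=> A B AB; apply: ereal_inf_le_tmp => _ [F BF <-].
by exists F => //; exact: subset_trans BF.
Qed.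

Let lebesgue_outer_sigma_subadditive : sigma_subadditive lebesgue_outer.
Proof.
move=> A.
have [[i ioo]|] := pselect (exists i, lebesgue_outer (A i) = +oo%E).
  rewrite (eseries_pinfty _ _ ioo) ?leey// => k _.
  by rewrite -ltNye (lt_le_trans _ (lebesgue_outer_ge0 _)).
rewrite -forallNE => Aoo.
suff add2e (e : {posnum R}) : (lebesgue_outer (\bigcup_k A k) <=
    \sum_(i <oo) lebesgue_outer (A i) + e%:num%:E)%E.
  by apply/lee_addgt0Pr => _/posnumP[].
apply: le_trans (epsilon_trick _ _ _) => //.
have /choice[G PG] : forall k, exists B : nat -> 'rV[R]_n.+1 * 'rV[R]_n.+1,
    A k `<=` \bigcup_j box (B j) /\
    (\sum_(j <oo) (box_volume (B j))%:E <=
     lebesgue_outer (A k) + (e%:num / (2 ^ k.+1)%:R)%:E)%E.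
  move=> k.
  have ek : 0 < e%:num / (2 ^ k.+1)%:R :> R by [].
  have Ak : lebesgue_outer (A k) \is a fin_num.
    by rewrite ge0_fin_numE// ltey; exact/eqP/Aoo.
  have [_ [B AB <-] /ltW BA] := lb_ereal_inf_adherent ek Ak.
  by exists B.
pose vol (ij : nat * nat) : \bar R := (box_volume (G ij.1 ij.2))%:E.
have /card_esym/ppcard_eqP[f] := card_nat2.
apply: (@le_trans _ _ (\esum_(ij in [set: nat * nat]) vol ij)%E).
  apply: ereal_inf_lbound; exists (fun k => G (f k).1 (f k).2).
    move=> x [i _ /(PG i).1[j _ Gx]].
    by exists (f^-1%FUN (i, j)) => //; rewrite invK ?inE.
  rewrite (nneseries_esumT (fun k => box_volume_ge0 (G (f k).1 (f k).2))).
  by rewrite [RHS](reindex_esum setT setT f).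
have vol_ge0 k : (0 <= \esum_(j in [set: nat]) vol (k, j))%E.
  by apply: esum_ge0 => j _; exact: box_volume_ge0.
rewrite (_ : setT = setT `*`` (fun=> setT)); last by apply/seteqP; split.
rewrite (_ : vol = fun ij => vol (ij.1, ij.2)); last by apply/funext => -[].
rewrite -(esum_esum (a := fun i j => vol (i, j))); last first.
  by move=> i j _ _; exact: box_volume_ge0.
rewrite -nneseries_esumT//.
apply: lee_nneseries => [k _ _|k _]; first exact: vol_ge0.
rewrite -nneseries_esumT; first exact: (PG k).2.
by move=> j; exact: box_volume_ge0.
Qed.

HB.instance Definition _ := isOuterMeasure.Build R 'rV[R]_n.+1 lebesgue_outer
  lebesgue_outer0 lebesgue_outer_ge0 le_lebesgue_outer
  lebesgue_outer_sigma_subadditive.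

End lebesgue_outer.

Section lebesgue.
Context {R : realType} {n : nat}.
Local Notation lebesgue_outer := (@lebesgue_outer R n).

(* Lebesgue measure is the restriction of the outer measure to its
   Caratheodory sets. *)
Definition lebesgue : set (caratheodory_type lebesgue_outer) -> \bar R :=
  lebesgue_outer.
HB.instance Definition _ := isMeasure.Build _ _ _ lebesgue
  (@caratheodory_measure0 _ _ lebesgue_outer)
  (@caratheodory_measure_ge0 _ _ lebesgue_outer)
  (@caratheodory_measure_sigma_additive _ _ lebesgue_outer).

Definition lebesgue_measurable (A : set 'rV[R]_n.+1) : Prop :=
  lebesgue_outer.-cara.-measurable A.

End lebesgue.

Section smooth.
Context {R : realType} {n : nat}.
Implicit Types (xi : 'rV[R]_n.+1 -> 'rV[R]_n.+1).

Definition partial (i : 'I_n.+1) (f : 'rV[R]_n.+1 -> R) : 'rV[R]_n.+1 -> R :=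
  'D_(delta_mx ord0 i) f.

Fixpoint Ck (k : nat) (f : 'rV[R]_n.+1 -> R) : Prop :=
  if k is k'.+1 then
    continuous f /\
    forall i, (forall x, derivable f x (delta_mx ord0 i)) /\ Ck k' (partial i f)
  else continuous f.

Definition smooth xi : Prop := forall k i, Ck k (fun x => xi x ord0 i).

Definition divergence xi : 'rV[R]_n.+1 -> R :=
  fun x => \sum_i partial i (fun y => xi y ord0 i) x.

Definition field_support xi : set 'rV[R]_n.+1 := closure [set x | xi x != 0].

End smooth.

Section isoperimetry.
Context {R : realType} {n : nat}.
Implicit Types C E : set 'rV[R]_n.+1.

Definition convex_body C : Prop :=
  [/\ closed C, convex_set C & C^° !=set0].

(* Fields with compact support in the interior of C, extended by 0. *)
Definition test_field C : set ('rV[R]_n.+1 -> 'rV[R]_n.+1) :=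
  [set xi | [/\ smooth xi, compact (field_support xi), field_support xi `<=` C^° &
               forall x, enorm (xi x) <= 1]].

Definition relative_perimeter C E : \bar R :=
  ereal_sup [set (\int[lebesgue]_(x in E) (divergence xi x)%:E)%E |
    xi in test_field C].

Definition isoperimetric_profile C (v : R) : \bar R :=
  ereal_inf [set relative_perimeter C E |
    E in [set E | [/\ lebesgue_measurable E, E `<=` C &
                     lebesgue E = v%:E]]].

Definition isoperimetric_region C E : Prop :=
  [/\ lebesgue_measurable E, E `<=` C, (0 < lebesgue E < +oo)%E &
      relative_perimeter C E = isoperimetric_profile C (fine (lebesgue E))].

Definition uniform_geometry C : Prop :=
  ~ bounded_set C /\
  exists2 r0 : R, 0 < r0 &
    (0 < ereal_inf [set lebesgue (C `&` closed_eball x r0) | x in C])%E.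

Definition essentially_bounded E : Prop :=
  exists (x0 : 'rV[R]_n.+1) (r : R),
    0 < r /\ lebesgue (E `\` eball x0 r) = 0%E.

End isoperimetry.

(* Main.v *)
(* Let E be isoperimetric, of perimeter p. Since |C| is infinite, local isoperimetric
   inequalities show that some smooth f compactly supported in the interior of C has
   int_E d_i f > 0. Moving sets along f e_i restores any small lost volume at a cost
   proportional to that volume. Cut E at a level t in [a, b] of a coordinate (up to sign),
   chosen so that the cut creates perimeter at most K V(a) / (b - a), where V(t) is the volume
   of E beyond t. Discarding the part beyond t and restoring its volume far away, minimality
   bounds the perimeter of the discarded part by K' V(a) / (b - a). The isoperimetric
   inequality |G| <= B h P_C(G), valid for |G| <= A h^(n+1) and h <= r_0 by convexity and
   uniform geometry, then gives V(b) <= B K' h V(a) / (b - a); De Giorgi's iteration with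
   h_k = h_0 2^-k and b - a = 2^-(k+1) makes V vanish at a finite level. No structure theory
   of sets of finite perimeter enters: everything is tested against smooth fields. *)

Require Import Defs.
From HB Require Import structures.
From mathcomp Require Import all_boot all_order all_algebra.
From mathcomp Require Import all_classical all_reals all_analysis.
From mathcomp Require Import measurable_realfun ring lra.
Import Order.TTheory GRing.Theory Num.Theory.
Import numFieldNormedType.Exports.

Set Implicit Arguments.
Unset Strict Implicit.
Unset Printing Implicit Defensive.

Local Open Scope classical_set_scope.
Local Open Scope ring_scope.

(** * Calculus of C^k functions on row vectors *)

(** Every geometric operation is turned into an operation on admissible fields. Gluing two fields by
    a ramp with values in [0, 1] keeps them admissible, by convexity of the unit ball; so one field
    on [E] tests both sides of a cut, and the cut costs only the gradient of the ramp. The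
    competitor must have the volume of [E] exactly. This is why the deformation is a shear x + t
    f(x) e_i: its Jacobian 1 + t d_i f is affine in t, hence so is the volume of the image, and the
    time that restores a lost volume G is G / alpha with alpha = int_E d_i f. Cuts are made beyond
    the support of f, so alpha is the same for all truncations of [E]. The isoperimetric inequality
    compares midpoints. For p in a convex set K of diameter at most D, radial fields about p show
    that the x in G interior to K whose midpoint with p is not in G have measure at most 2^n D P.
    For fixed x, the p in K whose midpoint with x is in G have measure at most 2^(n+1) |G|.
    Averaging over K bounds the part of G interior to K once |G| is small against |K|. In grid cells
    this is the inequality at scale h; in large pieces of C it yields alpha > 0. *)

Section calculus.
Context {R : realType}.

Lemma MVT0 (g dg : R -> R) (h : R) :
  (forall s : R, is_derive s 1 g (dg s)) ->
  exists2 c, `|c| <= `|h| & g h - g 0 = dg c * h.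
Proof.
move=> gd.
have gc : continuous g.
  by move=> s; apply/differentiable_continuous/derivable1_diffP; have [] := gd s.
have [h0|h0] := leP 0 h.
- have [c /[!in_itv]/= /andP[c0 ch] e] := MVT_segment h0 (fun x _ => gd x)
    (continuous_subspaceT gc).
  by exists c; rewrite ?subr0 in e *; rewrite // !ger0_norm.
- have [c /[!in_itv]/= /andP[c0 ch] e] := MVT_segment (ltW h0) (fun x _ => gd x)
    (continuous_subspaceT gc).
  exists c; first by rewrite !ler0_norm ?lerN2// ltW.
  by rewrite -opprB e sub0r mulrN opprK.
Qed.

Lemma line_is_derive (V : normedModType R) (f : V -> R) (v w : V) (s : R) :
  derivable f (s *: v + w) v ->
  is_derive s 1 (fun t => f (t *: v + w)) ('D_v f (s *: v + w)).
Proof.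
move=> df.
have e : (fun h : R => h^-1 *: (((fun t => f (t *: v + w)) \o shift s) h%:A - f (s *: v + w)))
  = (fun h : R => h^-1 *: ((f \o shift (s *: v + w)) (h *: v) - f (s *: v + w))).
  by apply/funext => h /=; rewrite [h%:A]mulr1 scalerDl addrA.
by apply: DeriveDef; rewrite /derivable /derive e.
Qed.

Lemma cvgr_sum (T : Type) (F : set_system T) (I : finType) (f : I -> T -> R)
    (a : I -> R) : Filter F -> (forall i, f i x @[x --> F] --> a i) ->
  \sum_i f i x @[x --> F] --> \sum_i a i.
Proof.
by move=> FF fa; apply: (@cvg_big _ _ _ _ xpredT add_continuous) => // i _; exact: fa.
Qed.

Context {n : nat}.
Implicit Types (f g : 'rV[R]_n.+1 -> R) (x y : 'rV[R]_n.+1).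

Lemma coord_le_norm x i : `|x ord0 i| <= `|x|.
Proof.
rewrite [leRHS]/Num.Def.normr/= mx_normrE.
exact: (le_bigmax _ (fun ij => `|x ij.1 ij.2|) (ord0, i)).
Qed.

Lemma norm_le_coord x (M : R) :
  0 <= M -> (forall i, `|x ord0 i| <= M) -> `|x| <= M.
Proof.
move=> M0 xM; rewrite [leLHS]/Num.Def.normr/= mx_normrE (bigmax_le _ M0)//=.
by move=> -[j i] _ /=; rewrite (ord1 j).
Qed.

Lemma norm_delta_le1 i : `|delta_mx ord0 i : 'rV[R]_n.+1| <= 1.
Proof.
by apply: norm_le_coord => // l; rewrite !mxE eqxx /=; case: eqP; rewrite ?normr1 ?normr0.
Qed.

Lemma Ck_continuous k f : Ck k f -> continuous f.
Proof. by case: k => //= k []. Qed.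

Lemma CkS k f : Ck k.+1 f -> Ck k f.
Proof.
elim: k f => [f []//|k ih f [cf H]]; split => // i; split; first by have [] := H i.
by have [_ /ih] := H i.
Qed.

Lemma Ck_le k l f : (k <= l)%N -> Ck l f -> Ck k f.
Proof.
by move=> /subnK <-; elim: (l - k)%N => //= m ih /CkS/ih.
Qed.

Lemma Ck_derivable k f x (i : 'I_n.+1) : Ck k.+1 f -> derivable f x (delta_mx ord0 i).
Proof. by case=> _ H; have [] := H i. Qed.

Lemma Ck_partial k f i : Ck k.+1 f -> Ck k (partial i f).
Proof. by case=> _ H; have [] := H i. Qed.

Lemma Ck_is_derive k f x (i : 'I_n.+1) : Ck k.+1 f ->
  is_derive x (delta_mx ord0 i) f (partial i f x).
Proof. by move=> fk; apply: DeriveDef => //; exact: (Ck_derivable fk). Qed.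

(* Mean value theorem along the edges of the box with diagonal [x, y]. *)
Lemma C1_increment f x y : Ck 1 f ->
  exists2 z : 'I_n.+1 -> 'rV[R]_n.+1,
    forall k, `|z k - x| <= `|y - x| &
    f y - f x = \sum_k partial k f (z k) * (y ord0 k - x ord0 k).
Proof.
move=> fC.
pose w (k : nat) : 'rV[R]_n.+1 := \row_j (if (j < k)%N then y ord0 j else x ord0 j).
have wS (k : 'I_n.+1) : w k.+1 = (y ord0 k - x ord0 k) *: delta_mx ord0 k + w k.
  apply/rowP => j; rewrite !mxE eqxx /= ltnS.
  have [->|jk] := eqVneq j k; first by rewrite leqnn ltnn mulr1 subrK.
  by rewrite leq_eqVlt (negPf (jk : (j : nat) != k)) mulr0 add0r.
have /choice[c cP] : forall k : 'I_n.+1, exists c : R,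
    `|c| <= `|y ord0 k - x ord0 k| /\ f (w k.+1) - f (w k) =
     partial k f (c *: delta_mx ord0 k + w k) * (y ord0 k - x ord0 k).
  move=> k.
  have [c c1 c2] := @MVT0 (fun t => f (t *: delta_mx ord0 k + w k))
    (fun t => partial k f (t *: delta_mx ord0 k + w k)) (y ord0 k - x ord0 k)
    (fun s => line_is_derive (Ck_derivable fC)).
  by exists c; split => //; rewrite wS -c2 scale0r add0r.
exists (fun k => c k *: delta_mx ord0 k + w k).
  move=> k; apply: norm_le_coord => // j; rewrite !mxE eqxx /=.
  have [->|jk] := eqVneq j k.
    rewrite ltnn mulr1 addrK; apply: (le_trans (cP k).1).
    by have := coord_le_norm (y - x) k; rewrite !mxE.
  rewrite mulr0 add0r; case: ifP => _; last by rewrite subrr normr0.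
  by have := coord_le_norm (y - x) j; rewrite !mxE.
have -> : y = w n.+1 by apply/rowP => j; rewrite !mxE ltn_ord.
have {1}-> : x = w 0%N by apply/rowP => j; rewrite !mxE.
rewrite -(telescope_sumr (fun k => f (w k))) // big_mkord.
by apply: eq_bigr => k _; rewrite (cP k).2 mxE ltn_ord.
Qed.

(** Chain rule from directional derivatives alone: by [C1_increment] the difference quotient of
    [f \o phi] is a sum of partial derivatives at points [z h i] tending to [phi x], each multiplied
    by the difference quotient of a coordinate of [phi]. *)
Lemma is_derive_comp_C1 (V : normedModType R) (phi : V -> 'rV[R]_n.+1) (v x : V)
    (w : 'I_n.+1 -> R) f :
  Ck 1 f -> (forall i, is_derive x v (fun t => phi t ord0 i) (w i)) ->
  is_derive x v (f \o phi) (\sum_i partial i f (phi x) * w i).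
Proof.
move=> fC phid.
pose q (i : 'I_n.+1) (h : R) := h^-1 *: (phi (h *: v + x) ord0 i - phi x ord0 i).
have qw i : q i h @[h --> 0^'] --> w i.
  by have [/cvgP + <-] := phid i; rewrite /derivable /derive => /cvg_ex[l] /[dup] /cvg_lim ->.
have phic : phi (h *: v + x) @[h --> 0^'] --> phi x.
  apply/cvgrPdist_le => e e0.
  have H i : \forall h \near 0^', `|phi x ord0 i - phi (h *: v + x) ord0 i| <= e.
    have : h * q i h + phi x ord0 i @[h --> 0^'] --> 0 * w i + phi x ord0 i.
      apply: cvgD; last exact: cvg_cst.
      apply: cvgM => //; apply: cvg_within_filter; exact: cvg_id.
    rewrite mul0r add0r => /cvgrPdist_le /(_ e e0) qe; near=> h.
    have h0 : h != 0 by near: h; exact: nbhs_dnbhs_neq.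
    have -> : phi (h *: v + x) ord0 i = h * q i h + phi x ord0 i.
      by rewrite /q [h * _]mulrA divff// mul1r subrK.
    by near: h.
  have {}H : \forall h \near 0^', forall i, `|phi x ord0 i - phi (h *: v + x) ord0 i| <= e.
    exact: filter_forall.
  near=> h; apply: norm_le_coord; first exact: ltW.
  by move=> i; rewrite !mxE; move: i; near: h.
have /choice[z zP] : forall h : R, exists z : 'I_n.+1 -> 'rV[R]_n.+1,
    (forall k, `|z k - phi x| <= `|phi (h *: v + x) - phi x|) /\
    f (phi (h *: v + x)) - f (phi x) =
    \sum_k partial k f (z k) * (phi (h *: v + x) ord0 k - phi x ord0 k).
  by move=> h; have [z] := C1_increment (phi x) (phi (h *: v + x)) fC; exists z.
have zc k : z h k @[h --> 0^'] --> phi x.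
  apply/cvgrPdist_le => e e0.
  move/cvgrPdist_le : phic => /(_ e e0) H; near=> h.
  rewrite distrC; apply: (le_trans ((zP h).1 k)); rewrite distrC.
  by near: h.
have main : h^-1 *: ((f \o phi \o shift x) (h *: v) - (f \o phi) x) @[h --> 0^'] -->
    \sum_i partial i f (phi x) * w i.
  rewrite (_ : (fun h => _) = fun h => \sum_i partial i f (z h i) * q i h); last first.
    apply/funext => h /=; rewrite (zP h).2 scaler_sumr; apply: eq_bigr => i _.
    by rewrite /q scalerAr.
  apply: cvgr_sum => i; apply: cvgM (qw i).
  apply: (cvg_comp _ _ (zc i)); exact: (Ck_continuous (Ck_partial i fC)).
by apply: DeriveDef; [apply/cvg_ex; eexists; exact: main | exact/cvg_lim].
Unshelve. all: by end_near. Qed.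

Lemma continuous_rV (T : topologicalType) (phi : T -> 'rV[R]_n.+1) :
  (forall i, continuous (fun t => phi t ord0 i)) -> continuous phi.
Proof.
move=> phic x; apply/cvgrPdist_le => e e0.
have H i : \forall t \near x, `|phi x ord0 i - phi t ord0 i| <= e.
  by have /cvgrPdist_le/(_ e e0) := phic i x.
have {}H : \forall t \near x, forall i, `|phi x ord0 i - phi t ord0 i| <= e.
  exact: filter_forall.
near=> t; apply: norm_le_coord; first exact: ltW.
by move=> i; rewrite !mxE; move: i; near: t.
Unshelve. all: by end_near. Qed.

Lemma Ck_intro k f (df : 'I_n.+1 -> 'rV[R]_n.+1 -> R) :
  continuous f -> (forall x i, is_derive x (delta_mx ord0 i) f (df i x)) ->
  (forall i, Ck k (df i)) -> Ck k.+1 f.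
Proof.
move=> cf fd dfk; split => // i; split=> [x|]; first by have [] := fd x i.
by rewrite (_ : partial i f = df i) //; apply/funext => x; have [] := fd x i.
Qed.

Lemma Ck_cst k (c : R) : Ck k (fun _ : 'rV[R]_n.+1 => c).
Proof.
elim: k c => [|k ih] c; first exact: cst_continuous.
by apply: (@Ck_intro _ _ (fun _ _ => 0)) => //; exact: cst_continuous.
Qed.

Lemma is_derive_coord x v (j : 'I_n.+1) :
  is_derive x v (fun y => y ord0 j) (v ord0 j).
Proof.
have main : h^-1 *: (((fun y : 'rV[R]_n.+1 => y ord0 j) \o shift x) (h *: v) - x ord0 j)
    @[h --> 0^'] --> v ord0 j.
  apply/cvgrPdist_le => e e0; near=> h.
  have h0 : h != 0 by near: h; exact: nbhs_dnbhs_neq.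
  by rewrite /= !mxE addrK [_ *: _]mulrA mulVf// mul1r subrr normr0 ltW.
by apply: DeriveDef; [apply/cvg_ex; eexists; exact: main | exact/cvg_lim].
Unshelve. all: by end_near. Qed.

Lemma Ck_coord k (j : 'I_n.+1) : Ck k (fun x : 'rV[R]_n.+1 => x ord0 j).
Proof.
case: k => [|k]; first exact: coord_continuous.
apply: (@Ck_intro _ _ (fun i _ => (delta_mx ord0 i : 'rV[R]_n.+1) ord0 j)).
- exact: coord_continuous.
- by move=> x i; exact: is_derive_coord.
- by move=> i; exact: Ck_cst.
Qed.

Lemma CkD k f g : Ck k f -> Ck k g -> Ck k (fun x => f x + g x).
Proof.
elim: k f g => [|k ih] f g fk gk.
  by move=> x; apply: continuousD; [exact: fk | exact: gk].
apply: (@Ck_intro _ _ (fun i x => partial i f x + partial i g x)).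
- by move=> x; apply: continuousD; exact: (Ck_continuous (k := k.+1)).
- by move=> x i; apply: is_deriveD; exact: (Ck_is_derive (k := k)).
- by move=> i; apply: ih; exact: Ck_partial.
Qed.

Lemma CkM k f g : Ck k f -> Ck k g -> Ck k (fun x => f x * g x).
Proof.
elim: k f g => [|k ih] f g fk gk.
  by move=> x; apply: continuousM; [exact: fk | exact: gk].
apply: (@Ck_intro _ _ (fun i x => f x * partial i g x + g x * partial i f x)).
- by move=> x; apply: continuousM; exact: (Ck_continuous (k := k.+1)).
- by move=> x i; apply: is_deriveM; exact: (Ck_is_derive (k := k)).
- by move=> i; apply: CkD; apply: ih; [exact: CkS|exact: Ck_partial|
    exact: CkS|exact: Ck_partial].
Qed.

Lemma CkZ k c f : Ck k f -> Ck k (fun x => c * f x).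
Proof. exact: CkM (Ck_cst _ _). Qed.

Lemma CkN k f : Ck k f -> Ck k (fun x => - f x).
Proof.
by move=> /(CkZ (-1)); rewrite (_ : (fun x => _) = fun x => - f x) //;
   apply/funext => x; rewrite mulN1r.
Qed.

Lemma CkB k f g : Ck k f -> Ck k g -> Ck k (fun x => f x - g x).
Proof. by move=> fk gk; apply: CkD fk _; exact: CkN. Qed.

Lemma Ck_sum k (I : Type) (r : seq I) (P : pred I) (F : I -> 'rV[R]_n.+1 -> R) :
  (forall i, P i -> Ck k (F i)) -> Ck k (fun x => \sum_(i <- r | P i) F i x).
Proof.
move=> Fk; elim: r => [|i r ih].
  rewrite (_ : (fun x => _) = fun=> 0); first exact: Ck_cst.
  by apply/funext => x; rewrite big_nil.
have [Pi|Pi] := boolP (P i); last first.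
  by rewrite (_ : (fun x => _) = fun x => \sum_(i <- r | P i) F i x) //;
    apply/funext => x; rewrite big_cons (negPf Pi).
rewrite (_ : (fun x => _) = fun x => F i x + \sum_(i <- r | P i) F i x); last first.
  by apply/funext => x; rewrite big_cons Pi.
by apply: CkD => //; exact: Fk.
Qed.

Lemma Ck_prod k (I : Type) (r : seq I) (P : pred I) (F : I -> 'rV[R]_n.+1 -> R) :
  (forall i, P i -> Ck k (F i)) -> Ck k (fun x => \prod_(i <- r | P i) F i x).
Proof.
move=> Fk; elim: r => [|i r ih].
  rewrite (_ : (fun x => _) = fun=> 1); first exact: Ck_cst.
  by apply/funext => x; rewrite big_nil.
have [Pi|Pi] := boolP (P i); last first.
  by rewrite (_ : (fun x => _) = fun x => \prod_(i <- r | P i) F i x) //;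
    apply/funext => x; rewrite big_cons (negPf Pi).
rewrite (_ : (fun x => _) = fun x => F i x * \prod_(i <- r | P i) F i x); last first.
  by apply/funext => x; rewrite big_cons Pi.
by apply: CkM => //; exact: Fk.
Qed.

Lemma CkV k f : (forall x, f x != 0) -> Ck k f -> Ck k (fun x => (f x)^-1).
Proof.
move=> f0; elim: k => [|k ih] fk.
  by move=> x; apply: continuousV => //; exact: fk.
apply: (@Ck_intro _ _ (fun i x => - ((f x)^-1 * (f x)^-1) * partial i f x)).
- by move=> x; apply: continuousV => //; exact: (Ck_continuous fk).
- move=> x i; have fd := Ck_derivable (x := x) (i := i) fk.
  apply: DeriveDef; first exact: derivableV.
  by rewrite deriveV // -exprVn expr2 mulNr scaleNr.
- have := ih (CkS fk) => Vk i; apply: CkM; last exact: Ck_partial.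
  by apply: CkN; exact: CkM.
Qed.

(** Two mean value theorems: along [ei] for the difference of [f] between two parallel edges, then
    along [ej] for [partial i f]. The second difference is symmetric in [i] and [j], which is what
    [partialC] exploits. *)
Lemma second_difference f (i j : 'I_n.+1) x (h : R) : Ck 2 f ->
  exists2 y, `|y - x| <= `|h| + `|h| &
    f (h *: delta_mx ord0 i + (h *: delta_mx ord0 j + x))
      - f (h *: delta_mx ord0 i + x) - (f (h *: delta_mx ord0 j + x) - f x)
    = partial j (partial i f) y * h * h.
Proof.
move=> f2; have f1 := CkS f2; set ei := delta_mx ord0 i; set ej := delta_mx ord0 j.
have fi1 : Ck 1 (partial i f) by exact: Ck_partial.
have [c ch] := @MVT0 (fun t => f (t *: ei + (h *: ej + x)) - f (t *: ei + x))
  (fun t => partial i f (t *: ei + (h *: ej + x)) - partial i f (t *: ei + x)) h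
  (fun s => is_deriveB (line_is_derive (Ck_derivable f1)) (line_is_derive (Ck_derivable f1))).
rewrite !scale0r !add0r => ->.
have [c' c'h] := @MVT0 (fun t => partial i f (t *: ej + (c *: ei + x)))
  (fun t => partial j (partial i f) (t *: ej + (c *: ei + x))) h
  (fun s => line_is_derive (Ck_derivable fi1)).
rewrite !scale0r !add0r addrCA => ->.
exists (c' *: ej + (c *: ei + x)) => //.
rewrite [c' *: ej + _]addrA addrK.
apply: (le_trans (ler_normD _ _)).
have ne (k : 'I_n.+1) : `|delta_mx ord0 k : 'rV[R]_n.+1| <= 1.
  by apply: norm_le_coord => // l; rewrite !mxE eqxx /=; case: eqP; rewrite ?normr1 ?normr0.
by apply: lerD; rewrite normrZ -[leRHS]mulr1 ler_pM ?ne.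
Qed.

Lemma continuous_eq_at f g x : {for x, continuous f} -> {for x, continuous g} ->
  (forall d : R, 0 < d -> exists y z, [/\ `|y - x| <= d + d, `|z - x| <= d + d &
     f y = g z]) -> f x = g x.
Proof.
move=> fc gc fg.
apply/eqP; rewrite -subr_eq0 -normr_le0; apply/ler_addgt0Pr => e e0; rewrite add0r.
have e2 : 0 < e / 2 by rewrite divr_gt0.
have near_x (h : 'rV[R]_n.+1 -> R) : {for x, continuous h} -> \forall d \near (0 : R)^'+, forall y,
    `|y - x| <= d + d -> `|h x - h y| <= e / 2.
  move=> /cvgrPdist_le/(_ _ e2)/nbhs_normP[/= r r0 H].
  near=> d => y yd; apply: H => /=.
  rewrite distrC; apply: (le_lt_trans yd).
  by rewrite [ltRHS]splitr ltrD //; near: d; apply: nbhs_right_lt; rewrite divr_gt0.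
have near_xx := filterI (near_x f fc) (near_x g gc).
have : \forall d \near (0 : R)^'+, `|f x - g x| <= e.
  near=> d.
  have d0 : 0 < d by near: d; exact: nbhs_right_gt.
  have [Hf Hg] : (forall y, `|y - x| <= d + d -> `|f x - f y| <= e / 2) /\
    (forall y, `|y - x| <= d + d -> `|g x - g y| <= e / 2).
    by near: d; exact: near_xx.
  have [y [z [yd zd yz]]] := fg d d0.
  have := Hf y yd; have := Hg z zd; rewrite yz !ler_norml => /andP[? ?] /andP[? ?].
  by apply/andP; split; lra.
by move=> /filter_ex[].
Unshelve. all: by end_near. Qed.

(** Both mixed derivatives, taken at points within [d + d] of [x], equal the same second difference
    divided by d ^ 2; continuity does the rest. The symmetry serves in the divergence of the Piola
    transform. *)
Lemma partialC f i j : Ck 2 f -> partial i (partial j f) = partial j (partial i f).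
Proof.
move=> f2; apply/funext => x.
have cont k l : continuous (partial k (partial l f)).
  by apply: (@Ck_continuous 0); do 2 apply: Ck_partial.
apply: continuous_eq_at; [exact: cont|exact: cont|] => d d0.
have [y yd Ey] := second_difference i j x d f2.
have [z zd Ez] := second_difference j i x d f2.
exists z, y; rewrite (gtr0_norm d0) in yd zd; split; [exact: zd|exact: yd|].
apply: (mulIf (lt0r_neq0 d0)); apply: (mulIf (lt0r_neq0 d0)).
apply: etrans (esym Ez) _; apply: etrans _ Ey.
rewrite [in LHS]addrCA.
have sw (a b c e' : R) : a - b - (c - e') = a - c - (b - e') by ring.
exact: sw.
Qed.

End calculus.

Section composition.
Context {R : realType} {m n : nat}.
Implicit Types (f : 'rV[R]_n.+1 -> R) (phi : 'rV[R]_m.+1 -> 'rV[R]_n.+1).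

Lemma partial_comp phi f (j : 'I_m.+1) (x : 'rV[R]_m.+1) :
  (forall i, Ck 1 (fun x => phi x ord0 i)) -> Ck 1 f ->
  is_derive x (delta_mx ord0 j) (f \o phi)
    (\sum_i partial i f (phi x) * partial j (fun x => phi x ord0 i) x).
Proof.
by move=> phi1 f1; apply: is_derive_comp_C1 => // i; exact: (Ck_is_derive (k := 0)).
Qed.

Lemma Ck_comp k phi f :
  (forall i, Ck k (fun x => phi x ord0 i)) -> Ck k f -> Ck k (f \o phi).
Proof.
elim: k f => [|k ih] f phik fk.
  by move=> x; apply: continuous_comp; [exact: continuous_rV | exact: fk].
have phi1 i : Ck 1 (fun x => phi x ord0 i) by exact: Ck_le (phik i).
have f1 : Ck 1 f by exact: Ck_le fk.
apply: (@Ck_intro _ _ _ _ (fun j x => \sum_i (partial i f \o phi) x *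
    partial j (fun x => phi x ord0 i) x)).
- move=> x; apply: continuous_comp; last exact: (Ck_continuous fk).
  by apply: continuous_rV => i; exact: (Ck_continuous (phi1 i)).
- by move=> x j; exact: partial_comp.
- move=> j; apply: Ck_sum => i _; apply: CkM; last exact: Ck_partial.
  by apply: ih => [l|]; [exact: CkS|exact: Ck_partial].
Qed.

End composition.

(** * A smooth step function *)

Section smooth_step.
Context {R : realType}.

Lemma is_derive_lineP (V : normedModType R) (f : V -> R) (x v : V) (l : R) :
  is_derive x v f l <-> is_derive (0 : R) 1 (fun h => f (h *: v + x)) l.
Proof.
have e : (fun h : R => h^-1 *: (((fun t => f (t *: v + x)) \o shift 0) h%:A - f (0 *: v + x)))
  = (fun h : R => h^-1 *: ((f \o shift x) (h *: v) - f x)).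
  by apply/funext => h /=; rewrite [h%:A]mulr1 addr0 scale0r add0r.
by split=> -[d1 d2]; apply: DeriveDef; move: d1 d2; rewrite /derivable /derive e.
Qed.

Lemma is_derive_comp1 (V : normedModType R) (f : V -> R) (g : R -> R) (x v : V)
    (df dg : R) :
  is_derive x v f df -> is_derive (f x) 1 g dg ->
  is_derive x v (g \o f) (dg * df).
Proof.
move=> /is_derive_lineP fd gd; apply/is_derive_lineP.
rewrite (_ : (fun h : R => _) = g \o (fun h => f (h *: v + x))) //.
by apply: is_derive1_comp; rewrite scale0r add0r.
Qed.

(** [flat 0] is the usual exp (-1/y) extended by 0. The powers of 1/y make the family stable under
    derivation, see [dflat], so that smoothness follows by one induction for all [m]. *)
Definition flat (m : nat) (y : R) : R :=
  if 0 < y then y^-1 ^+ m * expR (- y^-1) else 0.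

Lemma flat_le0 m y : y <= 0 -> flat m y = 0.
Proof. by rewrite /flat leNgt => /negPf ->. Qed.

Lemma flatE m y : 0 < y -> flat m y = y^-1 ^+ m * expR (- y^-1).
Proof. by rewrite /flat => ->. Qed.

Lemma flat_gt0 m y : 0 < y -> 0 < flat m y.
Proof. by move=> y0; rewrite flatE // mulr_gt0 ?expR_gt0 ?exprn_gt0 ?invr_gt0. Qed.

Lemma flat_ge0 m y : 0 <= flat m y.
Proof. by have [/flat_le0->//|y0] := leP y 0; exact/ltW/flat_gt0. Qed.

(** From exp u >= (u / (m + 2)) ^ (m + 2) with u = 1/y. The quadratic bound makes the derivative at
    0 vanish. *)
Lemma flat_bound m y : flat m y <= m.+2%:R ^+ m.+2 * y ^+ 2.
Proof.
have [y0|y0] := leP y 0; first by rewrite flat_le0 // mulr_ge0 ?sqr_ge0 // exprn_ge0.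
rewrite flatE //.
have u0 : 0 < y^-1 by rewrite invr_gt0.
suff H : y^-1 ^+ m.+2 * expR (- y^-1) <= m.+2%:R ^+ m.+2.
  apply: le_trans (ler_wpM2r (sqr_ge0 _) H).
  have e : y^-1 ^+ m.+2 * y ^+ 2 = y^-1 ^+ m.
    by rewrite -addn2 exprD -mulrA -exprMn mulVf ?gt_eqF // expr1n mulr1.
  by rewrite mulrAC e.
rewrite expRN ler_pdivrMr ?expR_gt0 //.
have -> : expR y^-1 = expR (y^-1 / m.+2%:R) ^+ m.+2.
  by rewrite -expRM_natl -mulr_natl mulrCA divff ?mulr1 // pnatr_eq0.
rewrite -exprMn lerXn2r ?nnegrE ?mulr_ge0 ?expR_ge0 ?(ltW u0) //.
rewrite -ler_pdivrMl ?ltr0n // mulrC.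
by apply: le_trans (expR_ge1Dx _); rewrite lerDr.
Qed.

Definition dflat (m : nat) (y : R) : R := flat m.+2 y - m%:R * flat m.+1 y.

Lemma is_derive_flat m (y : R) : is_derive y 1 (flat m) (dflat m y).
Proof.
have [y0|y0|->] := ltgtP y 0.
- apply: (@near_eq_is_derive _ _ _ (cst 0)) => //.
    near=> z; rewrite flat_le0 //; apply: ltW; near: z; exact: lt_nbhsl.
  by apply: is_derive_eq; rewrite /dflat !flat_le0 ?ltW // mulr0 subr0.
- apply: (@near_eq_is_derive _ _ _ (fun z : R => z^-1 ^+ m * expR (- z^-1))) => //.
    near=> z; rewrite flatE //; near: z; exact: lt_nbhsr.
  have dV : is_derive y 1 (fun z : R => z^-1) (- (y^-1 ^+ 2)).
    apply: DeriveDef; first by apply: derivableV => //; rewrite gt_eqF.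
    by rewrite deriveV ?gt_eqF // derive_id exprVn [_ *: _]mulr1.
  have dE : is_derive y 1 (fun z : R => expR (- z^-1)) (expR (- y^-1) * y^-1 ^+ 2).
    rewrite -[X in _ * X]opprK; apply: (is_derive1_comp (f := expR)).
  have dX : is_derive y 1 (fun z : R => z^-1 ^+ m) ((m%:R * y^-1 ^+ m.-1) *: (- (y^-1 ^+ 2))).
    by rewrite -[X in is_derive _ _ X _]/(fun z : R => _) -(exprfctE (fun z : R => z^-1)); exact: is_deriveX.
  apply: is_derive_eq; rewrite /dflat !flatE // /GRing.scale /=.
  case: m dX => [|m] _ /=; rewrite ?exprS ?expr0.
    ring.
  ring.
- rewrite /dflat !flat_le0 // mulr0 subr0.
  have main : h^-1 *: ((flat m \o shift 0) (h *: 1) - flat m 0) @[h --> (0:R)^'] --> (0 : R).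
    apply/cvgr0Pnorm_le => e e0; near=> h.
    have h0 : h != 0 by near: h; exact: nbhs_dnbhs_neq.
    rewrite /= addr0 [h%:A]mulr1 (flat_le0 m (lexx 0)) subr0 normrZ normfV.
    rewrite ler_pdivrMl ?normr_gt0 // ger0_norm ?flat_ge0 //.
    apply: (le_trans (flat_bound _ _)).
    rewrite -(real_normK (num_real h)) expr2 mulrCA ler_wpM2l //.
    rewrite mulrC -ler_pdivlMr ?exprn_gt0 //.
    near: h; apply: dnbhs0_le; by rewrite divr_gt0 ?exprn_gt0.
  by apply: DeriveDef; [apply/cvg_ex; eexists; exact: main | exact/cvg_lim].
Unshelve. all: by end_near. Qed.

Lemma continuous_flat m : continuous (flat m).
Proof.
move=> y; apply/differentiable_continuous/derivable1_diffP.
by have [] := is_derive_flat m y.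
Qed.

Definition step (y : R) : R := flat 0 y / (flat 0 y + flat 0 (1 - y)).

Lemma step_den_gt0 y : 0 < flat 0 y + flat 0 (1 - y).
Proof.
have [y0|y0] := leP y 0; last by rewrite ltr_pwDl ?flat_gt0 ?flat_ge0.
by rewrite ltr_wpDl ?flat_ge0 // flat_gt0 // subr_gt0 (le_lt_trans y0).
Qed.

Lemma step_le0 y : y <= 0 -> step y = 0.
Proof. by move=> y0; rewrite /step flat_le0 // mul0r. Qed.

Lemma step_ge1 y : 1 <= y -> step y = 1.
Proof.
move=> y1; rewrite /step [X in _ / (_ + X)]flat_le0 ?subr_le0 // addr0 divff //.
by rewrite gt_eqF // flat_gt0 // (lt_le_trans ltr01).
Qed.

Lemma step_ge0 y : 0 <= step y.
Proof. by rewrite divr_ge0 ?flat_ge0 // ltW ?step_den_gt0. Qed.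

Lemma step_le1 y : step y <= 1.
Proof. by rewrite ler_pdivrMr ?step_den_gt0 // mul1r lerDl flat_ge0. Qed.

Definition dstep (y : R) : R :=
  let d := flat 0 y + flat 0 (1 - y) in
  flat 0 y * (- (d^-1 * d^-1) * (dflat 0 y - dflat 0 (1 - y))) + d^-1 * dflat 0 y.

Lemma is_derive_step (y : R) : is_derive y 1 step (dstep y).
Proof.
have d0 z : flat 0 z + flat 0 (1 - z) != 0 by rewrite gt_eqF ?step_den_gt0.
have d1 : is_derive y 1 (fun z : R => flat 0 (1 - z)) (- dflat 0 (1 - y)).
  have : is_derive y 1 (fun z : R => 1 - z) (- 1).
    by rewrite -[- 1]sub0r; exact: (is_deriveB (is_derive_cst (1 : R) y 1) (is_derive_id y 1)).
  move=> H; have := is_derive_flat 0 (1 - y) => /(is_derive_comp1 H).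
  by rewrite mulrN1.
have dD : is_derive y 1 (fun z : R => flat 0 z + flat 0 (1 - z))
    (dflat 0 y - dflat 0 (1 - y)).
  by apply: is_deriveD => //; exact: is_derive_flat.
have dV : is_derive y 1 (fun z : R => (flat 0 z + flat 0 (1 - z))^-1)
   (- ((flat 0 y + flat 0 (1 - y))^-1 * (flat 0 y + flat 0 (1 - y))^-1) *
     (dflat 0 y - dflat 0 (1 - y))).
  apply: DeriveDef; first by apply: derivableV => //; case: dD.
  rewrite deriveV //.
  rewrite -exprVn expr2.
  by have [_ ->] := dD. 
by apply: (is_deriveM (is_derive_flat 0 y) dV).
Qed.

Lemma dstep_le0 y : y <= 0 -> dstep y = 0.
Proof.
by move=> y0; rewrite /dstep /dflat !(flat_le0 _ y0) !(mul0r,mulr0,add0r,oppr0).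
Qed.

Lemma dstep_ge1 y : 1 <= y -> dstep y = 0.
Proof.
move=> y1; have y1' : 1 - y <= 0 by rewrite subr_le0.
have fy : flat 0 y != 0 by rewrite gt_eqF // flat_gt0 // (lt_le_trans ltr01).
rewrite /dstep /dflat !(flat_le0 _ y1') !(mul0r,mulr0,subr0,addr0).
by rewrite mulNr mulrN !mulrA divff // mul1r addNr.
Qed.

(** [dstep] is continuous and vanishes outside [0, 1]. The bound enters the cost of every cut. *)
Lemma dstep_bounded : exists2 K : R, 0 < K & forall y, `|dstep y| <= K.
Proof.
have cV : continuous (fun y : R => (flat 0 y + flat 0 (1 - y))^-1).
  move=> y; apply: (@continuousV R R (fun y : R => flat 0 y + flat 0 (1 - y))).
    by rewrite gt_eqF ?step_den_gt0.
  apply: continuousD; first exact: continuous_flat.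
  apply: continuous_comp; last exact: continuous_flat.
  by apply: continuousB => //; exact: cst_continuous.
have cd : continuous (dflat 0).
  by move=> y; apply: continuousB; [exact: continuous_flat|apply: continuousM;
    [exact: cst_continuous|exact: continuous_flat]].
have cd1 : continuous (fun y : R => dflat 0 (1 - y)).
  move=> y; apply: (@continuous_comp _ _ _ (fun y : R => 1 - y) (dflat 0)); last exact: cd.
  by apply: continuousB => //; exact: cst_continuous.
have cs : continuous dstep.
  pose V (y : R) := (flat 0 y + flat 0 (1 - y))^-1.
  move=> y.
  apply: (@continuousD _ _ _ (fun y => flat 0 y * (- (V y * V y) *
    (dflat 0 y - dflat 0 (1 - y)))) (fun y => V y * dflat 0 y)).
    apply: (@continuousM _ _ (flat 0)); first exact: continuous_flat.
    apply: (@continuousM _ _ (fun y => - (V y * V y))).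
      by apply: (@continuousN _ _ _ (fun y => V y * V y)); apply: continuousM; exact: cV.
    by apply: (@continuousB _ _ _ (dflat 0)); [exact: cd|exact: cd1].
  by apply: (@continuousM _ _ V); [exact: cV|exact: cd].
have cns : continuous (fun y => `|dstep y|).
  by move=> y; apply: (@continuous_comp _ _ _ dstep); [exact: cs|exact: norm_continuous].
have [c _ H] := @EVT_max R (fun y => `|dstep y|) 0 1 ler01 (continuous_subspaceT cns).
exists (`|dstep c| + 1); first by rewrite ltr_wpDl.
move=> y; have [y0|y0] := ltP y 0.
  by rewrite dstep_le0 ?normr0 ?addr_ge0 // ltW.
have [y1|y1] := leP y 1.
  by apply: (le_trans (H y _)); rewrite ?lerDl // in_itv /= y0.
by rewrite dstep_ge1 ?normr0 ?addr_ge0 // ltW.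
Qed.

Context {n : nat}.
Implicit Types f : 'rV[R]_n.+1 -> R.

Lemma Ck_flat k m f : Ck k f -> Ck k (fun x => flat m (f x)).
Proof.
elim: k m f => [|k ih] m f fk.
  by move=> x; apply: continuous_comp; [exact: fk|exact: continuous_flat].
have cf := Ck_continuous fk.
apply: (@Ck_intro _ _ _ _ (fun i x => dflat m (f x) * partial i f x)).
- by move=> x; apply: continuous_comp; [exact: cf|exact: continuous_flat].
- move=> x i; apply: is_derive_comp1; last exact: is_derive_flat.
  exact: (Ck_is_derive (k := k)).
- move=> i; apply: CkM; last exact: Ck_partial.
  have fk' := CkS fk.
  by apply: CkB; [exact: ih|apply: CkZ; exact: ih].
Qed.

Lemma Ck_step k f : Ck k f -> Ck k (fun x => step (f x)).
Proof.
move=> fk; apply: CkM; first exact: Ck_flat.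
apply: CkV; first by move=> x; rewrite gt_eqF ?step_den_gt0.
apply: CkD; apply: Ck_flat => //.
by apply: CkB => //; exact: Ck_cst.
Qed.

End smooth_step.

(** * Lebesgue measure of row vectors *)

Section lebesgue_basics.
Context {R : realType} {n : nat}.
Implicit Types (A B X : set 'rV[R]_n.+1) (p : 'rV[R]_n.+1 * 'rV[R]_n.+1).
Local Notation mu := (@lebesgue R n).
Local Notation meas := (@lebesgue_measurable R n).
Local Open Scope ereal_scope.

(** Translations ([c = 1]), midpoint maps and the rays towards a point are all instances, so one
    scaling law serves them all. *)
Definition hom (c : R) (v x : 'rV[R]_n.+1) : 'rV[R]_n.+1 := (c *: x + v)%R.

Lemma homK c v : (c != 0)%R -> cancel (hom c v) (hom c^-1 (- (c^-1 *: v))%R).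
Proof.
by move=> c0 x; rewrite /hom scalerDr scalerA mulVf // scale1r addrK.
Qed.

Lemma homVK c v : (c != 0)%R -> cancel (hom c^-1 (- (c^-1 *: v))%R) (hom c v).
Proof.
by move=> c0 x; rewrite /hom scalerBr !scalerA divff // !scale1r subrK.
Qed.

Lemma hom_image c v A : (c != 0)%R ->
  hom c v @` A = hom c^-1 (- (c^-1 *: v))%R @^-1` A.
Proof.
move=> c0; apply/seteqP; split=> [_ [x Ax <-]|x Ax] /=; first by rewrite homK.
by exists (hom c^-1 (- (c^-1 *: v))%R x) => //; rewrite homVK.
Qed.

Lemma box_volume_ge0 p : (0 <= box_volume p)%R.
Proof. by apply: prodr_ge0 => i _; rewrite le_max lexx. Qed.

Lemma lebesgue_le A B : A `<=` B -> mu A <= mu B.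
Proof. exact: le_outer_measure. Qed.

Lemma lebesgue_cover A (B : nat -> 'rV[R]_n.+1 * 'rV[R]_n.+1) :
  A `<=` \bigcup_k box (B k) -> mu A <= \sum_(k <oo) (box_volume (B k))%:E.
Proof. by move=> AB; apply: ereal_inf_lbound; exists B. Qed.

Lemma lebesgue_lb A (x : \bar R) :
  (forall B : nat -> 'rV[R]_n.+1 * 'rV[R]_n.+1, A `<=` \bigcup_k box (B k) ->
    x <= \sum_(k <oo) (box_volume (B k))%:E) -> x <= mu A.
Proof. by move=> H; apply: le_ereal_inf_tmp => _ [B AB <-]; exact: H. Qed.

(** A homothety of positive ratio maps boxes to boxes, hence covers to covers; the same bound for
    the inverse homothety gives the equality in [lebesgue_hom_image]. *)
Lemma lebesgue_hom_le c v A : (0 < c)%R ->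
  mu (hom c v @` A) <= (c ^+ n.+1)%:E * mu A.
Proof.
move=> c0; rewrite -lee_pdivrMl ?exprn_gt0 //; apply: lebesgue_lb => B AB.
rewrite lee_pdivrMl ?exprn_gt0 // -nneseriesZl; last first.
  by move=> k _; rewrite lee_fin box_volume_ge0.
pose B' k := (hom c v (B k).1, hom c v (B k).2).
apply: (@le_trans _ _ (\sum_(k <oo) (box_volume (B' k))%:E)).
  apply: lebesgue_cover => _ [x Ax <-]; have [k _ Bk] := AB x Ax.
  exists k => // i; have /andP[a b] := Bk i.
  by rewrite !mxE ltrD2r lerD2r ltr_pM2l // ler_pM2l // a.
apply: lee_nneseries => [k _ _|k _]; first by rewrite lee_fin box_volume_ge0.
rewrite -EFinM lee_fin /box_volume.
have -> : (c ^+ n.+1 = \prod_(i < n.+1) c)%R by rewrite prodr_const card_ord.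
rewrite -big_split /=; apply: ler_prod => i _; rewrite le_max lexx /=.
rewrite (maxr_pMr _ _ (ltW c0)) mulr0 !mxE.
by rewrite (_ : _ - _ = c * ((B k).2 ord0 i - (B k).1 ord0 i))%R //; ring.
Qed.

Lemma lebesgue_hom_image c v A : (0 < c)%R ->
  mu (hom c v @` A) = (c ^+ n.+1)%:E * mu A.
Proof.
move=> c0; apply/eqP; rewrite eq_le lebesgue_hom_le //=.
have cV0 : (0 < c^-1)%R by rewrite invr_gt0.
have := lebesgue_hom_le (- (c^-1 *: v))%R (hom c v @` A) cV0.
rewrite (_ : _ @` (_ @` _) = A); last first.
  rewrite image_comp (_ : _ \o _ = id) ?image_id //.
  by apply/funext => x /=; rewrite homK ?gt_eqF.
by rewrite exprVn -lee_pdivrMl ?invr_gt0 ?exprn_gt0 // invrK.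
Qed.

Lemma lebesgue_hom_preimage c v A : (0 < c)%R ->
  mu (hom c v @^-1` A) = (c ^- n.+1)%:E * mu A.
Proof.
move=> c0; have cV0 : (0 < c^-1)%R by rewrite invr_gt0.
rewrite -exprVn -(lebesgue_hom_image (- (c^-1 *: v))%R) //; congr (mu _).
rewrite hom_image ?gt_eqF // invrK.
rewrite (_ : (- _)%R = v) //.
by rewrite scalerN opprK scalerA divff ?scale1r ?gt_eqF.
Qed.

(** The scaling law holds for the outer measure of every set, so the Caratheodory condition of the
    preimage on the test set [X] is that of [A] on the image [Y] of [X]. *)
Lemma measurable_hom c v A : (0 < c)%R -> meas A -> meas (hom c v @^-1` A).
Proof.
move=> c0 mA; apply: le_caratheodory_measurable => X.
have c00 : c != 0%R by rewrite gt_eqF.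
pose Y := hom c v @` X.
have XY : X = hom c v @^-1` Y.
  apply/seteqP; split=> [x Xx|x [y Xy] /(can_inj (homK v c00)) <-//].
  by exists x.
have H B : lebesgue_outer (hom c v @^-1` B) = (c ^- n.+1)%:E * lebesgue_outer B.
  exact: lebesgue_hom_preimage.
have e1 : X `&` hom c v @^-1` A = hom c v @^-1` (Y `&` A) by rewrite preimage_setI -XY.
have e2 : X `&` ~` (hom c v @^-1` A) = hom c v @^-1` (Y `&` ~` A).
  by rewrite preimage_setI -XY preimage_setC.
have eX : lebesgue_outer X = (c ^- n.+1)%:E * lebesgue_outer Y by rewrite -H -XY.
change (lebesgue_outer (X `&` hom c v @^-1` A) +
  lebesgue_outer (X `&` ~` (hom c v @^-1` A)) <= lebesgue_outer X).
rewrite e1 e2 eX !H -ge0_muleDr ?outer_measure_ge0 //.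
by apply: lee_wpmul2l; [rewrite lee_fin invr_ge0 exprn_ge0 // ltW|rewrite -(mA Y)].
Qed.

(** The hyperplane splits each box of a cover of [X] into the boxes [B1 k] and [B2 k], possibly
    empty, whose volumes add up to at most that of the original. *)
Lemma measurable_halfspace_le i (t : R) : meas [set x | x ord0 i <= t]%R.
Proof.
apply: le_caratheodory_measurable => X; apply: lebesgue_lb => B XB.
pose B1 k := ((B k).1, \row_j (if j == i then Num.min ((B k).2 ord0 j) t
  else (B k).2 ord0 j))%R.
pose B2 k := ((\row_j (if j == i then Num.max ((B k).1 ord0 j) t
  else (B k).1 ord0 j))%R, (B k).2).
apply: (@le_trans _ _ (\sum_(k <oo) (box_volume (B1 k))%:E +
    \sum_(k <oo) (box_volume (B2 k))%:E)).
  apply: leeD; apply: lebesgue_cover => x [Xx /= xt];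
    have [k _ Bk] := XB x Xx; exists k => // j; have /andP[a b] := Bk j.
    rewrite !mxE a /=; case: eqP => // ->.
    by rewrite le_min xt andbT; have /andP[] := Bk i.
  rewrite !mxE b andbT; case: eqP => // ->.
  rewrite gt_max; have /andP[-> _] := Bk i.
  by rewrite ltNge; exact/negP.
rewrite -nneseriesD; [|by move=> *; rewrite lee_fin box_volume_ge0..].
apply: lee_nneseries => [k _ _|k _].
  by rewrite -EFinD lee_fin addr_ge0 ?box_volume_ge0.
rewrite -EFinD lee_fin /box_volume (bigD1 i) //= [X in (_ + X <= _)%R](bigD1 i) //=.
rewrite [leRHS](bigD1 i) //=.
rewrite (eq_bigr (fun j => Num.max 0 ((B k).2 ord0 j - (B k).1 ord0 j))%R); last first.
  by move=> j /negPf ji; rewrite !mxE ji.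
rewrite [X in (_ + _ * X <= _)%R](eq_bigr (fun j => Num.max 0 ((B k).2 ord0 j - (B k).1 ord0 j))%R); last first.
  by move=> j /negPf ji; rewrite !mxE ji.
rewrite -mulrDl ler_wpM2r //; first by apply: prodr_ge0 => j _; rewrite le_max lexx.
rewrite !mxE eqxx /=.
move: ((B k).1 ord0 i) ((B k).2 ord0 i) => a b.
have [bt|tb] := leP b t.
  have h : (b - Num.max a t <= 0)%R by rewrite subr_le0 le_max bt orbT.
  by rewrite (max_l h) addr0.
have [a_t|ta] := leP a t.
  have h1 : (0 <= t - a)%R by rewrite subr_ge0.
  have h2 : (0 <= b - t)%R by rewrite subr_ge0 ltW.
  by rewrite (max_r h1) (max_r h2) le_max addrC subrKA lexx orbT.
have h : (t - a <= 0)%R by rewrite subr_le0 ltW.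
by rewrite (max_l h) add0r.
Qed.

Lemma measurable_halfspace_lt i (t : R) : meas [set x | t < x ord0 i]%R.
Proof.
rewrite (_ : mkset _ = ~` [set x | x ord0 i <= t]%R).
  exact/measurableC/measurable_halfspace_le.
by apply/seteqP; split=> x /=; rewrite ltNge => /negP.
Qed.

Lemma measurable_box p : meas (box p).
Proof.
rewrite (_ : box p = \bigcap_(i in [set: 'I_n.+1])
  ([set x | p.1 ord0 i < x ord0 i] `&` [set x | x ord0 i <= p.2 ord0 i])%R).
  apply: fin_bigcap_measurable => // i _; apply: measurableI.
    exact: measurable_halfspace_lt.
  exact: measurable_halfspace_le.
apply/seteqP; split=> x /= H i.
  by move=> _; have /andP[] := H i.
by have [/= -> ->] := H i I.
Qed.

Lemma open_bigcup_box A : open A ->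
  exists B : nat -> 'rV[R]_n.+1 * 'rV[R]_n.+1, A = \bigcup_k box (B k).
Proof.
move=> oA.
pose rbox (q : 'rV[rat]_n.+1 * 'rV[rat]_n.+1) : 'rV[R]_n.+1 * 'rV[R]_n.+1 :=
  (map_mx ratr q.1, map_mx ratr q.2).
(* Enumeration of the boxes with rational corners that lie in [A]; every other code is sent to (0,
   0), the empty box. *)
pose B k := if @unpickle ('rV[rat]_n.+1 * 'rV[rat]_n.+1)%type k is Some q then
  if pselect (box (rbox q) `<=` A) then rbox q else (0, 0)%R else (0, 0)%R.
have box00 x : ~ box ((0, 0)%R : 'rV[R]_n.+1 * 'rV[R]_n.+1) x.
  by move=> /(_ ord0) /=; rewrite !mxE => /andP[h1 h2]; have := lt_le_trans h1 h2; rewrite ltxx.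
exists B; apply/seteqP; split=> [x Ax|x [k _]]; last first.
  rewrite /B; case: unpickle => [q|/box00//].
  by case: pselect => [qA /qA|nqA /box00].
have /nbhs_normP[/= e e0 eA] : nbhs x A by move: oA; rewrite openE; exact.
have /choice[a aP] : forall i, exists q : rat, ratr q \in `](x ord0 i - e)%R, x ord0 i[.
  by move=> i; apply: rat_in_itvoo; rewrite gtrBl.
have /choice[b bP] : forall i, exists q : rat, ratr q \in `]x ord0 i, (x ord0 i + e)%R[.
  by move=> i; apply: rat_in_itvoo; rewrite ltrDl.
exists (pickle (\row_i a i, \row_i b i)) => //; rewrite /B pickleK.
case: pselect => [hq|[]].
  move=> i; rewrite !mxE.
  have := aP i; have := bP i; rewrite !in_itv /= => /andP[h1 _] /andP[_ h2].
  by apply/andP; split; [exact: h2|exact: ltW h1].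
move=> y yb; apply: eA => /=.
have : forall i, (`|x ord0 i - y ord0 i| < e)%R.
  move=> i; have := yb i; rewrite !mxE.
  have := aP i; have := bP i; rewrite !in_itv /= => /andP[? ?] /andP[? ?] /andP[? ?].
  by rewrite ltr_norml; apply/andP; split; lra.
move=> H; rewrite [ltLHS]/Num.Def.normr /= mx_normrE; apply: bigmax_lt => // -[j i] _ /=.
by rewrite (ord1 j) !mxE.
Qed.

Lemma measurable_open A : open A -> meas A.
Proof.
move=> /open_bigcup_box[B ->]; apply: bigcupT_measurable => k.
exact: measurable_box.
Qed.

Lemma measurable_closed A : closed A -> meas A.
Proof.
move=> cA; rewrite -(setCK A); apply: measurableC; apply: measurable_open.
exact: closed_openC.
Qed.

Lemma measurable_compact A : compact A -> meas A.
Proof.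
move=> cA; apply: measurable_closed; apply: compact_closed cA.
exact: norm_hausdorff.
Qed.

Lemma lebesgue_box_le p : mu (box p) <= (box_volume p)%:E.
Proof.
pose B k := if k == 0%N then p else (0, 0)%R.
apply: (@le_trans _ _ (\sum_(k <oo) (box_volume (B k))%:E)).
  by apply: lebesgue_cover => x px; exists 0%N.
rewrite nneseries_recl //; last by move=> k _; rewrite lee_fin box_volume_ge0.
rewrite eseries0 ?adde0 // => k k0 _.
rewrite /B eqn0Ngt k0 /= /box_volume big_ord_recl /= subrr.
by rewrite /Order.max ltxx mul0r.
Qed.

Lemma lebesgue_bounded A : bounded_set A -> mu A < +oo.
Proof.
move=> [M [Mr MA]].
have H x : A x -> (`|x| <= `|M| + 1)%R.
  by apply: (MA (`|M| + 1)%R); rewrite (le_lt_trans (ler_norm M)) // ltrDl.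
apply: (@le_lt_trans _ _ (mu (box (const_mx (- (`|M| + 2))%R, const_mx (`|M| + 1)%R)))).
  apply: lebesgue_le => x /H xM i; rewrite !mxE.
  have := le_trans (coord_le_norm x i) xM; rewrite ler_norml => /andP[? ?].
  by apply/andP; split; lra.
by apply: (le_lt_trans (lebesgue_box_le _)); rewrite ltry.
Qed.

End lebesgue_basics.

(** * Regularity of Lebesgue measure *)

Section lebesgue_regularity.
Context {R : realType} {n : nat}.
Implicit Types (A B D X : set 'rV[R]_n.+1) (p : 'rV[R]_n.+1 * 'rV[R]_n.+1).
Local Notation mu := (@lebesgue R n).
Local Notation meas := (@lebesgue_measurable R n).
Local Open Scope ereal_scope.

Lemma bounded_closed_ball0 (r : R) : bounded_set [set x : 'rV[R]_n.+1 | `|x| <= r]%R.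
Proof.
exists r; split; first exact: num_real.
by move=> y ry x /= /le_trans; apply; exact: ltW.
Qed.

Lemma bounded_subset A B : A `<=` B -> bounded_set B -> bounded_set A.
Proof.
by move=> AB [M [Mr MB]]; exists M; split=> // y My x Ax; apply: MB My _ _; exact: AB.
Qed.

Lemma closed_norm_le (r : R) : closed [set x : 'rV[R]_n.+1 | `|x| <= r]%R.
Proof.
rewrite (_ : mkset _ = (fun x : 'rV[R]_n.+1 => `|x|%R) @^-1` [set y : R | y <= r]%R) //.
by apply: closed_comp; [move=> x _; exact: norm_continuous|exact: closed_le].
Qed.

(** Required for the product measure to which Tonelli is applied in [section_bound]. *)
Lemma lebesgue_sigma_finite : sigma_finite setT mu.
Proof.
exists (fun k => [set x : 'rV[R]_n.+1 | `|x| <= k%:R]%R).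
  apply/seteqP; split=> // x _.
  exists (Num.truncn `|x|).+1 => //=; rewrite ltW //.
  exact: truncnS_gt.
move=> k; split; first by apply: measurable_closed; exact: closed_norm_le.
by apply: lebesgue_bounded; exact: bounded_closed_ball0.
Qed.

HB.instance Definition _ := @Measure_isSigmaFinite.Build _
  (caratheodory_type (@lebesgue_outer R n)) R mu lebesgue_sigma_finite.

Lemma box_volume_enlarge p (e : R) : (0 < e)%R -> exists2 d : R, (0 < d)%R &
  (box_volume (p.1, p.2 + const_mx d) <= box_volume p + e)%R.
Proof.
move=> e0.
have H : box_volume (p.1, p.2 + const_mx d)%R @[d --> (0:R)%R] --> box_volume p.
  rewrite /box_volume; apply: (@cvg_big _ _ _ _ xpredT mul_continuous) => i _ /=.
  have -> : (p.2 ord0 i - p.1 ord0 i = p.2 ord0 i + 0 - p.1 ord0 i)%R by rewrite addr0.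
  have E (d : R) : ((p.2 + const_mx d)%R ord0 i = p.2 ord0 i + d)%R by rewrite !mxE.
  under eq_fun do rewrite E.
  apply: (@continuous_max R R (fun=> 0%R) (fun d : R => p.2 ord0 i + d - p.1 ord0 i)%R 0%R).
    exact: cvg_cst.
  apply: cvgB; last exact: cvg_cst.
  by apply: cvgD; [exact: cvg_cst|exact: cvg_id].
have {}H : box_volume (p.1, p.2 + const_mx d)%R @[d --> (0:R)^'+%R] --> box_volume p.
  exact: cvg_at_right_filter.
have : \forall d \near (0:R)^'+%R, (0 < d)%R /\ (box_volume (p.1, p.2 + const_mx d) <= box_volume p + e)%R.
  near=> d; split; first by near: d; exact: nbhs_right_gt.
  rewrite -lerBlDl; apply: le_trans (ler_norm _) _; rewrite distrC.
  by near: d; move/cvgrPdist_le : H; exact.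
by move=> /filter_ex[d [d0 dH]]; exists d.
Unshelve. all: by end_near. Qed.

Definition obox p : set 'rV[R]_n.+1 :=
  [set x | forall i, p.1 ord0 i < x ord0 i < p.2 ord0 i]%R.

Lemma open_obox p : open (obox p).
Proof.
rewrite openE => x /= px.
have H i : \forall y \near x, (p.1 ord0 i < (y : 'rV[R]_n.+1) ord0 i < p.2 ord0 i)%R.
  have /andP[a b] := px i.
  have c : (y : 'rV[R]_n.+1) ord0 i @[y --> x] --> x ord0 i by exact: coord_continuous.
  near=> y; apply/andP; split; near: y.
  - exact: cvgr_gt c _ a.
  - exact: cvgr_lt c _ b.
exact: (@filter_forall _ _ _ _ _ H).
Unshelve. all: by end_near. Qed.

(** Start from a cover of [A] within [e / 2] of the infimum and push out the upper corner of its
    [k]-th box so that the volume grows by at most (e / 2) / 2 ^ (k + 1); the open boxes so obtained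
    still cover [A]. *)
Lemma outer_regular A (e : R) : (0 < e)%R ->
  exists O, [/\ open O, A `<=` O & mu O <= mu A + e%:E].
Proof.
move=> e0; have [Aoo|Afin] := eqVneq (mu A) +oo.
  by exists setT; split => //; [exact: openT|rewrite Aoo addye // leey].
have Af : mu A \is a fin_num by rewrite ge0_fin_numE ?outer_measure_ge0 // ltey.
have e2 : (0 < e / 2)%R by rewrite divr_gt0.
have [_ [B AB <-] /ltW BA] := lb_ereal_inf_adherent e2 Af.
have ek k : (0 < (e / 2) / (2 ^ k.+1)%:R)%R by rewrite divr_gt0 // ltr0n expn_gt0.
have /choice[d dP] : forall k, exists d : R, (0 < d)%R /\
    (box_volume ((B k).1, (B k).2 + const_mx d) <= box_volume (B k) + (e / 2) / (2 ^ k.+1)%:R)%R.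
  by move=> k; have [d] := box_volume_enlarge (B k) (ek k); exists d.
pose O k := obox ((B k).1, (B k).2 + const_mx (d k))%R.
exists (\bigcup_k O k); split.
- apply: bigcup_open => k _; exact: open_obox.
- move=> x /AB[k _ Bk]; exists k => // i; have /andP[-> b] := Bk i.
  by rewrite /= !mxE (le_lt_trans b) // ltrDl (dP k).1.
- apply: (@le_trans _ _ (\sum_(k <oo) (box_volume ((B k).1, (B k).2 + const_mx (d k))%R)%:E)).
    apply: lebesgue_cover => x [k _ Ok]; exists k => // i; have /andP[a b] := Ok i.
    by rewrite a /= ltW.
  apply: (@le_trans _ _ (\sum_(k <oo) ((box_volume (B k))%:E + ((e / 2) / (2 ^ k.+1)%:R)%:E))).
    apply: lee_nneseries => [k _ _|k _]; first by rewrite lee_fin box_volume_ge0.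
    by rewrite -EFinD lee_fin (dP k).2.
  apply: le_trans (epsilon_trick xpredT _ (ltW e2)) _.
    by move=> k; rewrite lee_fin box_volume_ge0.
  rewrite [in X in _ <= X](splitr e) EFinD addeA leeD2r //.
Qed.

Lemma lebesgue_fin A : mu A < +oo -> mu A \is a fin_num.
Proof. by move=> h; rewrite ge0_fin_numE // outer_measure_ge0. Qed.

Lemma cvg_decr_set0 (F : (set 'rV[R]_n.+1)^nat) : mu (F 0%N) < +oo ->
  (forall k, meas (F k)) -> (forall k l, (k <= l)%N -> F l `<=` F k) ->
  \bigcap_k F k = set0 -> forall e : R, (0 < e)%R -> exists k, mu (F k) <= e%:E.
Proof.
move=> F0 mF dF F00 e e0.
have := @nonincreasing_cvg_mu _ _ R mu F F0 mF.
rewrite F00 measure0 => /(_ measurable0) H.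
have {}H : mu \o F @ \oo --> 0 by apply: H => k l kl; apply/subsetPset/dF.
have Ff k : mu (F k) \is a fin_num.
  by apply: lebesgue_fin; apply: le_lt_trans F0; apply: lebesgue_le; exact: dF.
move/fine_cvgP : H => [_ /cvgrPdist_le /(_ e e0)[k _ /(_ k (leqnn _))]] /=.
rewrite sub0r normrN ger0_norm; last by rewrite fine_ge0 // outer_measure_ge0.
by move=> h; exists k; rewrite -(fineK (Ff k)) lee_fin.
Qed.

Lemma small_outside A (e : R) : meas A -> mu A < +oo -> (0 < e)%R ->
  exists N : nat, mu (A `\` [set x : 'rV[R]_n.+1 | `|x| <= N%:R]%R) <= e%:E.
Proof.
move=> mA Aoo e0; apply: cvg_decr_set0 => //.
- by apply: le_lt_trans Aoo; apply: lebesgue_le => x [].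
- move=> k; apply: measurableD; first exact: mA.
  by apply: measurable_closed; exact: closed_norm_le.
- move=> k l kl x [Ax Qx]; split => // /= xk; apply: Qx => /=.
  by apply: (le_trans xk); rewrite ler_nat.
- apply/seteqP; split => // x /(_ (Num.truncn `|x|).+1 I) [_ []] /=.
  exact/ltW/truncnS_gt.
Qed.

(** [K] is what remains of a large closed ball [Q k] after removing an open set [U] that
    approximates [Q k] minus [A] from outside. *)
Lemma inner_regular A (e : R) : meas A -> mu A < +oo -> (0 < e)%R ->
  exists K, [/\ compact K, K `<=` A & mu (A `\` K) <= e%:E].
Proof.
move=> mA Aoo e0.
have e2 : (0 < e / 2)%R by rewrite divr_gt0.
pose Q k := [set x : 'rV[R]_n.+1 | `|x| <= k%:R]%R.
have mQ k : meas (Q k) by apply: measurable_closed; exact: closed_norm_le.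
have [k kH] := small_outside mA Aoo e2.
have Qfin : mu (Q k) < +oo by apply: lebesgue_bounded; exact: bounded_closed_ball0.
have [U [oO DO muO]] := outer_regular (Q k `\` A) e2.
exists (Q k `&` ~` U); split.
- apply: bounded_closed_compact.
    by apply: bounded_subset (bounded_closed_ball0 k%:R) => x [].
  by apply: closedI; [exact: closed_norm_le|exact: open_closedC].
- by move=> x [Qx nO]; apply: contrapT => nA; apply: nO; exact: DO.
have mO : meas U by exact: measurable_open.
apply: (@le_trans _ _ (mu ((A `\` Q k) `|` (U `\` (Q k `\` A))))).
  apply: lebesgue_le => x [Ax nx].
  have [Qx|] := pselect (Q k x); last by left.
  right; split; last by move=> [].
  by apply: contrapT => nO; apply: nx.
apply: le_trans (outer_measureU2 _ _ _) _.
rewrite [leRHS](_ : _ = (e / 2)%:E + (e / 2)%:E); last by rewrite -EFinD -splitr.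
apply: leeD => //.
have Dfin : mu (Q k `\` A) \is a fin_num.
  by apply: lebesgue_fin; apply: le_lt_trans Qfin; apply: lebesgue_le => x [].
rewrite -[leLHS]/(mu (U `\` (Q k `\` A))).
rewrite measureD //; last 2 first.
- by apply: measurableD; [exact: mQ|exact: mA].
- by apply: le_lt_trans muO _; rewrite -(fineK Dfin) -EFinD ltry.
have -> : U `&` (Q k `\` A) = Q k `\` A by apply/setIidr.
by rewrite leeBlDr // addeC.
Qed.

Lemma measurable_continuous (f : 'rV[R]_n.+1 -> R) : continuous f ->
  measurable_fun [set: caratheodory_type (@lebesgue_outer R n)] f.
Proof.
move=> cf; apply: (measurability _ (RGenOInfty.measurableE R)) => _ [_ [a ->] <-].
rewrite setTI; apply: measurable_open.
rewrite [X in open X](_ : _ = f @^-1` [set x | a < x]%R).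
  by apply: open_comp => //; exact: open_gt.
by apply/seteqP; split=> x /=; rewrite in_itv /= andbT.
Qed.

End lebesgue_regularity.

(** * Integration *)

Section abstract_integration.
Context {R : realType} {d : measure_display} {T : measurableType d}.

Lemma ge0_Rintegral_pushforward (m : {measure set T -> \bar R}) (phi : T -> T)
    (k : R) (A : set T) (f : T -> R) :
  0 <= k -> measurable_fun [set: T] phi ->
  (forall B, measurable B -> m (phi @^-1` B) = (k%:E * m B)%E) ->
  measurable A -> measurable_fun [set: T] f -> (forall x, 0 <= f x) ->
  \int[m]_(x in phi @^-1` A) f (phi x) = k * \int[m]_(x in A) f x.
Proof.
move=> k0 mphi mk mA mf f0.
have mf' : measurable_fun A (fun x => (f x)%:E) by exact/measurable_funTS/measurable_EFinP.
have := ge0_integral_pushforward mphi m mA mf' (fun y _ => f0 y).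
rewrite (@eq_measure_integral _ T R A (mscale (NngNum k0) m)); last first.
  by move=> B mB BA; exact: mk.
rewrite ge0_integral_mscale //; last by move=> x _; rewrite lee_fin.
rewrite /Rintegral /= => <-.
(* If the integral is infinite, [fine] turns both sides into 0. *)
have := integral_ge0 m (D := A) (f := fun x => (f x)%:E) (fun x _ => f0 x).
case: (\int[m]_(x in A) (f x)%:E)%E => [r|_|//] //=.
have [->|k00] := eqVneq k 0; first by rewrite mul0e mul0r.
by rewrite mulr0 gt0_muley // lte_fin lt_neqAle eq_sym k00.
Qed.

Lemma Rintegral_pushforward (m : {measure set T -> \bar R}) (phi : T -> T)
    (A : set T) (f : T -> R) :
  measurable_fun [set: T] phi ->
  (forall B, measurable B -> m (phi @^-1` B) = m B) ->
  measurable A -> measurable_fun [set: T] f ->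
  m.-integrable (phi @^-1` A) (EFin \o (f \o phi)) ->
  \int[m]_(x in phi @^-1` A) f (phi x) = \int[m]_(x in A) f x.
Proof.
move=> mphi mk mA mf fi; rewrite /Rintegral.
rewrite [in RHS](@eq_measure_integral _ T R A (pushforward m phi) m); last first.
  by move=> B mB BA; exact/esym/mk.
rewrite (@integral_pushforward _ _ T T R _ mphi m A (fun x => (f x)%:E)) //.
exact/measurable_EFinP.
Qed.

(** Tonelli as an inequality: the product measure of [W] is bounded below by integrating its
    sections over [A], and above by integrating those over [P]. *)
Lemma section_bound (m : {sigma_finite_measure set T -> \bar R}) (P A : set T)
    (W : set (T * T)) (a M : R) : measurable P -> measurable A -> measurable W ->
  W `<=` P `*` A -> 0 <= a -> 0 <= M ->
  (forall p, P p -> (m (xsection W p) <= M%:E)%E) ->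
  (forall x, A x -> (a%:E <= m (ysection W x))%E) ->
  (a%:E * m A <= M%:E * m P)%E.
Proof.
move=> mP mA mW WPA a0 M0 HM Ha.
have E : ((m \x m) W = (m \x^ m) W)%E.
  apply: product_measure_unique => // B D mB mD; exact: product_measure2E.
apply: (@le_trans _ _ ((m \x^ m) W)%E).
  rewrite /product_measure2 -integral_cst //.
  rewrite [leLHS]integral_mkcond; apply: ge0_le_integral => //.
  - by move=> x _; rewrite patchE; case: ifP => // _; rewrite lee_fin.
  - exact/(measurable_restrictT _ mA).
  - exact: measurable_fun_ysection.
  move=> x _ /=; rewrite patchE; case: ifPn => [xA|_]; last exact: measure_ge0.
  exact: (Ha x (set_mem xA)).
rewrite -E /product_measure1 -integral_cst //.
rewrite [leRHS]integral_mkcond; apply: ge0_le_integral => //.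
- exact: measurable_fun_xsection.
- exact/(measurable_restrictT _ mP).
move=> p _ /=; rewrite patchE; case: ifPn => [pP|/negP nP]; first exact: (HM p (set_mem pP)).
rewrite (_ : xsection W p = set0) ?measure0 //; apply/seteqP; split => // x.
by rewrite /xsection /= inE => /WPA[/= Pp _]; apply: nP; exact/mem_set.
Qed.

End abstract_integration.

Section lebesgue_integration.
Context {R : realType} {n : nat}.
Implicit Types (A B D G P X : set 'rV[R]_n.+1) (f g : 'rV[R]_n.+1 -> R).
Local Notation mu := (@lebesgue R n).
Local Notation meas := (@lebesgue_measurable R n).
Local Notation T := (caratheodory_type (@lebesgue_outer R n)).

Lemma integrable_bounded A f (M : R) : meas A -> (mu A < +oo)%E ->
  measurable_fun [set: T] f -> (forall x, `|f x| <= M) ->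
  mu.-integrable A (EFin \o f).
Proof.
move=> mA Aoo mf fM; apply: measurable_bounded_integrable => //.
  exact: measurable_funTS.
exists M; split; first exact: num_real.
by move=> y My x _; exact: le_trans (fM x) (ltW My).
Qed.

Lemma Rintegral_EFin A f : meas A -> mu.-integrable A (EFin \o f) ->
  (\int[mu]_(x in A) (f x)%:E)%E = (\int[mu]_(x in A) f x)%:E.
Proof. by move=> mA fi; rewrite /Rintegral fineK //; exact: integrable_fin_num. Qed.

Lemma bounded_convergence A (F : nat -> 'rV[R]_n.+1 -> R) f (M : R) :
  meas A -> (mu A < +oo)%E -> (forall k, measurable_fun [set: T] (F k)) ->
  measurable_fun [set: T] f -> (forall k x, `|F k x| <= M) ->
  (forall x, A x -> F k x @[k --> \oo] --> f x) ->
  \int[mu]_(x in A) F k x @[k --> \oo] --> \int[mu]_(x in A) f x.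
Proof.
move=> mA Aoo mF mf FM Ff.
have := @dominated_convergence _ T R mu A mA (fun k x => (F k x)%:E) (fun x => (f x)%:E)
  (fun=> M%:E).
case.
- by move=> k; apply: measurable_funTS; exact/measurable_EFinP.
- by apply: measurable_funTS; exact/measurable_EFinP.
- apply/aeW => x Ax; apply: cvg_EFin; last exact: Ff.
  by near=> k.
- have := @integrable_bounded A (fun=> M) `|M| mA Aoo (measurable_cst _) (fun=> lexx _).
  by [].
- by apply/aeW => x k Ax; rewrite /= lee_fin.
move=> fi _ H.
by move: H; rewrite (Rintegral_EFin mA fi) => /fine_cvg.
Unshelve. all: by end_near. Qed.

Lemma measurable_fun_hom (c : R) v : 0 < c ->
  measurable_fun [set: T] (hom c v : T -> T).
Proof. by move=> c0 _ A mA; rewrite setTI; exact: measurable_hom. Qed.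

Lemma ge0_Rintegral_hom (c : R) v A f : 0 < c -> meas A ->
  measurable_fun [set: T] f -> (forall x, 0 <= f x) ->
  \int[mu]_(x in hom c v @^-1` A) f (hom c v x) = c ^- n.+1 * \int[mu]_(x in A) f x.
Proof.
move=> c0 mA mf f0; apply: (@ge0_Rintegral_pushforward _ _ T mu (hom c v)).
- by rewrite invr_ge0 exprn_ge0 // ltW.
- exact: measurable_fun_hom.
- by move=> B _; exact: lebesgue_hom_preimage.
- exact: mA.
- exact: mf.
- exact: f0.
Qed.

Lemma Rintegral_translate v A f (M : R) : meas A -> (mu A < +oo)%E ->
  measurable_fun [set: T] f -> (forall x, `|f x| <= M) ->
  \int[mu]_(x in hom 1 v @^-1` A) f (hom 1 v x) = \int[mu]_(x in A) f x.
Proof.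
move=> mA Aoo mf fM.
have mh := measurable_fun_hom v ltr01.
have H B : mu (hom 1 v @^-1` B) = mu B.
  by rewrite lebesgue_hom_preimage // expr1n invr1 mul1e.
apply: (@Rintegral_pushforward _ _ T mu (hom 1 v) A f mh (fun B _ => H B) mA mf).
apply: (@integrable_bounded _ (f \o hom 1 v) M).
- exact: measurable_hom.
- by rewrite H.
- exact: measurableT_comp mf mh.
- by move=> x; exact: fM.
Qed.

(** The core is a countable union of compact sets: its preimages under continuous maps are Borel and
    its images again countable unions of compact sets, which is not so for a general Lebesgue
    measurable set. *)
Lemma sigma_compact_core G : meas G -> (mu G < +oo)%E ->
  exists K : nat -> set 'rV[R]_n.+1, [/\ forall k, compact (K k),
    forall k l, (k <= l)%N -> K k `<=` K l,
    \bigcup_k K k `<=` G & mu (G `\` \bigcup_k K k) = 0%E].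
Proof.
move=> mG Goo.
have /choice[K0 K0P] : forall k, exists K, [/\ compact K, K `<=` G &
    (mu (G `\` K) <= (k.+1%:R^-1 : R)%:E)%E].
  by move=> k; apply: inner_regular.
pose K k := \bigcup_(j in [set j | (j <= k)%N]) K0 j.
exists K; split.
- move=> k; rewrite /K (_ : [set j | (j <= k)%N] = `I_k.+1) //.
  by rewrite bigcup_mkord; apply: bigsetU_compact => j _; have [] := K0P j.
- by move=> k l kl x [j /= jk Kx]; exists j => //=; exact: leq_trans kl.
- by move=> x [k _ [j _ Kx]]; have [_ + _] := K0P j; exact.
- apply/eqP; rewrite eq_le outer_measure_ge0 andbT.
  apply/lee_addgt0Pr => e e0; rewrite add0e.
  near \oo => k.
  apply: (@le_trans _ _ (mu (G `\` K0 k))).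
    apply: lebesgue_le => x [Gx nx]; split=> // Kx; apply: nx.
    by exists k => //; exists k => /=.
  have [_ _ /le_trans] := K0P k; apply; rewrite lee_fin.
  by apply: ltW; near: k; exact: (near_infty_natSinv_lt (PosNum e0)).
Unshelve. all: by end_near. Qed.

Lemma measurable_preimage_open d (S : measurableType d) (phi : S -> 'rV[R]_n.+1)
    (O : set 'rV[R]_n.+1) :
  (forall i, measurable_fun [set: S] (fun s => phi s ord0 i)) -> open O ->
  measurable (phi @^-1` O).
Proof.
move=> mphi /open_bigcup_box[B ->]; rewrite preimage_bigcup.
apply: bigcupT_measurable => k.
rewrite (_ : _ @^-1` _ = \bigcap_(i in [set: 'I_n.+1])
   ((fun s => phi s ord0 i) @^-1` `](B k).1 ord0 i, (B k).2 ord0 i])).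
  apply: fin_bigcap_measurable => // i _; rewrite -[_ @^-1` _]setTI.
  by apply: mphi.
apply/seteqP; split=> x /= H i; first by move=> _; rewrite /= in_itv /=; exact: H.
by have := H i I; rewrite /= in_itv.
Qed.

Definition mid (p x : 'rV[R]_n.+1) := hom 2^-1 (2^-1 *: p) x.

(* Tonelli over [P x A]; the mean over [x] of [|{p in P : mid p x in G}|] is at
   most [2 ^ (n + 1) |G|], because [p |-> mid p x] is a homothety of ratio 1/2. *)
Lemma midpoint_average A P G (M : R) : meas A -> meas P -> meas G ->
  (mu A < +oo)%E -> (mu P < +oo)%E -> (mu G < +oo)%E -> 0 <= M ->
  (forall p, P p -> (mu [set x | A x /\ ~ G (mid p x)] <= M%:E)%E) ->
  fine (mu A) * (fine (mu P) - 2 ^+ n.+1 * fine (mu G)) <= fine (mu P) * M.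
Proof.
move=> mA mP mG Aoo Poo Goo M0 H.
(* The preimage of [G] under the midpoint map need not be measurable for the product; that of the
   Borel core [F] is. The difference [G] minus [F] is null, and so are its preimages under the
   homotheties [mid p]. *)
have [K [cK _ KG GK0]] := sigma_compact_core mG Goo.
pose F := \bigcup_k K k.
have mF : meas F by apply: bigcupT_measurable => k; exact: measurable_compact.
have mGF : meas (G `\` F) by apply: measurableD; [exact: mG|exact: mF].
pose W : set (T * T) := (P `*` A) `\` (fun z => mid z.1 z.2) @^-1` F.
have mW : measurable W.
  apply: measurableD; first exact: measurableX.
  rewrite preimage_bigcup; apply: bigcupT_measurable => k.
  rewrite -(setCK (K k)) -preimage_setC; apply: measurableC.
  apply: measurable_preimage_open; last first.
    by apply: closed_openC; apply: compact_closed (cK k); exact: norm_hausdorff.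
  move=> i; have mc : measurable_fun [set: T] (fun x : 'rV[R]_n.+1 => x ord0 i).
    by apply: measurable_continuous; exact: coord_continuous.
  rewrite (_ : (fun s => _) = (fun s : T * T => 2^-1 * (s.2 : 'rV[R]_n.+1) ord0 i + 2^-1 * (s.1 : 'rV[R]_n.+1) ord0 i)); last first.
    by apply/funext => s; rewrite /mid /hom !mxE.
  apply: measurable_funD; apply: measurable_funM => //.
    exact: (measurableT_comp mc measurable_snd).
  exact: (measurableT_comp mc measurable_fst).
have Ff : mu F \is a fin_num.
  by apply: lebesgue_fin; apply: le_lt_trans Goo; exact: lebesgue_le.
have Af := lebesgue_fin Aoo; have Pf := lebesgue_fin Poo; have Gf := lebesgue_fin Goo.
have FG : fine (mu F) <= fine (mu G) by rewrite fine_le //; exact: lebesgue_le.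
set a := fine (mu P) - 2 ^+ n.+1 * fine (mu G).
(* [section_bound] asks for a >= 0; for negative [a] the left-hand side is at most 0. *)
have [aneg|a0] := ltP a 0.
  apply: (@le_trans _ _ 0).
    by rewrite mulr_ge0_le0 ?fine_ge0 ?outer_measure_ge0 // ltW.
  by rewrite mulr_ge0 // fine_ge0 // outer_measure_ge0.
suff : (a%:E * mu A <= M%:E * mu P)%E.
  by rewrite -(fineK Af) -(fineK Pf) -!EFinM lee_fin mulrC [M * _]mulrC.
have sub : W `<=` P `*` A by move=> z [].
apply: (@section_bound _ _ T mu P A W a M mP mA mW sub a0 M0).
- move=> p Pp; have -> : (M%:E = M%:E + 0)%E by rewrite adde0.
  have <- : (mu (mid p @^-1` (G `\` F)) = 0)%E.
    by rewrite lebesgue_hom_preimage // GK0 mule0.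
  apply: le_trans (leeD (H p Pp) (lexx _)).
  apply: le_trans (outer_measureU2 _ _ _); apply: lebesgue_le => x.
  rewrite /xsection /= inE => -[[/= _ Ax] nF].
  by have [Gx|nGx] := pselect (G (mid p x)); [right|left].
- move=> x Ax.
  have F2 : (mu (hom 2^-1 (2^-1 *: x) @^-1` F) = (2 ^+ n.+1 * fine (mu F))%:E)%E.
    by rewrite lebesgue_hom_preimage // exprVn invrK EFinM fineK.
  apply: (@le_trans _ _ (mu P - (2 ^+ n.+1 * fine (mu F))%:E)%E).
    by rewrite -(fineK Pf) -EFinB lee_fin lerD2l lerN2 ler_wpM2l ?exprn_ge0.
  rewrite leeBlDr // -F2.
  apply: le_trans (outer_measureU2 _ _ _); apply: lebesgue_le => p Pp.
  have midC : mid p x = hom 2^-1 (2^-1 *: x) p by rewrite /mid /hom addrC.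
  have [Fp|nFp] := pselect (F (mid p x)); [right|left]; first by rewrite /= -midC.
  by rewrite /ysection /= inE.
Qed.

Lemma Rintegral1 A : meas A -> \int[mu]_(x in A) (1 : R) = fine (mu A).
Proof. by move=> mA; rewrite (Rintegral_cst _ mA) mul1r. Qed.

Lemma fine_lebesgue_le A B : A `<=` B -> (mu B < +oo)%E -> fine (mu A) <= fine (mu B).
Proof.
move=> AB Boo; have AlB := lebesgue_le AB.
by apply: fine_le => //; apply: lebesgue_fin => //; exact: le_lt_trans Boo.
Qed.

Lemma Rintegral_null A B g : meas A -> meas B -> B `<=` A -> mu (A `\` B) = 0%E ->
  mu.-integrable A (EFin \o g) -> \int[mu]_(x in A) g x = \int[mu]_(x in B) g x.
Proof.
move=> mA mB BA N0 ig; have mN : meas (A `\` B) by exact: (measurableD mA mB).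
rewrite /Rintegral (negligible_integral mN mA ig N0).
congr (fine _); congr (integral _ _ _); apply/seteqP; split => x.
  by move=> [Ax nN]; apply: contrapT => nB; apply: nN.
by move=> Bx; split; [exact: BA|move=> []].
Qed.

Lemma Rintegral_split A B g (M : R) : meas A -> meas B -> (mu A < +oo)%E ->
  measurable_fun [set: T] g -> (forall x, `|g x| <= M) ->
  \int[mu]_(x in A) g x = \int[mu]_(x in A `&` B) g x + \int[mu]_(x in A `\` B) g x.
Proof.
move=> mA mB Aoo mg gM.
have m1 : meas (A `&` B) by exact: (measurableI _ _ mA mB).
have m2 : meas (A `\` B) by exact: (measurableD mA mB).
have ig : mu.-integrable ((A `&` B) `|` (A `\` B)) (EFin \o g).
  by rewrite setUIDK; exact: (integrable_bounded mA Aoo mg gM).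
have disj : [disjoint A `&` B & A `\` B] by apply/disj_setPS => x [[? ?] []].
have := @Rintegral_setU _ T R mu (A `&` B) (A `\` B) g m1 m2 ig disj.
by rewrite setUIDK.
Qed.

Lemma Rintegral_le_measure A g (M : R) : meas A -> (mu A < +oo)%E ->
  measurable_fun [set: T] g -> (forall x, `|g x| <= M) ->
  `|\int[mu]_(x in A) g x| <= M * fine (mu A).
Proof.
move=> mA Aoo mg gM; have ig := integrable_bounded mA Aoo mg gM.
apply: (le_trans (le_normr_Rintegral mA ig)); rewrite -(Rintegral_cst _ mA).
apply: (le_Rintegral mA) => //.
- apply: (integrable_bounded (M := M) mA Aoo); last by move=> x; rewrite normr_id.
  by apply: measurableT_comp => //; exact: normr_measurable.
- exact: (integrable_bounded (M := `|M|) mA Aoo (measurable_cst _) (fun=> lexx _)).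
Qed.

End lebesgue_integration.

(** * Differentiation under the integral sign *)

Section differentiation_integral.
Context {R : realType} {d : measure_display} {T : measurableType d}.
Variable m : {measure set T -> \bar R}.

Lemma is_derive_Rintegral (A : set T) (w dw : R -> T -> R) (a u v M : R) :
  measurable A -> (m A < +oo)%E -> a \in `]u, v[ ->
  (forall t, t \in `]u, v[ -> m.-integrable A (EFin \o w t)) ->
  (forall t x, t \in `]u, v[ -> is_derive t 1 (w ^~ x) (dw t x)) ->
  (forall t x, t \in `]u, v[ -> `|dw t x| <= M) ->
  is_derive a 1 (fun t => \int[m]_(x in A) w t x) (\int[m]_(x in A) dw a x).
Proof.
move=> mA Aoo auv wi wd dwM.
have M0 : 0 <= M by exact: le_trans (normr_ge0 _) (dwM a point auv).
have Ia : [set` `]u, v[] a by [].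
have E t x : t \in `]u, v[ -> partial1of2 w t x = dw t x.
  by move=> tuv; rewrite partial1of2E; have [_ ->] := wd t x tuv.
have iG : m.-integrable A (EFin \o cst M).
  apply: measurable_bounded_integrable => //.
  exists M; split; first exact: num_real.
  by move=> y My x _ /=; rewrite ger0_norm // ltW.
have G_ub t x : [set` `]u, v[] t -> A x -> `|partial1of2 w t x| <= cst M x.
  by move=> tuv _; rewrite E // dwM.
have derf t x : [set` `]u, v[] t -> A x -> derivable (w ^~ x) t 1.
  by move=> tuv _; have [] := wd t x tuv.
have G0 (y : T) : 0 <= (cst M : T -> R) y by [].
have D := @derivable_under_integral R d T m w A mA a u v Ia wi derf _ G0 iG G_ub.
have V := @differentiation_under_integral R d T m w A mA a u v Ia wi derf _ G0 iG G_ub.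
apply: DeriveDef; first exact: D.
rewrite -derive1E V; apply: eq_Rintegral => x _.
exact: E.
Qed.

(** Lets a domain of integration be exchanged for a convenient one, usually a bounded set that
    contains the support of [f]. *)
Lemma Rintegral_agree (A B : set T) (f : T -> R) :
  (forall x, f x != 0 -> A x <-> B x) ->
  \int[m]_(x in A) f x = \int[m]_(x in B) f x.
Proof.
move=> fAB; rewrite Rintegral_mkcond [RHS]Rintegral_mkcond; congr Rintegral.
apply/funext => x; rewrite !patchE.
have [f0|/fAB AB] := eqVneq (f x) 0; first by rewrite f0; case: ifP; case: ifP.
suff -> : (x \in A) = (x \in B) by [].
by apply/idP/idP; rewrite !inE; apply AB.
Qed.

End differentiation_integral.

(** * Compactly supported functions *)

Section compact_support.
Context {R : realType} {n : nat}.
Implicit Types (A K L : set 'rV[R]_n.+1) (f g : 'rV[R]_n.+1 -> R).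
Local Notation mu := (@lebesgue R n).
Local Notation meas := (@lebesgue_measurable R n).
Local Notation T := (caratheodory_type (@lebesgue_outer R n)).

(** Bounds the support by any convenient set, in practice a compact one; the bound passes to partial
    derivatives once [K] is closed and spares computing closures. *)
Definition vanishes_off K f := forall x, ~ K x -> f x = 0.

Lemma compact_closed_rV K : compact K -> closed K.
Proof. by apply: compact_closed; exact: norm_hausdorff. Qed.

Lemma partial_vanishes_off K f i : closed K -> vanishes_off K f ->
  vanishes_off K (partial i f).
Proof.
move=> cK fK x nK; rewrite /partial.
rewrite (@near_eq_derive _ _ _ f (cst 0)); first exact: derive_cst.
have oK : open (~` K) by exact: closed_openC.
have : nbhs x (~` K) by move: oK; rewrite openE; exact.
by apply: filterS; exact: fK.
Qed.

Lemma bounded_compact_support K f : compact K -> continuous f ->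
  vanishes_off K f -> exists2 M : R, 0 <= M & forall x, `|f x| <= M.
Proof.
move=> cK cf fK; have [[x0 Kx0]|/nonemptyPn K0] := pselect (K !=set0); last first.
  by exists 0 => // x; rewrite fK ?normr0 // K0.
have cfn : continuous (fun x => `|f x|).
  by move=> x; apply: (@continuous_comp _ _ _ f); [exact: cf|exact: norm_continuous].
have [c Kc H] := @EVT_max_rV R n.+1 (fun x => `|f x|) K (ex_intro _ x0 Kx0) cK
  (continuous_subspaceT cfn).
exists `|f c| => // x; have [Kx|nKx] := pselect (K x); first exact: H (mem_set Kx).
by rewrite fK // normr0.
Qed.

Lemma compact_in_ball K : compact K ->
  exists2 r : R, 0 < r & forall x, K x -> `|x| <= r.
Proof.
move=> /compact_bounded[M [Mr MK]]; exists (`|M| + 1).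
  by rewrite ltr_wpDl.
by move=> x Kx; apply: (MK (`|M| + 1)) => //; rewrite (le_lt_trans (ler_norm M)) // ltrDl.
Qed.

Lemma meas_norm_le (r : R) : meas [set x : 'rV[R]_n.+1 | `|x| <= r].
Proof. by apply: measurable_closed; exact: closed_norm_le. Qed.

Lemma fin_norm_le (r : R) : (mu [set x : 'rV[R]_n.+1 | (`|x| <= r)%R] < +oo)%E.
Proof. by apply: lebesgue_bounded; exact: bounded_closed_ball0. Qed.

(* The integral of [x |-> f (x + t e_i)] does not depend on [t]. *)
Lemma integral_partial0 K f i A : compact K -> Ck 1 f -> vanishes_off K f ->
  K `<=` A -> \int[mu]_(x in A) partial i f x = 0.
Proof.
move=> cK f1 fK KA.
have cf := Ck_continuous f1; have cdf := Ck_continuous (Ck_partial i f1).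
have dfK := partial_vanishes_off i (compact_closed_rV cK) fK.
have [M M0 fM] := bounded_compact_support cK cf fK.
have [N N0 dfN] := bounded_compact_support cK cdf dfK.
have [r r0 Kr] := compact_in_ball cK.
(* The margin 1 keeps in [B] every point that a translation by [t e_i] with |t| < 1 moves into [K],
   so that the integral of the translated function over [B] is constant in [t]. *)
pose B := [set x : 'rV[R]_n.+1 | `|x| <= r + 1].
have mB : meas B by exact: meas_norm_le.
have Boo : (mu B < +oo)%E by exact: fin_norm_le.
have KB : K `<=` B by move=> x /Kr xr; rewrite /B /= (le_trans xr) // lerDl.
transitivity (\int[mu]_(x in B) partial i f x).
  apply: Rintegral_agree => x /eqP f0.
  have Kx : K x by apply: contrapT => /dfK.
  by split=> _; [exact: KB|exact: KA].
pose e : 'rV[R]_n.+1 := delta_mx ord0 i.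
have ne : `|e| <= 1.
  exact: norm_delta_le1.
pose w (t : R) (x : 'rV[R]_n.+1) := f (t *: e + x).
pose dw (t : R) (x : 'rV[R]_n.+1) := partial i f (t *: e + x).
have cw t : continuous (w t).
  move=> x; apply: (@continuous_comp _ _ _ (fun x => t *: e + x) f); last exact: cf.
  by apply: continuousD; [exact: cst_continuous|exact: cvg_id].
have d1 : is_derive (0 : R) 1 (fun t => \int[mu]_(x in B) w t x) (\int[mu]_(x in B) dw 0 x).
  apply: (@is_derive_Rintegral _ _ T mu B w dw 0 (-1) 1 N mB Boo).
  - by rewrite in_itv /= ltr01 andbT ltrN10.
  - move=> t _; apply: (integrable_bounded (M := M)) => //.
      exact: measurable_continuous.
    by move=> x; exact: fM.
  - by move=> t x _; apply: line_is_derive; exact: (Ck_derivable f1).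
  - by move=> t x _; exact: dfN.
have const t : t \in `]-1, (1 : R)[ -> \int[mu]_(x in B) w t x = \int[mu]_(x in B) f x.
  rewrite in_itv /= => /andP[t1 t2].
  have <- := Rintegral_translate (t *: e) mB Boo (measurable_continuous cf) fM.
  have -> : (fun x => f (hom 1 (t *: e) x)) = w t.
    by apply/funext => x; rewrite /w /hom scale1r addrC.
  apply: Rintegral_agree => x /eqP wx0.
  have Kx : K (t *: e + x) by apply: contrapT => /fK.
  split=> _; rewrite /B /=; last first.
    have -> : x = (t *: e + x) - t *: e by rewrite addrAC subrr add0r.
    apply: (le_trans (ler_normB _ _)); apply: lerD; first exact: Kr.
    rewrite normrZ -[leRHS]mulr1 ler_pM //.
    by rewrite ler_norml !ltW.
  by rewrite /hom scale1r addrC; exact: KB.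
have d2 : is_derive (0 : R) 1 (fun t => \int[mu]_(x in B) w t x) 0.
  apply: (@near_eq_is_derive _ _ _ (cst (\int[mu]_(x in B) f x))) => //.
  near=> t; have ht : t \in `]-1, (1 : R)[.
    by near: t; apply: near_in_itvoo; rewrite in_itv /= ltr01 andbT ltrN10.
  by rewrite /= (const t ht).
have <- : \int[mu]_(x in B) dw 0 x = 0 by have [_ <-] := d1; have [_ ->] := d2.
by apply: eq_Rintegral => x _; rewrite /dw scale0r add0r.
Unshelve. all: by end_near. Qed.

End compact_support.

(** * Smooth cutoff functions *)

Section smooth_urysohn.
Context {R : realType} {n : nat}.
Implicit Types (K L : set 'rV[R]_n.+1) (f g : 'rV[R]_n.+1 -> R) (x y : 'rV[R]_n.+1).

Lemma prod_le1 (I : Type) (s : seq I) (F : I -> R) :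
  (forall i, 0 <= F i <= 1) -> \prod_(i <- s) F i <= 1.
Proof.
move=> F01; rewrite -[leRHS](@big1_eq _ 1 *%R _ s xpredT).
by apply: ler_prod => i _.
Qed.

Definition bump x (r : R) y : R :=
  \prod_i (step (2 - r^-1 * (y ord0 i - x ord0 i)) *
           step (2 + r^-1 * (y ord0 i - x ord0 i))).

Lemma Ck_bump k x (r : R) : Ck k (bump x r).
Proof.
have L i : Ck k (fun y : 'rV[R]_n.+1 => r^-1 * (y ord0 i - x ord0 i)).
  by apply: CkZ; apply: CkB; [exact: Ck_coord|exact: Ck_cst].
apply: Ck_prod => i _; apply: CkM; apply: Ck_step.
  by apply: CkB => //; exact: Ck_cst.
by apply: CkD => //; exact: Ck_cst.
Qed.

Lemma bump_ge0 x (r : R) y : 0 <= bump x r y.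
Proof. by apply: prodr_ge0 => i _; rewrite mulr_ge0 // step_ge0. Qed.

Lemma bump_le1 x (r : R) y : bump x r y <= 1.
Proof.
apply: prod_le1 => i; rewrite mulr_ge0 ?step_ge0 //=.
by rewrite mulr_ile1 ?step_ge0 ?step_le1.
Qed.

Lemma bump1 x (r : R) y : 0 < r -> `|y - x| <= r -> bump x r y = 1.
Proof.
move=> r0 yx; rewrite /bump big1 // => i _.
have : `|r^-1 * (y ord0 i - x ord0 i)| <= 1.
  rewrite normrM normfV (gtr0_norm r0) ler_pdivrMl // mulr1.
  by have := coord_le_norm (y - x) i; rewrite !mxE => /le_trans; apply.
by rewrite ler_norml => /andP[? ?]; rewrite !step_ge1 ?mulr1 //; lra.
Qed.

Lemma bump0 x (r : R) y : 0 < r -> ~ (`|y - x| <= 2 * r) -> bump x r y = 0.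
Proof.
move=> r0 yx.
have [i iH] : exists i, 2 * r < `|y ord0 i - x ord0 i|.
  apply: contrapT => nH; apply: yx; apply: norm_le_coord.
    by rewrite mulr_ge0 // ltW.
  by move=> i; rewrite !mxE leNgt; apply/negP => H; apply: nH; exists i.
rewrite /bump (bigD1 i) //=.
suff -> : step (2 - r^-1 * (y ord0 i - x ord0 i)) *
   step (2 + r^-1 * (y ord0 i - x ord0 i)) = 0 by rewrite mul0r.
have : 2 < `|r^-1 * (y ord0 i - x ord0 i)|.
  by rewrite normrM normfV (gtr0_norm r0) ltr_pdivlMl // mulrC.
rewrite lter_normr => /orP[h|h].
  by rewrite step_le0 ?mul0r //; lra.
by rewrite [X in _ * X]step_le0 ?mulr0 //; lra.
Qed.

(** Finitely many bumps, each equal to 1 on a ball of a cover of [L] and supported in the doubled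
    ball inside [U], are combined as 1 minus the product of the 1 - bump: the result stays in [0, 1]
    and is 1 wherever one of the bumps is. *)
Lemma smooth_urysohn L U : compact L -> open U -> L `<=` U ->
  exists (a : 'rV[R]_n.+1 -> R) K, [/\ forall k, Ck k a, compact K, K `<=` U,
    vanishes_off K a & (forall y, 0 <= a y <= 1) /\ (forall y, L y -> a y = 1)].
Proof.
move=> cL oU LU.
have /choice[r rP] : forall x, exists r : R, 0 < r /\
    (L x -> forall y, `|y - x| <= 2 * r -> U y).
  move=> x; have [Lx|nL] := pselect (L x); last by exists 1.
  have /nbhs_normP[/= e e0 eU] : nbhs x U by move: oU; rewrite openE; apply; exact: LU.
  exists (e / 4); split; first by rewrite divr_gt0.
  move=> _ y yx; apply: eU => /=; rewrite distrC; apply: le_lt_trans yx _; lra.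
pose B x := ball x (r x).
have H := cL; rewrite compact_cover in H; have := H _ L B; case.
- by move=> x Lx; apply: ball_open; exact: (rP x).1.
- by move=> x Lx; exists x => //; apply: ballxx; exact: (rP x).1.
move=> D0 D0L LD0.
pose D : seq 'rV[R]_n.+1 := finmap.enum_fset D0.
have DL x : x \in D -> L x by move=> xD; exact/set_mem/D0L.
have LD y : L y -> exists2 x, x \in D & B x y by move=> /LD0[x xD Bx]; exists x.
pose a y := 1 - \prod_(x <- D) (1 - bump x (r x) y).
have p01 y : 0 <= \prod_(x <- D) (1 - bump x (r x) y) <= 1.
  apply/andP; split.
    by apply: prodr_ge0 => x _; rewrite subr_ge0 bump_le1.
  by apply: prod_le1 => x; rewrite subr_ge0 bump_le1 /= lerBlDr lerDl bump_ge0.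
pose Q x := [set y | `|y - x| <= 2 * r x].
have cQ x : compact (Q x).
  apply: bounded_closed_compact.
    exists (`|x| + 2 * r x); split; first exact: num_real.
    move=> M Mx y; rewrite /Q /= => yx; apply: le_trans (ltW Mx).
    by rewrite -(subrK x y) addrC; apply: (le_trans (ler_normD _ _)); rewrite lerD2l.
  rewrite (_ : Q x = (fun y => `|y - x|) @^-1` [set t : R | t <= 2 * r x]) //.
  apply: closed_comp; last exact: closed_le.
  move=> y _; apply: (@continuous_comp _ _ _ (fun y => y - x)); last exact: norm_continuous.
  by apply: continuousB => //; exact: cst_continuous.
exists a, (\big[setU/set0]_(x <- D) Q x); split.
- move=> k; apply: CkB; first exact: Ck_cst.
  by apply: Ck_prod => x _; apply: CkB; [exact: Ck_cst|exact: Ck_bump].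
- by apply: bigsetU_compact => x _; exact: cQ.
- move=> y; rewrite -bigcup_seq => -[x /= xD Qy].
  by apply: (rP x).2 Qy; exact: DL.
- move=> y nQ; rewrite /a big_seq big1 ?subrr // => x xD.
  rewrite bump0 ?subr0 //; first exact: (rP x).1.
  by move=> Qy; apply: nQ; rewrite -bigcup_seq; exists x.
split.
- by move=> y; have /andP[h1 h2] := p01 y; rewrite /a subr_ge0 h2 /= lerBlDr lerDl.
- move=> y /LD[x xD xy]; rewrite /a.
  have -> : \prod_(x <- D) (1 - bump x (r x) y) = 0.
    rewrite (big_rem x) //= bump1 ?subrr ?mul0r //; first exact: (rP x).1.
    by move: xy; rewrite /B -ball_normE /= distrC => /ltW.
  by rewrite subr0.
Qed.

End smooth_urysohn.

(** * Relative perimeter *)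

Section perimeter.
Context {R : realType} {n : nat}.
Implicit Types (C E G K : set 'rV[R]_n.+1) (xi eta : 'rV[R]_n.+1 -> 'rV[R]_n.+1).
Local Notation mu := (@lebesgue R n).
Local Notation meas := (@lebesgue_measurable R n).
Local Notation T := (caratheodory_type (@lebesgue_outer R n)).

Lemma enorm_le (x : 'rV[R]_n.+1) (c : R) : 0 <= c ->
  (enorm x <= c) = (\sum_i x ord0 i ^+ 2 <= c ^+ 2).
Proof.
move=> c0; rewrite /enorm.
by rewrite -{1}(ger0_norm c0) -sqrtr_sqr ler_sqrt // sqr_ge0.
Qed.

Lemma coord_le_enorm (x : 'rV[R]_n.+1) i : `|x ord0 i| <= enorm x.
Proof.
rewrite -sqrtr_sqr ler_sqrt; last by apply: sumr_ge0 => j _; exact: sqr_ge0.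
by rewrite (bigD1 i) //= lerDl; apply: sumr_ge0 => j _; exact: sqr_ge0.
Qed.

Lemma enorm_ge0 (x : 'rV[R]_n.+1) : 0 <= enorm x.
Proof. exact: sqrtr_ge0. Qed.

Lemma enormZ (c : R) (x : 'rV[R]_n.+1) : enorm (c *: x) = `|c| * enorm x.
Proof.
rewrite /enorm -sqrtr_sqr -sqrtrM ?sqr_ge0 // mulr_sumr; congr Num.sqrt.
by apply: eq_bigr => i _; rewrite !mxE exprMn.
Qed.

Lemma enorm_norm_le (x : 'rV[R]_n.+1) : enorm x <= n.+1%:R * `|x|.
Proof.
rewrite enorm_le ?mulr_ge0 //.
apply: (@le_trans _ _ (\sum_(i < n.+1) `|x| ^+ 2)).
  apply: ler_sum => i _; rewrite -(real_normK (num_real (x ord0 i))).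
  by rewrite lerXn2r ?nnegrE // coord_le_norm.
rewrite sumr_const card_ord -[leLHS]mulr_natl exprMn ler_wpM2r ?sqr_ge0 //.
by rewrite -natrX ler_nat -[n.+1 in X in (X <= _)%N]expn1 leq_pexp2l.
Qed.

Lemma smooth_divergence k xi : smooth xi -> Ck k (divergence xi).
Proof. by move=> sxi; apply: Ck_sum => i _; apply: Ck_partial; exact: sxi. Qed.

Lemma test_fieldI C xi K : smooth xi -> compact K -> K `<=` C^° ->
  (forall x, ~ K x -> xi x = 0) -> (forall x, enorm (xi x) <= 1) -> test_field C xi.
Proof.
move=> sxi cK KC xi0 xi1.
have sK : field_support xi `<=` K.
  rewrite ((closure_id K).1 (compact_closed_rV cK)).
  by apply: closureS => x /= /eqP; apply: contra_notP => /xi0.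
split => //; last exact: subset_trans KC.
by apply: subclosed_compact cK sK; exact: closed_closure.
Qed.

Lemma test_fieldE C xi : test_field C xi -> exists K, [/\ compact K, K `<=` C^°,
  forall i, vanishes_off K (fun x => xi x ord0 i) & forall x i, `|xi x ord0 i| <= 1].
Proof.
move=> [sxi cs sC xi1]; exists (field_support xi); split => //.
  move=> i x nx; have [->|x0] := eqVneq (xi x) 0; first by rewrite mxE.
  by exfalso; apply: nx; apply: subset_closure.
by move=> x i; exact: le_trans (coord_le_enorm _ _) (xi1 x).
Qed.

Lemma divergence_vanishes_off K xi : closed K ->
  (forall i, vanishes_off K (fun x => xi x ord0 i)) -> vanishes_off K (divergence xi).
Proof.
move=> cK xiK x nK; rewrite /divergence big1 // => i _.
exact: (partial_vanishes_off i cK (xiK i)).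
Qed.

Lemma divergence_bounded C xi : test_field C xi ->
  exists2 M : R, 0 <= M & forall x, `|divergence xi x| <= M.
Proof.
move=> txi; have [K [cK _ xiK _]] := test_fieldE txi.
have [sxi _ _ _] := txi.
apply: (bounded_compact_support cK); first exact: (@Ck_continuous _ _ 0 _ (smooth_divergence _ sxi)).
by apply: divergence_vanishes_off => //; exact: compact_closed_rV.
Qed.

Lemma divergence_integrable C xi E : meas E -> (mu E < +oo)%E -> test_field C xi ->
  mu.-integrable E (EFin \o divergence xi).
Proof.
move=> mE Eoo txi; have [M _ HM] := divergence_bounded txi.
have [sxi _ _ _] := txi.
apply: (integrable_bounded mE Eoo _ HM).
exact/measurable_continuous/(@Ck_continuous _ _ 0 _ (smooth_divergence _ sxi)).
Qed.

Lemma perimeter_ge C xi E : meas E -> (mu E < +oo)%E -> test_field C xi ->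
  ((\int[mu]_(x in E) divergence xi x)%:E <= relative_perimeter C E)%E.
Proof.
move=> mE Eoo txi; apply: ereal_sup_ubound; exists xi => //.
exact/Rintegral_EFin/(divergence_integrable mE Eoo txi).
Qed.

Lemma perimeter_le C E (p : \bar R) : meas E -> (mu E < +oo)%E ->
  (forall xi, test_field C xi -> ((\int[mu]_(x in E) divergence xi x)%:E <= p)%E) ->
  (relative_perimeter C E <= p)%E.
Proof.
move=> mE Eoo H; apply: ge_ereal_sup => _ [xi txi <-].
rewrite Rintegral_EFin //; first exact: H.
exact: (divergence_integrable mE Eoo txi).
Qed.

Lemma test_field0 C : test_field C (fun=> 0).
Proof.
apply: (@test_fieldI _ _ set0) => //.
- by move=> k i; rewrite (_ : (fun _ => _) = fun=> 0); [exact: Ck_cst|apply/funext => x; rewrite mxE].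
- exact: compact0.
- move=> x; rewrite enorm_le // big1 ?expr1n // => i _; by rewrite mxE expr0n.
Qed.

Lemma divergence0 x : divergence (fun=> 0 : 'rV[R]_n.+1) x = 0 :> R.
Proof.
rewrite /divergence big1 // => i _; rewrite /partial.
rewrite (_ : (fun _ => _) = cst 0); first exact: derive_cst.
by apply/funext => y; rewrite mxE.
Qed.

Lemma perimeter_ge0 C E : meas E -> (mu E < +oo)%E -> (0 <= relative_perimeter C E)%E.
Proof.
move=> mE Eoo; have := perimeter_ge mE Eoo (test_field0 C).
have -> : \int[mu]_(x in E) divergence (fun=> 0 : 'rV[R]_n.+1) x = \int[mu]_(x in E) 0.
  by apply: eq_Rintegral => x _; exact: divergence0.
by rewrite Rintegral_cst // mul0r.
Qed.

Lemma hyperplane_null i (t : R) : mu [set x | x ord0 i = t] = 0%E.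
Proof.
pose H k := [set x : 'rV[R]_n.+1 | x ord0 i = t /\ `|x| <= k%:R].
have H0 k : mu (H k) = 0%E.
  apply/eqP; rewrite eq_le outer_measure_ge0 andbT; apply/lee_addgt0Pr => e e0.
  rewrite add0e.
  (* [V] is the product of the other sides, so that a slab of thickness [e / V] has volume [e]. *)
  pose V : R := \prod_(j < n.+1 | j != i) (k%:R + (k%:R + 1)).
  have V0 : 0 < V by apply: prodr_gt0 => j _; rewrite ltr_wpDl // ltr_wpDl.
  pose a : 'rV[R]_n.+1 := \row_j (if j == i then t - e / V else - (k%:R + 1)).
  pose b : 'rV[R]_n.+1 := \row_j (if j == i then t else k%:R).
  apply: (@le_trans _ _ (mu (box (a, b)))).
    apply: lebesgue_le => x [xt xk] j; rewrite !mxE; case: eqP => [->|_].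
      by rewrite xt lexx andbT ltrBlDr ltrDl divr_gt0.
    have := le_trans (coord_le_norm x j) xk; rewrite ler_norml => /andP[? ?].
    by apply/andP; split; lra.
  apply: (le_trans (lebesgue_box_le _)); rewrite lee_fin /box_volume (bigD1 i) //=.
  rewrite !mxE eqxx opprB addrCA subrr addr0 max_r ?divr_ge0 // ?(ltW e0) ?(ltW V0) //.
  rewrite (eq_bigr (fun=> k%:R + (k%:R + 1))).
    by rewrite -/V divfK ?gt_eqF.
  by move=> j /negPf ji; rewrite !mxE ji opprK max_r // !addr_ge0.
apply/eqP; rewrite eq_le outer_measure_ge0 andbT.
apply: (@le_trans _ _ (mu (\bigcup_k H k))).
  apply: lebesgue_le => x xt; exists (Num.truncn `|x|).+1 => //; split => //.
  exact/ltW/truncnS_gt.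
apply: le_trans (outer_measure_sigma_subadditive _ _) _.
by rewrite eseries0 // => k _ _; exact: H0.
Qed.

End perimeter.

(** * Nested intervals of controlled slope *)

Section bisection.
Context {R : realType}.

(** Keep at each step the half over which [g] grows least. The intervals shrink to a common point
    [t] and on each of them [g] has at most its mean slope over [a, b]: a substitute for a level at
    which the derivative of the volume function is at most its mean. *)
Lemma bisection (g : R -> R) (a b : R) : a < b -> exists (t : R) (u v : nat -> R),
  forall k, [/\ a <= u k, v k <= b, u k <= t <= v k, v k - u k = (b - a) / 2 ^+ k
   & g (v k) - g (u k) <= (g b - g a) / 2 ^+ k].
Proof.
move=> ab.
pose h (p : R * R) := let m := (p.1 + p.2) / 2 in
  if g m - g p.1 <= (g p.2 - g p.1) / 2 then (p.1, m) else (m, p.2).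
pose s k := iter k h (a, b).
have sS k : s k.+1 = h (s k) by [].
have s_len k : (s k).2 - (s k).1 = (b - a) / 2 ^+ k.
  elim: k => [|k ih]; first by rewrite expr0 divr1.
  rewrite sS /h exprSr invfM mulrA -ih; case: ifP => _ /=; lra.
have s_lt k : (s k).1 < (s k).2.
  by rewrite -subr_gt0 s_len divr_gt0 ?exprn_gt0 ?subr_gt0.
have s_g k : g (s k).2 - g (s k).1 <= (g b - g a) / 2 ^+ k.
  elim: k => [|k ih]; first by rewrite expr0 divr1.
  rewrite sS /h exprSr invfM mulrA.
  have ih2 : (g (s k).2 - g (s k).1) / 2 <= (g b - g a) / 2 ^+ k / 2.
    by rewrite ler_pM2r.
  case: ifP => /= [c|/negbT]; first exact: le_trans c ih2.
  rewrite -ltNge => c; apply: le_trans ih2; lra.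
have u_step k : (s k).1 <= (s k.+1).1.
  by have := s_lt k; rewrite sS /h; case: ifP => _ /=; lra.
have v_step k : (s k.+1).2 <= (s k).2.
  by have := s_lt k; rewrite sS /h; case: ifP => _ /=; lra.
have u_mono k l : (k <= l)%N -> (s k).1 <= (s l).1.
  by move=> /subnK <-; elim: (l - k)%N => //= m /le_trans; apply.
have v_mono k l : (k <= l)%N -> (s l).2 <= (s k).2.
  by move=> /subnK <-; elim: (l - k)%N => // m ih; exact: le_trans (v_step _) ih.
have uv k l : (s k).1 <= (s l).2.
  have [kl|/ltnW lk] := leqP k l.
    exact: le_trans (u_mono _ _ kl) (ltW (s_lt l)).
  exact: le_trans (ltW (s_lt k)) (v_mono _ _ lk).
pose S := [set (s k).1 | k in [set: nat]].
have S0 : S !=set0 by exists (s 0%N).1, 0%N.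
exists (sup S), (fun k => (s k).1), (fun k => (s k).2) => k; split.
- exact: (u_mono 0%N).
- exact: (v_mono 0%N).
- apply/andP; split.
    apply: ub_le_sup; last by exists k.
    by exists (s 0%N).2 => _ [l _ <-].
  by apply: ge_sup => // _ [l _ <-].
- exact: s_len.
- exact: s_g.
Qed.

End bisection.

(** * Cutting by a hyperplane *)

Section cut.
Context {R : realType} {n : nat}.
Implicit Types (C E G K : set 'rV[R]_n.+1) (xi eta : 'rV[R]_n.+1 -> 'rV[R]_n.+1).
Local Notation mu := (@lebesgue R n).
Local Notation meas := (@lebesgue_measurable R n).
Local Notation T := (caratheodory_type (@lebesgue_outer R n)).

Lemma is_deriveMl (V : normedModType R) (f : V -> R) (x v : V) (k df : R) :
  is_derive x v f df -> is_derive x v (fun y => k * f y) (k * df).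
Proof. by move=> fd; exact: (is_deriveZ k fd). Qed.

Lemma is_derive_subC (V : normedModType R) (f : V -> R) (x v : V) (k df : R) :
  is_derive x v f df -> is_derive x v (fun y => f y - k) df.
Proof. by move=> fd; rewrite -[df]subr0; exact: (is_deriveB fd (is_derive_cst k x v)). Qed.

(** Smooth passage from 0 to 1 over the strip u <= c x_i <= u + w, for w > 0; the factor [c] is
    there for its sign, to cut from either side. *)
Definition ramp (c u w : R) (i : 'I_n.+1) (x : 'rV[R]_n.+1) : R :=
  step (w^-1 * (c * x ord0 i - u)).

Lemma Ck_ramp k c u w i : Ck k (ramp c u w i).
Proof.
apply: Ck_step; apply: CkZ; apply: CkB; last exact: Ck_cst.
by apply: CkZ; exact: Ck_coord.
Qed.

Lemma is_derive_ramp c u w i (x v : 'rV[R]_n.+1) :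
  is_derive x v (ramp c u w i) (dstep (w^-1 * (c * x ord0 i - u)) * (w^-1 * (c * v ord0 i))).
Proof.
apply: is_derive_comp1; last exact: is_derive_step.
by apply: is_deriveMl; apply: is_derive_subC; apply: is_deriveMl; exact: is_derive_coord.
Qed.

Definition blend (phi : 'rV[R]_n.+1 -> R) xi eta (x : 'rV[R]_n.+1) : 'rV[R]_n.+1 :=
  \row_j (xi x ord0 j + phi x * (eta x ord0 j - xi x ord0 j)).

Lemma test_field_blend C (phi : 'rV[R]_n.+1 -> R) xi eta : (forall k, Ck k phi) ->
  (forall x, 0 <= phi x <= 1) -> test_field C xi -> test_field C eta ->
  test_field C (blend phi xi eta).
Proof.
move=> phik phi01 txi teta.
have [K1 [cK1 K1C xi0 _]] := test_fieldE txi; have [K2 [cK2 K2C eta0 _]] := test_fieldE teta.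
have [sxi _ _ xi1] := txi; have [seta _ _ eta1] := teta.
apply: (@test_fieldI _ _ _ _ (K1 `|` K2)).
- move=> k j; rewrite (_ : (fun _ => _) =
    fun x => xi x ord0 j + phi x * (eta x ord0 j - xi x ord0 j)); last first.
    by apply/funext => x; rewrite mxE.
  by apply: CkD; [exact: sxi|apply: CkM => //; apply: CkB; [exact: seta|exact: sxi]].
- exact: compactU.
- by move=> x [/K1C|/K2C].
- move=> x nx; apply/rowP => j; rewrite !mxE.
  have e1 : xi x ord0 j = 0 by apply: xi0 => Kx; apply: nx; left.
  have e2 : eta x ord0 j = 0 by apply: eta0 => Kx; apply: nx; right.
  by rewrite e1 e2 subrr mulr0 addr0.
- move=> x; rewrite enorm_le // expr1n.
  have := xi1 x; have := eta1 x; rewrite !enorm_le // expr1n => h2 h1.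
  have /andP[p0 p1] := phi01 x.
  (* Convexity of the square, with the explicit defect phi (1 - phi) (eta_j - xi_j) ^ 2. *)
  apply: (@le_trans _ _ (\sum_j ((1 - phi x) * xi x ord0 j ^+ 2 + phi x * eta x ord0 j ^+ 2))).
    apply: ler_sum => j _; rewrite mxE -subr_ge0.
    rewrite (_ : _ - _ = phi x * (1 - phi x) * (eta x ord0 j - xi x ord0 j) ^+ 2); last by ring.
    by rewrite mulr_ge0 ?sqr_ge0 // mulr_ge0 // subr_ge0.
  rewrite big_split /= -!mulr_sumr -[leRHS](subrK (phi x)).
  apply: lerD; first by rewrite -[leRHS]mulr1 ler_wpM2l // subr_ge0.
  by rewrite -[leRHS]mulr1 ler_wpM2l.
Qed.

Lemma divergence_blend_ramp c u w i xi eta x : smooth xi -> smooth eta ->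
  divergence (blend (ramp c u w i) xi eta) x =
  divergence xi x + ramp c u w i x * (divergence eta x - divergence xi x)
  + (eta x ord0 i - xi x ord0 i) * (dstep (w^-1 * (c * x ord0 i - u)) * (w^-1 * c)).
Proof.
move=> sxi seta; pose D := dstep (w^-1 * (c * x ord0 i - u)).
have E j : partial j (fun y => blend (ramp c u w i) xi eta y ord0 j) x =
  partial j (fun y => xi y ord0 j) x + (ramp c u w i x *
    (partial j (fun y => eta y ord0 j) x - partial j (fun y => xi y ord0 j) x)
   + (eta x ord0 j - xi x ord0 j) * (D * (w^-1 * (c * (i == j)%:R)))).
  have d1 := Ck_is_derive x j (sxi 1%N j).
  have d2 := Ck_is_derive x j (seta 1%N j).
  have d3 := is_derive_ramp c u w i x (delta_mx ord0 j).
  rewrite mxE eqxx in d3.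
  have [_ <-] := is_deriveD d1 (is_deriveM d3 (is_deriveB d2 d1)); rewrite /partial; congr ('D_ _ _ _).
  by apply/funext => y; rewrite mxE.
rewrite /divergence (eq_bigr _ (fun j _ => E j)) big_split /= big_split /= addrA.
congr (_ + _); last first.
  rewrite (bigD1 i) //= eqxx mulr1 big1 ?addr0 // => j /negPf ji.
  by rewrite eq_sym ji !mulr0.
by congr (_ + _); rewrite -mulr_sumr sumrB.
Qed.

Lemma meas_le (c : R) (i : 'I_n.+1) t : meas [set x | c * x ord0 i <= t].
Proof.
apply: measurable_closed.
change (closed ((fun x : 'rV[R]_n.+1 => c * x ord0 i) @^-1` [set y : R | y <= t])).
apply: closed_comp; last exact: closed_le.
by move=> x _; exact: (Ck_continuous (CkZ (k := 0) c (Ck_coord 0 i))).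
Qed.

Lemma meas_gt (c : R) (i : 'I_n.+1) t : meas [set x | t < c * x ord0 i].
Proof.
rewrite (_ : mkset _ = ~` [set x | c * x ord0 i <= t]).
  exact/measurableC/meas_le.
by apply/seteqP; split=> x /=; rewrite ltNge => /negP.
Qed.

Lemma ramp01 c u w i x : 0 <= ramp c u w i x <= 1.
Proof. by rewrite step_ge0 step_le1. Qed.

Lemma level_null c i t : c != 0 -> mu [set x : 'rV[R]_n.+1 | (c * x ord0 i = t)%R] = 0%E.
Proof.
move=> c0; rewrite -(hyperplane_null (n := n) i (t / c)); congr (mu _).
apply/seteqP; split => x /=; first by move=> <-; rewrite mulrAC divff // mul1r.
by move=> ->; rewrite mulrCA divff // mulr1.
Qed.

(** Divergence of the blend without the term that contains the gradient of the ramp: the part that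
    has a limit as the ramp steepens. *)
Definition ramp_div c u w i xi eta x :=
  divergence xi x + ramp c u w i x * (divergence eta x - divergence xi x).

Lemma continuous_ramp_div c u w i xi eta : smooth xi -> smooth eta ->
  continuous (ramp_div c u w i xi eta).
Proof.
move=> sxi seta; apply: (Ck_continuous (k := 0)); apply: CkD; first exact: smooth_divergence.
by apply: CkM; [exact: Ck_ramp|apply: CkB; exact: smooth_divergence].
Qed.

(** Test the perimeter of [E] with the blend. The gradient term lives on the strip u < c x_i <= u +
    w and is at most 2 K / w there, since two components of modulus at most 1 differ by at most
    2. *)
Lemma ramp_estimate C E i c (u w p K : R) xi eta : (forall y, `|dstep y| <= K) ->
  meas E -> (mu E < +oo)%E -> `|c| <= 1 -> 0 < w ->
  (relative_perimeter C E <= p%:E)%E -> test_field C xi -> test_field C eta ->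
  \int[mu]_(x in E) ramp_div c u w i xi eta x <=
  p + 2 * K / w * fine (mu (E `&` [set x | (u < c * x ord0 i <= u + w)%R])).
Proof.
move=> HK mE Eoo c1 w0 Ep txi teta; have [sxi _ _ _] := txi; have [seta _ _ _] := teta.
have [_ [_ _ _ xi1]] := test_fieldE txi; have [_ [_ _ _ eta1]] := test_fieldE teta.
set B := E `&` _.
have mB : meas B.
  rewrite (_ : B = E `&` ([set x | c * x ord0 i <= u + w] `&` [set x | u < c * x ord0 i])).
    exact: (measurableI _ _ mE (measurableI _ _ (meas_le _ _ _) (meas_gt _ _ _))).
  apply/seteqP; split => x /= [Ex]; first by move=> /andP[h1 h2].
  by move=> [h1 h2]; split => //; apply/andP.
have Boo : (mu B < +oo)%E by apply: le_lt_trans Eoo; apply: lebesgue_le => x [].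
pose F := ramp_div c u w i xi eta.
have cF : continuous F by exact: continuous_ramp_div.
pose h x := (eta x ord0 i - xi x ord0 i) * (dstep (w^-1 * (c * x ord0 i - u)) * (w^-1 * c)).
have tz := test_field_blend (fun k => Ck_ramp k c u w i) (ramp01 c u w i) txi teta.
have E1 x : divergence (blend (ramp c u w i) xi eta) x = F x + h x.
  exact: divergence_blend_ramp.
have hE : h = fun x => divergence (blend (ramp c u w i) xi eta) x - F x.
  by apply/funext => x; rewrite E1 addrAC subrr add0r.
have hM x : `|h x| <= 2 * K / w.
  rewrite normrM -[leRHS]mulrA; apply: ler_pM => //.
    by apply: (le_trans (ler_normB _ _)); have := eta1 x i; have := xi1 x i; lra.
  rewrite normrM; apply: ler_pM => //.
  by rewrite normrM normfV (gtr0_norm w0) -[leRHS]mulr1; apply: ler_pM; rewrite ?invr_ge0 ?(ltW w0).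
have mh : measurable_fun [set: T] h.
  rewrite hE; apply: measurable_continuous => x; apply: continuousB; last exact: cF.
  by have [sz _ _ _] := tz; exact: (Ck_continuous (smooth_divergence 0 sz)).
have ih := integrable_bounded mE Eoo mh hM.
have iF : mu.-integrable E (EFin \o F).
  have -> : F = fun x => divergence (blend (ramp c u w i) xi eta) x - h x.
    by apply/funext => x; rewrite E1 addrK.
  have [M _ HM] := divergence_bounded tz.
  apply: (integrable_bounded (M := M + 2 * K / w) mE Eoo); last first.
    by move=> x; apply: (le_trans (ler_normB _ _)); exact: lerD.
  apply: measurable_funB => //; have [sz _ _ _] := tz.
  by apply: measurable_continuous; exact: (Ck_continuous (smooth_divergence 0 sz)).
have le1 : \int[mu]_(x in E) F x + \int[mu]_(x in E) h x <= p.
  rewrite -RintegralD // -lee_fin; apply: le_trans Ep.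
  apply: le_trans (perimeter_ge mE Eoo tz).
  by rewrite lee_fin; under [leRHS]eq_Rintegral do rewrite E1.
have hB : \int[mu]_(x in E) h x = \int[mu]_(x in B) h x.
  apply: Rintegral_agree => x /eqP hx; split=> [Ex|[]//]; split => //=.
  apply: contrapT => nuv; apply: hx; rewrite /h.
  suff -> : dstep (w^-1 * (c * x ord0 i - u)) = 0 by rewrite mul0r mulr0.
  have [xu|ux] := leP (c * x ord0 i) u.
    by apply: dstep_le0; rewrite mulr_ge0_le0 ?subr_le0 // invr_ge0 ltW.
  apply: dstep_ge1; rewrite ler_pdivlMl // mulr1 lerBrDl ltW // ltNge.
  by apply/negP => xv; apply: nuv; rewrite ux.
have := Rintegral_le_measure mB Boo mh hM; rewrite -hB ler_norml => /andP[le2 _].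
apply: (@le_trans _ _ (p - \int[mu]_(x in E) h x)); first by rewrite lerBrDr.
by rewrite lerD2l lerNl.
Qed.

(** Off the level c x_i = t the ramps are eventually equal to 0 or to 1, so that dominated
    convergence separates the two fields. *)
Lemma ramp_limit C E i c (t : R) (u w : nat -> R) xi eta :
  meas E -> (mu E < +oo)%E -> c != 0 -> test_field C xi -> test_field C eta ->
  (forall k, 0 < w k) -> u k @[k --> \oo] --> t -> u k + w k @[k --> \oo] --> t ->
  \int[mu]_(x in E) ramp_div c (u k) (w k) i xi eta x @[k --> \oo] -->
  \int[mu]_(x in E `&` [set x | (c * x ord0 i <= t)%R]) divergence xi x +
  \int[mu]_(x in E `&` [set x | (t < c * x ord0 i)%R]) divergence eta x.
Proof.
move=> mE Eoo c0 txi teta w0 ut vt; have [sxi _ _ _] := txi; have [seta _ _ _] := teta.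
have [M1 M10 HM1] := divergence_bounded txi; have [M2 M20 HM2] := divergence_bounded teta.
pose F k := ramp_div c (u k) (w k) i xi eta.
have mF k : measurable_fun [set: T] (F k).
  by apply: measurable_continuous; exact: continuous_ramp_div.
have FM k x : `|F k x| <= M1 + (M2 + M1).
  apply: (le_trans (ler_normD _ _)); apply: lerD => //.
  rewrite normrM -[leRHS]mul1r ler_pM //.
    by have /andP[h0 h1] := ramp01 c (u k) (w k) i x; rewrite ger0_norm.
  by apply: (le_trans (ler_normB _ _)); apply: lerD.
have mdiv zeta : smooth zeta -> measurable_fun [set: T] (divergence zeta).
  by move=> sz; apply: measurable_continuous; exact: (Ck_continuous (smooth_divergence 0 sz)).
set S := E `&` _; set S' := E `&` _.
(* [S0] is [S] without the null hyperplane c x_i = t, where the ramps need not converge. The signs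
   put it in the form of [meas_gt]. *)
pose S0 := E `&` [set x : 'rV[R]_n.+1 | - t < - c * x ord0 i].
have mS : meas S by exact: (measurableI _ _ mE (meas_le _ _ _)).
have mS' : meas S' by exact: (measurableI _ _ mE (meas_gt _ _ _)).
have mS0 : meas S0 by exact: (measurableI _ _ mE (meas_gt _ _ _)).
have fin A : A `<=` E -> (mu A < +oo)%E.
  by move=> AE; apply: le_lt_trans Eoo; exact: lebesgue_le.
have Soo : (mu S < +oo)%E by apply: fin => x [].
have S'oo : (mu S' < +oo)%E by apply: fin => x [].
have S0oo : (mu S0 < +oo)%E by apply: fin => x [].
have S0S : S0 `<=` S by move=> x [Ex /=]; rewrite mulNr ltrN2 => /ltW.
have null : mu (S `\` S0) = 0%E.
  apply/eqP; rewrite eq_le outer_measure_ge0 andbT -(level_null i t c0).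
  apply: lebesgue_le => x [[Ex /= xt] nx]; apply/eqP; rewrite eq_le xt /= leNgt.
  by apply/negP => tx; apply: nx; split => //=; rewrite mulNr ltrN2.
have ESS' : E `\` S = S'.
  apply/seteqP; split => x [Ex]; first by move=> nS; split => //=; rewrite ltNge; apply/negP => h; apply: nS.
  by move=> /= tx; split => // -[_ /=]; rewrite leNgt tx.
have ESS : E `&` S = S by apply/setIidPr => x [].
have -> : (fun k => \int[mu]_(x in E) F k x) =
    fun k => \int[mu]_(x in S0) F k x + \int[mu]_(x in S') F k x.
  apply/funext => k; rewrite (Rintegral_split mE mS Eoo (mF k) (FM k)) ESS ESS'; congr (_ + _).
  exact: (Rintegral_null mS mS0 S0S null (integrable_bounded mS Soo (mF k) (FM k))).
rewrite (Rintegral_null mS mS0 S0S null (divergence_integrable mS Soo txi)).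
apply: cvgD.
  apply: (bounded_convergence mS0 S0oo mF (mdiv _ sxi) FM) => x [_ /=].
  rewrite mulNr ltrN2 => xt; have H := cvgr_gt _ ut _ xt.
  apply: cvg_near_cst; near=> k; have xu : c * x ord0 i < u k by near: k; exact: H.
  rewrite /F /ramp_div /ramp step_le0 ?mul0r ?addr0 //.
  by rewrite mulr_ge0_le0 ?subr_le0 ?invr_ge0 ?ltW.
apply: (bounded_convergence mS' S'oo mF (mdiv _ seta) FM) => x [_ /= tx].
have H := cvgr_lt _ vt _ tx.
apply: cvg_near_cst; near=> k; have vx : u k + w k < c * x ord0 i by near: k; exact: H.
have e1 : ramp c (u k) (w k) i x = 1.
  by apply: step_ge1; rewrite ler_pdivlMl // mulr1 lerBrDl ltW.
by rewrite /F /ramp_div e1 mul1r addrC subrK.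
Unshelve. all: by end_near. Qed.

(* Bisect [a, b], keeping the half with at most half of the mass of [E]; ramps over the
   successive intervals separate the two sides of the limit point. *)
Lemma cut C E i (c a b p K : R) : (forall y, `|dstep y| <= K) ->
  meas E -> (mu E < +oo)%E -> c != 0 -> `|c| <= 1 -> a < b ->
  (relative_perimeter C E <= p%:E)%E ->
  exists t alpha beta : R, [/\ a <= t <= b,
   (relative_perimeter C (E `&` [set x | (c * x ord0 i <= t)%R]) <= alpha%:E)%E,
   (relative_perimeter C (E `&` [set x | (t < c * x ord0 i)%R]) <= beta%:E)%E &
   alpha + beta <= p + 2 * K / (b - a) * fine (mu (E `&` [set x | (a < c * x ord0 i <= b)%R]))].
Proof.
move=> HK mE Eoo c0 c1 ab Ep.
pose S t := E `&` [set x | c * x ord0 i <= t].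
pose S' t := E `&` [set x | t < c * x ord0 i].
pose B u v := E `&` [set x | u < c * x ord0 i <= v].
have mS t : meas (S t) by exact: (measurableI _ _ mE (meas_le _ _ _)).
have mS' t : meas (S' t) by exact: (measurableI _ _ mE (meas_gt _ _ _)).
have BS u v : B u v = S v `\` S u.
  apply/seteqP; split=> x; rewrite /B /S /=.
    by move=> [Ex /andP[h1 h2]]; split => // -[_]; rewrite leNgt h1.
  by move=> [[Ex h1] nh]; split=> //; rewrite h1 andbT ltNge; apply/negP => h; apply: nh.
have fin A : A `<=` E -> (mu A < +oo)%E.
  by move=> AE; apply: le_lt_trans Eoo; exact: lebesgue_le.
have Soo t : (mu (S t) < +oo)%E by apply: fin => x [].
have S'oo t : (mu (S' t) < +oo)%E by apply: fin => x [].
pose g t := fine (mu (S t)).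
have gB u v : u <= v -> g v - g u = fine (mu (B u v)).
  move=> uv; have SS : S u `<=` S v by move=> x [Ex /= h]; split => //=; exact: le_trans h uv.
  have /(congr1 fine) := measureD (mS v) (mS u) (Soo v).
  rewrite (_ : S v `&` S u = S u); last exact/setIidr.
  by rewrite -BS => ->; rewrite fineB // lebesgue_fin.
have K0 : 0 <= K by apply: le_trans (HK 0).
have [t [u [v uvP]]] := bisection g ab.
pose w k := v k - u k.
have wE k : w k = (b - a) / 2 ^+ k by have [] := uvP k.
have w0 k : 0 < w k by rewrite wE divr_gt0 ?exprn_gt0 ?subr_gt0.
have uw k : u k + w k = v k by rewrite addrC subrK.
pose Gm := fine (mu (B a b)); pose Smax := p + 2 * K / (b - a) * Gm.
have [ut vt] : u k @[k --> \oo] --> t /\ u k + w k @[k --> \oo] --> t.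
  have w_cv : (b - a) / 2 ^+ k @[k --> \oo] --> (0 : R).
    rewrite -(mulr0 (b - a)); apply: cvgM; first exact: cvg_cst.
    under eq_fun do rewrite -exprVn; apply: cvg_expr.
    by rewrite ger0_norm ?invr_ge0 // invf_lt1 // ltr1n.
  split; apply/cvgrPdist_le => e e0; move/cvgrPdist_le : w_cv => /(_ e e0);
    apply: filterS => k; rewrite sub0r normrN -wE gtr0_norm // => we;
    have [_ _ /andP[h1 h2] _ _] := uvP k.
    by rewrite ger0_norm ?subr_ge0 // (le_trans _ we) // lerD2r.
  by rewrite uw ler0_norm ?subr_le0 // opprB (le_trans _ we) // lerD2l lerN2.
have main xi eta : test_field C xi -> test_field C eta ->
    \int[mu]_(x in S t) divergence xi x + \int[mu]_(x in S' t) divergence eta x <= Smax.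
  move=> txi teta.
  have L := @ramp_limit C E i c t u w xi eta mE Eoo c0 txi teta w0 ut vt.
  rewrite -(cvg_lim (@Rhausdorff R) L); apply: limr_le; first by apply/cvg_ex; eexists; exact: L.
  apply: nearW => k; apply: (le_trans (ramp_estimate i (u k) HK mE Eoo c1 (w0 k) Ep txi teta)).
  rewrite lerD2l uw -/(B (u k) (v k)) -gB; last by rewrite -subr_ge0 ltW // w0.
  have [_ _ _ _ gk] := uvP k.
  (* The width of the strip and the bound on its mass carry the same factor 2 ^- k, which cancels:
     the estimate does not depend on [k]. *)
  apply: (@le_trans _ _ (2 * K / w k * (Gm / 2 ^+ k))).
    rewrite ler_wpM2l //; first by rewrite divr_ge0 ?mulr_ge0 // ltW.
    by apply: (le_trans gk); rewrite gB // ltW.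
  rewrite wE invfM invrK.
  have p2 : (2 ^+ k : R) != 0 by rewrite expf_neq0.
  by rewrite le_eqVlt; apply/orP; left; apply/eqP; field; rewrite p2 subr_eq0 gt_eqF.
have perS : (relative_perimeter C (S t) <= Smax%:E)%E.
  apply: (perimeter_le (mS t) (Soo t)) => xi txi; rewrite lee_fin.
  have := main _ _ txi (test_field0 C).
  have -> : \int[mu]_(x in S' t) divergence (fun=> 0 : 'rV[R]_n.+1) x = \int[mu]_(x in S' t) 0.
    by apply: eq_Rintegral => x _; exact: divergence0.
  by rewrite (Rintegral_cst _ (mS' t)) mul0r addr0.
have Sfin : relative_perimeter C (S t) \is a fin_num.
  rewrite ge0_fin_numE ?(perimeter_ge0 _ (mS t) (Soo t)) //; exact: le_lt_trans perS (ltry _).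
(* [alpha] is the perimeter of the lower piece itself and [beta] what it leaves of [Smax]: as [xi]
   and [eta] are independent in [main], the two suprema can be taken one after the other. *)
exists t, (fine (relative_perimeter C (S t))), (Smax - fine (relative_perimeter C (S t))); split.
- have [h1 h2 /andP[h3 h4] _ _] := uvP 0%N.
  by apply/andP; split; [exact: le_trans h1 h3|exact: le_trans h4 h2].
- by rewrite fineK.
- apply: (perimeter_le (mS' t) (S'oo t)) => eta teta; rewrite lee_fin lerBrDr addrC -lerBrDr.
  rewrite -lee_fin fineK //; apply: (perimeter_le (mS t) (Soo t)) => xi txi.
  by rewrite lee_fin lerBrDr; exact: main.
- by rewrite addrC subrK.
Qed.

End cut.

(** * Isoperimetric inequalities in a convex body *)

Section convex_sets.
Context {R : realType} {n : nat}.
Implicit Types (C K : set 'rV[R]_n.+1) (p x y z : 'rV[R]_n.+1).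

Definition cvx K := forall x y (l : R), K x -> K y -> 0 <= l <= 1 ->
  K (l *: x + (1 - l) *: y).

Lemma convex_set_cvx C : convex_set C -> cvx C.
Proof.
move=> cC x y l Cx Cy /andP[l0 l1].
by have := cC x y (Itv01 l0 l1) (mem_set Cx) (mem_set Cy); rewrite inE.
Qed.

Lemma interior_nbhs K x : K^° x -> exists2 e : R, 0 < e & forall y, `|x - y| < e -> K y.
Proof. by move=> /nbhs_normP[/= e e0 H]; exists e. Qed.

Lemma nbhs_interior K x (e : R) : 0 < e -> (forall y, `|x - y| < e -> K y) -> K^° x.
Proof.
move=> e0 H; apply/nbhs_ballP; exists e => // y.
by rewrite -ball_normE /=; exact: H.
Qed.

Lemma cvx_interior K p x (l : R) : cvx K -> K p -> K^° x -> 0 < l <= 1 ->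
  K^° (l *: x + (1 - l) *: p).
Proof.
move=> cK Kp /interior_nbhs[e e0 He] /andP[l0 l1].
apply: (@nbhs_interior _ _ (l * e)); first exact: mulr_gt0.
move=> y yd; have -> : y = l *: (l^-1 *: (y - (1 - l) *: p)) + (1 - l) *: p.
  by rewrite scalerA divff ?gt_eqF // scale1r subrK.
apply: cK => //; last by rewrite ltW.
apply: He; have -> : x - l^-1 *: (y - (1 - l) *: p) =
    l^-1 *: (l *: x + (1 - l) *: p - y).
  have ln0 : l != 0 by rewrite gt_eqF.
  rewrite -[X in X - _](scale1r x) -(mulVf ln0) -scalerA -scalerBr.
  by rewrite opprB addrA.
by rewrite normrZ normfV gtr0_norm // ltr_pdivrMl.
Qed.

End convex_sets.

(** * Midpoints and perimeter in a convex set *)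

Section local.
Context {R : realType} {n : nat}.
Implicit Types (C E G K : set 'rV[R]_n.+1) (a : 'rV[R]_n.+1 -> R) (p x y z : 'rV[R]_n.+1).
Local Notation mu := (@lebesgue R n).
Local Notation meas := (@lebesgue_measurable R n).
Local Notation T := (caratheodory_type (@lebesgue_outer R n)).

(** The homothety p + s (z - p) of centre [p], written through [hom]; [mid p] is the inverse of
    [ray p 2]. *)
Definition ray p (s : R) z := hom s (p - s *: p) z.

Lemma rayE p s z i : ray p s z ord0 i = s * z ord0 i + (p ord0 i - s * p ord0 i).
Proof. by rewrite /ray /hom !mxE. Qed.

Definition rayfield (k : R) a p s z : 'rV[R]_n.+1 :=
  \row_i (k * (s ^+ n * (a (ray p s z) * (z ord0 i - p ord0 i)))).

Definition raydiv a p s z : R :=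
  s ^+ n.+1 * (\sum_j partial j a (ray p s z) * (z ord0 j - p ord0 j)) +
  n.+1%:R * s ^+ n * a (ray p s z).

Lemma Ck_ray k p s i : Ck k (fun z => ray p s z ord0 i).
Proof.
rewrite (_ : (fun _ => _) = fun z => s * z ord0 i + (p ord0 i - s * p ord0 i)); last first.
  by apply/funext => z; rewrite rayE.
by apply: CkD; [apply: CkZ; exact: Ck_coord|exact: Ck_cst].
Qed.

Lemma Ck_comp_ray k a p s : Ck k a -> Ck k (fun z => a (ray p s z)).
Proof. by move=> ak; apply: (@Ck_comp _ _ _ k (ray p s) a) => // i; exact: Ck_ray. Qed.

Lemma smooth_rayfield k a p s : (forall l, Ck l a) -> smooth (rayfield k a p s).
Proof.
move=> ak l i; rewrite (_ : (fun _ => _) =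
  fun z => k * (s ^+ n * (a (ray p s z) * (z ord0 i - p ord0 i)))); last first.
  by apply/funext => z; rewrite mxE.
apply: CkZ; apply: CkZ; apply: CkM; first exact: Ck_comp_ray.
by apply: CkB; [exact: Ck_coord|exact: Ck_cst].
Qed.

Lemma divergence_rayfield k a p s z : (forall l, Ck l a) ->
  divergence (rayfield k a p s) z = k * raydiv a p s z.
Proof.
move=> ak.
have E i : partial i (fun z => rayfield k a p s z ord0 i) z =
    k * (s ^+ n * (a (ray p s z) + (z ord0 i - p ord0 i) * (partial i a (ray p s z) * s))).
  have d1 : is_derive z (delta_mx ord0 i) (a \o ray p s) (partial i a (ray p s z) * s).
    have -> : partial i a (ray p s z) * s = \sum_j partial j a (ray p s z) * (s * (i == j)%:R).
      rewrite (bigD1 i) //= eqxx mulr1 big1 ?addr0 // => j /negPf ji.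
      by rewrite eq_sym ji !mulr0.
    apply: is_derive_comp_C1 => // j.
    rewrite (_ : (fun _ => _) = fun z => s * z ord0 j + (p ord0 j - s * p ord0 j)); last first.
      by apply/funext => y; rewrite rayE.
    rewrite -[X in is_derive _ _ _ X]addr0; apply: is_deriveD.
    apply: is_deriveMl; have := is_derive_coord z (delta_mx ord0 i) j.
    by rewrite mxE eqxx /= eq_sym.
  have d2 : is_derive z (delta_mx ord0 i) (fun z => z ord0 i - p ord0 i) 1.
    apply: is_derive_subC; have := is_derive_coord z (delta_mx ord0 i) i.
    by rewrite mxE !eqxx.
  have := is_deriveMl k (is_deriveMl (s ^+ n) (is_deriveM d1 d2)).
  rewrite /= => -[_]; rewrite [_ *: 1]mulr1 => <-; rewrite /partial; congr ('D_ _ _ _).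
  by apply/funext => y; rewrite mxE.
rewrite /divergence (eq_bigr _ (fun i _ => E i)) -mulr_sumr -mulr_sumr big_split /=.
rewrite sumr_const card_ord /raydiv mulrDr addrC; congr (k * (_ + _)).
  rewrite mulr_sumr mulr_sumr; apply: eq_bigr => j _; rewrite exprSr; ring.
by rewrite -mulr_natl; ring.
Qed.

Lemma is_derive_ray a p (s : R) z : (forall l, Ck l a) ->
  is_derive s 1 (fun s : R => s ^+ n.+1 * a (ray p s z)) (raydiv a p s z).
Proof.
move=> ak.
have d1 : is_derive s 1 (fun t : R => a (ray p t z))
    (\sum_j partial j a (ray p s z) * (z ord0 j - p ord0 j)).
  apply: (is_derive_comp_C1 (phi := fun t => ray p t z)) => // j.
  rewrite (_ : (fun _ => _) = fun t : R => (z ord0 j - p ord0 j) * t - (- p ord0 j)); last first.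
    by apply/funext => t; rewrite rayE; ring.
  apply: is_derive_subC; rewrite -[X in is_derive _ _ _ X]mulr1.
  by apply: is_deriveMl; exact: is_derive_id.
have d2 : is_derive s 1 (fun t : R => t ^+ n.+1) (n.+1%:R * s ^+ n).
  rewrite -[X in is_derive _ _ X _]/(fun t : R => id t ^+ n.+1) -(exprfctE (@id R)).
  by rewrite -[X in is_derive _ _ _ X]mulr1; exact: (is_deriveX n.+1 (is_derive_id s (1 : R))).
have := is_deriveM d2 d1.
rewrite (_ : _ + _ = raydiv a p s z) //.
by rewrite /raydiv; congr (_ + _); rewrite /GRing.scale /= mulrC.
Qed.

Variables (K : set 'rV[R]_n.+1) (p : 'rV[R]_n.+1) (D : R).
Hypotheses (cK : cvx K) (Kp : K p) (D0 : 0 < D).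
Hypothesis KD : forall z, K z -> enorm (z - p) <= D.

(** For s >= 1 a point lies between [p] and its image under [ray p s], so by convexity the support
    stays in the interior of [K]. The factor (2 ^ n D)^-1 compensates s ^ n <= 2 ^ n and |z - p| <=
    D; the minus sign turns the field towards [p]. *)
Lemma rayfield_test a K0 (s : R) : (forall l, Ck l a) -> compact K0 ->
  K0 `<=` K^° -> vanishes_off K0 a -> (forall x, 0 <= a x <= 1) -> 1 <= s <= 2 ->
  test_field K (rayfield (- (2 ^+ n * D)^-1) a p s).
Proof.
move=> ak cK0 K0K aK0 a01 /andP[s1 s2]; have s0 : 0 < s by exact: lt_le_trans s1.
have KrayK z : K0 (ray p s z) -> K^° z.
  move=> /K0K rz; have -> : z = s^-1 *: ray p s z + (1 - s^-1) *: p.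
    by apply/rowP => i; rewrite /ray /hom !mxE; field; rewrite gt_eqF.
  by apply: cvx_interior => //; rewrite invr_gt0 s0 /= invf_le1.
have rv z : ~ K0 (ray p s z) -> rayfield (- (2 ^+ n * D)^-1) a p s z = 0.
  by move=> /aK0 az; apply/rowP => i; rewrite !mxE az mul0r !mulr0.
apply: (@test_fieldI _ _ _ _ (ray p s @^-1` K0)).
- exact: smooth_rayfield.
- have sV0 : s^-1 != 0 by rewrite invr_eq0 gt_eqF.
  have e : - (s *: - (s^-1 *: (p - s *: p))) = p - s *: p.
    by rewrite scalerN opprK scalerA divff ?gt_eqF // scale1r.
  have := hom_image (- (s^-1 *: (p - s *: p))) K0 sV0.
  rewrite invrK e; rewrite -[ray p s @^-1` K0]/(hom s (p - s *: p) @^-1` K0).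
  move=> <-; apply: continuous_compact cK0; apply: continuous_subspaceT.
  apply: continuous_rV => i.
  rewrite (_ : (fun _ => _) = fun z : 'rV[R]_n.+1 => s^-1 * z ord0 i + (- (s^-1 *: (p - s *: p))) ord0 i); last first.
    by apply/funext => y; rewrite /hom !mxE.
  exact: (Ck_continuous (CkD (CkZ s^-1 (Ck_coord 0 i)) (Ck_cst 0 _))).
- by move=> z /KrayK.
- exact: rv.
- move=> z; have [rz|/rv ->] := pselect (K0 (ray p s z)); last first.
    by rewrite enorm_le // big1 ?expr1n // => i _; rewrite mxE expr0n.
  have -> : rayfield (- (2 ^+ n * D)^-1) a p s z =
      (- (2 ^+ n * D)^-1 * (s ^+ n * a (ray p s z))) *: (z - p).
    by apply/rowP => i; rewrite !mxE !mulrA.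
  have Kz : K z by exact: interior_subset (KrayK z rz).
  have /andP[a0 a1] := a01 (ray p s z).
  have B0 : 0 < 2 ^+ n * D by rewrite mulr_gt0 ?exprn_gt0.
  rewrite enormZ mulNr normrN normrM normfV (gtr0_norm B0).
  rewrite -mulrA ler_pdivrMl // mulr1.
  apply: ler_pM => //; [exact: enorm_ge0| |exact: KD].
  rewrite ger0_norm ?mulr_ge0 ?exprn_ge0 ?(ltW s0) // -[leRHS]mulr1.
  apply: ler_pM => //; first by rewrite exprn_ge0 // ltW.
  by rewrite lerXn2r ?nnegrE ?(ltW s0).
Qed.

(* [raydiv] is both the derivative in [s] of [s^(n+1) a (ray p s z)] and the divergence in [z] of
   [rayfield 1]; the mean value theorem on [s] in [1, 2] compares the scales 1 and 2. *)
Lemma integral_ray_le a K0 G (P : R) : (forall l, Ck l a) -> compact K0 ->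
  K0 `<=` K^° -> vanishes_off K0 a -> (forall x, 0 <= a x <= 1) ->
  meas G -> (mu G < +oo)%E -> (relative_perimeter K G <= P%:E)%E ->
  \int[mu]_(x in G) a x - \int[mu]_(x in mid p @^-1` G) a x <= 2 ^+ n * D * P.
Proof.
move=> ak cK0 K0K aK0 a01 mG Goo GP.
have B0 : 0 < 2 ^+ n * D by rewrite mulr_gt0 ?exprn_gt0.
have [r r0 K0r] := compact_in_ball cK0.
have ca : continuous a by exact: (@Ck_continuous _ _ 0).
have [N N0 aN] : exists2 N : R, 0 <= N & forall j x, `|partial j a x| <= N.
  have /choice[N NP] : forall j, exists N : R, 0 <= N /\ forall x, `|partial j a x| <= N.
    move=> j; have [N N0 NP] := bounded_compact_support cK0
      (Ck_continuous (Ck_partial j (ak 1%N)))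
      (partial_vanishes_off j (compact_closed_rV cK0) aK0).
    by exists N.
  exists (\sum_j N j); first by apply: sumr_ge0 => j _; exact: (NP j).1.
  move=> j x; apply: (le_trans ((NP j).2 x)); rewrite (bigD1 j) //= lerDl.
  by apply: sumr_ge0 => l _; exact: (NP l).1.
(* Bounds valid for s in ]1/2, 3[, an open neighbourhood of [1, 2]: where [ray p s z] lies in [K0],
   |z_j - p_j| <= s^-1 (r + |p|) <= Z. *)
pose Z := 2 * (r + `|p|).
pose M := 3 ^+ n.+1 * (n.+1%:R * (N * Z)) + n.+1%:R * 3 ^+ n * 1.
have dM (s : R) z : s \in `]2^-1, 3[ -> `|raydiv a p s z| <= M.
  rewrite in_itv /= => /andP[s1 s3]; have s0 : 0 < s by apply: lt_trans s1.
  have pow m : `|s ^+ m| <= 3 ^+ m.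
    by rewrite ger0_norm ?exprn_ge0 ?(ltW s0) // lerXn2r ?nnegrE ?(ltW s0) ?(ltW s3).
  apply: (le_trans (ler_normD _ _)); apply: lerD.
    rewrite normrM; apply: ler_pM => //.
    apply: (le_trans (ler_norm_sum _ _ _)).
    rewrite mulr_natl -[n.+1 in leRHS]card_ord -sumr_const; apply: ler_sum => j _.
    have [rz|nrz] := pselect (K0 (ray p s z)); last first.
      rewrite (partial_vanishes_off j (compact_closed_rV cK0) aK0 nrz) mul0r normr0.
      by rewrite mulr_ge0 // mulr_ge0 // addr_ge0 // ltW.
    rewrite normrM; apply: ler_pM => //.
    have -> : z ord0 j - p ord0 j = s^-1 * (ray p s z ord0 j - p ord0 j).
      by rewrite rayE; field; rewrite gt_eqF.
    rewrite normrM; apply: ler_pM => //.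
      rewrite normfV gtr0_norm // -[leRHS]invrK lef_pV2 ?posrE ?invr_gt0 //; exact: ltW.
    apply: (le_trans (ler_normB _ _)); apply: lerD; last exact: coord_le_norm.
    by apply: (le_trans (coord_le_norm _ _)); exact: K0r.
  rewrite normrM normrM; apply: ler_pM => //.
    by apply: ler_pM => //; rewrite normr_nat.
  by have /andP[a0 a1] := a01 (ray p s z); rewrite ger0_norm.
pose w (s : R) z := s ^+ n.+1 * a (ray p s z).
have cw s : continuous (w s).
  by apply: (Ck_continuous (k := 0)); apply: CkZ; exact: Ck_comp_ray.
have wi s : mu.-integrable G (EFin \o w s).
  apply: (integrable_bounded (M := `|s ^+ n.+1|) mG Goo); first exact: measurable_continuous.
  move=> z; have /andP[a0 a1] := a01 (ray p s z).
  by rewrite normrM -[leRHS]mulr1 ler_pM // ger0_norm.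
pose Q (s : R) := \int[mu]_(z in G) w s z.
have dQ (s : R) : s \in `]2^-1, 3[ -> is_derive s 1 Q (\int[mu]_(z in G) raydiv a p s z).
  move=> sI; apply: (@is_derive_Rintegral _ _ T mu G w (raydiv a p) s 2^-1 3 M mG Goo sI).
  - by move=> t _; exact: wi.
  - by move=> t z _; exact: is_derive_ray.
  - by move=> t z tI; exact: dM.
have sub (s : R) : s \in `[1, 2] -> s \in `]2^-1, (3 : R)[.
  rewrite !in_itv /= => /andP[s1 s2]; apply/andP; split.
    by apply: lt_le_trans s1; rewrite invf_lt1 // ltr1n.
  by apply: le_lt_trans s2 _; rewrite ltr_nat.
pose dq (s : R) := \int[mu]_(z in G) raydiv a p s z.
have le12 : (1 : R) <= 2 by rewrite ler1n.
have Qd s : s \in `]1, (2 : R)[ -> is_derive s 1 Q (dq s).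
  by move=> sI; apply/dQ/sub; exact: subset_itv_oo_cc.
have Qc : {within `[1, (2 : R)], continuous Q}.
  by apply: derivable_within_continuous => s /sub/dQ[].
have [c cI {}Qc] := MVT_segment le12 Qd Qc.
have cI' := cI; rewrite in_itv /= in cI'.
have := perimeter_ge mG Goo (rayfield_test ak cK0 K0K aK0 a01 cI').
move=> /le_trans/(_ GP); rewrite lee_fin.
have -> : \int[mu]_(x in G) divergence (rayfield (- (2 ^+ n * D)^-1) a p c) x =
    - (2 ^+ n * D)^-1 * (Q 2 - Q 1).
  have one : (2 : R) - 1 = 1 by rewrite -[2]/(1 + 1) addrK.
  rewrite Qc one mulr1 /dq -RintegralZl //.
    by apply: eq_Rintegral => x _; exact: divergence_rayfield.
  apply: (integrable_bounded (M := M) mG Goo); last by move=> z; exact/dM/sub.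
  apply: measurable_continuous; apply: (Ck_continuous (k := 0)).
  apply: CkD; [apply: CkZ; apply: Ck_sum => j _; apply: CkM|apply: CkZ; exact: Ck_comp_ray].
    by apply: Ck_comp_ray; apply: Ck_partial.
  by apply: CkB; [exact: Ck_coord|exact: Ck_cst].
rewrite mulNr -mulrN opprB ler_pdivrMl // => H; apply: le_trans H.
have -> : Q 1 = \int[mu]_(x in G) a x.
  apply: eq_Rintegral => x _; rewrite /w expr1n mul1r; congr (a _).
  by apply/rowP => i; rewrite rayE mul1r mul1r subrr addr0.
suff -> : Q 2 = \int[mu]_(x in mid p @^-1` G) a x by [].
(* Substituting x = [ray p 2 z] produces the factor 2 ^- (n + 1), which cancels the power of s = 2
   in [w], and turns [G] into its preimage under [mid p]. *)
rewrite /Q RintegralZl //; last first.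
  apply: (integrable_bounded (M := 1) mG Goo).
    by apply: measurable_continuous; apply: (Ck_continuous (k := 0)); exact: Ck_comp_ray.
  by move=> z; have /andP[a0 a1] := a01 (ray p 2 z); rewrite ger0_norm.
have mG' : meas (mid p @^-1` G) by apply: measurable_hom => //; rewrite invr_gt0.
have a0 x : 0 <= a x by have /andP[] := a01 x.
have two0 : (0 : R) < 2 by [].
have := ge0_Rintegral_hom (p - 2 *: p) two0 mG' (measurable_continuous ca) a0.
have -> : hom 2 (p - 2 *: p) @^-1` (mid p @^-1` G) = G.
  rewrite -comp_preimage (_ : _ \o _ = id) //; apply/funext => x /=.
  by apply/rowP => i; rewrite /mid /hom !mxE; field.
have p2 : (2 ^+ n.+1 : R) != 0 by rewrite expf_neq0 // pnatr_eq0.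
by rewrite /ray => ->; rewrite mulrA divff // mul1r.
Qed.

Lemma third_slack (l x y q e : R) :
  l <= x -> y <= e / 3 -> x - y <= q -> 0 < e -> l + e / 3 <= q + e.
Proof. lra. Qed.

(* Take [a] close to the indicator function of the set to be estimated. *)
Lemma local_estimate G (P : R) : meas G -> (mu G < +oo)%E -> 0 <= P ->
  (relative_perimeter K G <= P%:E)%E ->
  (mu [set x | (G `&` K^°) x /\ ~ G (mid p x)] <= (2 ^+ n * D * P)%:E)%E.
Proof.
move=> mG Goo P0 GP.
pose A := (G `&` K^°) `\` (mid p @^-1` G).
rewrite -[X in mu X]/A.
have mG' : meas (mid p @^-1` G) by apply: measurable_hom => //; rewrite invr_gt0.
have mA : meas A.
  apply: measurableD; last exact: mG'.
  by apply: measurableI; [exact: mG|apply: measurable_open; exact: open_interior].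
have Aoo : (mu A < +oo)%E by apply: le_lt_trans Goo; apply: lebesgue_le => x [[]].
apply/lee_addgt0Pr => e e0.
have e3 : 0 < e / 3 by rewrite divr_gt0.
have [L [cL LA muL]] := inner_regular mA Aoo e3.
have mL : meas L by exact: measurable_compact.
have Loo : (mu L < +oo)%E by apply: lebesgue_bounded; exact: compact_bounded.
have [U0 [oU0 LU0 muU0]] := outer_regular L e3.
pose U := U0 `&` K^°.
have oU : open U by apply: openI => //; exact: open_interior.
have LU : L `<=` U by move=> x Lx; split; [exact: LU0|have [[]] := LA x Lx].
have mU : meas U by exact: measurable_open.
have muU : (mu U <= mu L + (e / 3)%:E)%E by apply: le_trans muU0; apply: lebesgue_le => x [].
have [a [K0 [ak cK0 K0U aK0 [a01 aL]]]] := smooth_urysohn cL oU LU.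
have K0K : K0 `<=` K^° by move=> x /K0U[].
have H := integral_ray_le ak cK0 K0K aK0 a01 mG Goo GP.
have Lf := lebesgue_fin Loo.
have Uoo : (mu U < +oo)%E by apply: le_lt_trans muU _; rewrite -(fineK Lf) -EFinD ltry.
have ia X : meas X -> (mu X < +oo)%E -> mu.-integrable X (EFin \o a).
  move=> mX Xoo; apply: (integrable_bounded (M := 1) mX Xoo).
    by apply: measurable_continuous; exact: (@Ck_continuous _ _ 0).
  by move=> x; have /andP[a0 a1] := a01 x; rewrite ger0_norm.
have G'oo : (mu (mid p @^-1` G) < +oo)%E.
  rewrite lebesgue_hom_preimage ?invr_gt0 // exprVn invrK.
  by rewrite -(fineK (lebesgue_fin Goo)) -EFinM ltry.
have mUL : meas (U `\` L) by apply: measurableD; [exact: mU|exact: mL].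
have ULoo : (mu (U `\` L) < +oo)%E by apply: le_lt_trans Uoo; apply: lebesgue_le => x [].
have lowG : fine (mu L) <= \int[mu]_(x in G) a x.
  rewrite -[leLHS]mul1r -(Rintegral_cst _ mL).
  apply: (@le_trans _ _ (\int[mu]_(x in L) a x)).
    apply: (le_Rintegral mL _ (ia _ mL Loo)) => [|x Lx]; last by rewrite aL.
    by apply: (integrable_bounded (M := 1) mL Loo) => // x; rewrite normr1.
  have LG : L `<=` G by move=> x /LA[[]].
  rewrite /Rintegral fine_le //.
  - by apply: integrable_fin_num => //; exact: ia.
  - by apply: integrable_fin_num => //; exact: ia.
  apply: ge0_subset_integral => //.
    by apply/measurable_EFinP; apply: measurable_funTS; apply: measurable_continuous;
      exact: (@Ck_continuous _ _ 0).
  by move=> x _; rewrite lee_fin; have /andP[] := a01 x.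
(* [L] avoids the preimage of [G] and [a] vanishes off [U], so that only [U] minus [L], of measure
   at most [e / 3], contributes. *)
have upG : \int[mu]_(x in mid p @^-1` G) a x <= e / 3.
  have -> : \int[mu]_(x in mid p @^-1` G) a x = \int[mu]_(x in (mid p @^-1` G) `&` (U `\` L)) a x.
    apply: Rintegral_agree => x /eqP ax; split=> [Gx|[]//]; split => //; split.
      by apply: K0U; apply: contrapT => /aK0.
    by move=> /LA[_]; exact.
  have mX : meas ((mid p @^-1` G) `&` (U `\` L)) by apply: measurableI; [exact: mG'|exact: mUL].
  have Xoo : (mu ((mid p @^-1` G) `&` (U `\` L)) < +oo)%E.
    by apply: le_lt_trans G'oo; apply: lebesgue_le => x [].
  apply: (@le_trans _ _ (\int[mu]_(x in (mid p @^-1` G) `&` (U `\` L)) 1)).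
    apply: (le_Rintegral mX (ia _ mX Xoo)) => [|x _]; last by have /andP[] := a01 x.
    by apply: (integrable_bounded (M := 1) mX Xoo) => // x; rewrite normr1.
  rewrite Rintegral_cst // mul1r -lee_fin fineK ?lebesgue_fin //.
  apply: (@le_trans _ _ (mu (U `\` L))); first by apply: lebesgue_le => x [].
  rewrite measureD //; rewrite (_ : U `&` L = L); last exact/setIidr.
  by rewrite leeBlDr // addeC.
apply: (@le_trans _ _ (mu (L `|` (A `\` L)))).
  by apply: lebesgue_le => x Ax; have [Lx|nL] := pselect (L x); [left|right].
apply: le_trans (outer_measureU2 _ _ _) _.
apply: le_trans (leeD (lexx _) muL) _.
rewrite -[X in (X + _ <= _)%E](fineK Lf) -!EFinD lee_fin.
exact: third_slack lowG upG H e0.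
Qed.

End local.

Section local_isoperimetric.
Context {R : realType} {n : nat}.
Implicit Types (G K : set 'rV[R]_n.+1).
Local Notation mu := (@lebesgue R n).
Local Notation meas := (@lebesgue_measurable R n).

(** Informative when |G| < 2 ^- (n + 1) |K|: the second factor is then a positive lower bound for
    the measure of the [p] in [K] whose midpoint with a given [x] lies outside [G]. *)
Lemma local_isoperimetric K G (D P : R) : cvx K -> meas K -> (mu K < +oo)%E -> 0 < D ->
  (forall x y, K x -> K y -> enorm (x - y) <= D) ->
  meas G -> (mu G < +oo)%E -> 0 <= P -> (relative_perimeter K G <= P%:E)%E ->
  fine (mu (G `&` K^°)) * (fine (mu K) - 2 ^+ n.+1 * fine (mu G)) <=
  fine (mu K) * (2 ^+ n * D * P).
Proof.
move=> cK mK Koo D0 KD mG Goo P0 GP.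
have mA : meas (G `&` K^°).
  by apply: measurableI; [exact: mG|apply: measurable_open; exact: open_interior].
have Aoo : (mu (G `&` K^°) < +oo)%E by apply: le_lt_trans Goo; apply: lebesgue_le => x [].
apply: (midpoint_average mA mK mG Aoo Koo Goo); first by rewrite !mulr_ge0 ?exprn_ge0 ?(ltW D0).
move=> p Kp; apply: (local_estimate cK Kp D0) => // z Kz; exact: KD.
Qed.

End local_isoperimetric.

Section field_sums.
Context {R : realType} {n : nat}.
Implicit Types (C E G K : set 'rV[R]_n.+1).
Local Notation mu := (@lebesgue R n).
Local Notation meas := (@lebesgue_measurable R n).

Lemma is_derive_bigsum (I : Type) (r : seq I) (V : normedModType R) (x v : V)
    (f : I -> V -> R) (df : I -> R) : (forall j, is_derive x v (f j) (df j)) ->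
  is_derive x v (fun y => \sum_(j <- r) f j y) (\sum_(j <- r) df j).
Proof.
move=> fd; elim: r => [|j r ih].
  rewrite big_nil (_ : (fun _ => _) = cst 0); first exact: is_derive_cst.
  by apply/funext => y; rewrite big_nil.
rewrite big_cons (_ : (fun _ => _) = fun y => f j y + \sum_(j <- r) f j y); last first.
  by apply/funext => y; rewrite big_cons.
exact: is_deriveD.
Qed.

Definition sumfield (I : finType) (k : R) (xi : I -> 'rV[R]_n.+1 -> 'rV[R]_n.+1)
  (x : 'rV[R]_n.+1) : 'rV[R]_n.+1 := \row_i (k * \sum_j xi j x ord0 i).

Lemma divergence_sumfield (I : finType) (k : R) (xi : I -> 'rV[R]_n.+1 -> 'rV[R]_n.+1) x :
  (forall j, smooth (xi j)) ->
  divergence (sumfield k xi) x = k * \sum_j divergence (xi j) x.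
Proof.
move=> sxi; rewrite /divergence exchange_big /= mulr_sumr; apply: eq_bigr => i _.
have d1 j := Ck_is_derive x i (sxi j 1%N i).
have := is_deriveMl k (is_derive_bigsum (index_enum I) d1).
move=> [_ <-]; rewrite /partial; congr ('D_ _ _ _).
by apply/funext => y; rewrite mxE.
Qed.

Lemma smooth_sumfield (I : finType) (k : R) (xi : I -> 'rV[R]_n.+1 -> 'rV[R]_n.+1) :
  (forall j, smooth (xi j)) -> smooth (sumfield k xi).
Proof.
move=> sxi l i; rewrite (_ : (fun _ => _) = fun x => k * \sum_j xi j x ord0 i); last first.
  by apply/funext => x; rewrite mxE.
by apply: CkZ; apply: Ck_sum => j _; exact: sxi.
Qed.

End field_sums.

Section Rintegral_sums.
Context {R : realType} {d : measure_display} {T : measurableType d}.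
Variable m : {measure set T -> \bar R}.

Lemma Rintegral_sum (I : Type) (r : seq I) (A : set T) (f : I -> T -> R) :
  measurable A -> (forall j, m.-integrable A (EFin \o f j)) ->
  m.-integrable A (EFin \o (fun x => \sum_(j <- r) f j x)) /\
  \int[m]_(x in A) (\sum_(j <- r) f j x) = \sum_(j <- r) \int[m]_(x in A) f j x.
Proof.
move=> mA fi; elim: r => [|j r [ih1 ih2]].
  have -> : (fun x : T => \sum_(j <- [::]) f j x) = cst 0.
    by apply/funext => x; rewrite big_nil.
  split; first exact: integrable0.
  by rewrite big_nil Rintegral_cst // mul0r.
have -> : (fun x : T => \sum_(i <- j :: r) f i x) = (fun x => f j x + \sum_(i <- r) f i x).
  by apply/funext => x; rewrite big_cons.
split; first exact: (integrableD mA (fi j) ih1).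
by rewrite big_cons RintegralD // ih2.
Qed.

End Rintegral_sums.

Section counting.
Context {R : realType}.

(** The window is open of length 3, so all its integers are among the three that start at the least
    one. They index, in one coordinate, the tripled grid cells that contain a given point. *)
Lemma count_window (m : nat) (y : R) :
  \sum_(k < m) ((y - 2 < k%:R < y + 1)%R : nat)%:R <= 3 :> R.
Proof.
rewrite -natr_sum ler_nat.
rewrite -(big_mkord xpredT (fun k => (y - 2 < (k%:R : R) < y + 1)%R : nat)).
pose P (k : nat) := y - 2 < (k%:R : R) < y + 1.
rewrite (_ : (\sum_(0 <= k < m) P k = count P (iota 0 m))%N); last first.
  by rewrite -sum1_count [RHS]big_mkcond /index_iota subn0; apply: eq_bigr => k _; case: (P k).
rewrite -size_filter; set s := seq.filter P (iota 0 m).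
have [s0|[k ks]] : s = [::] \/ exists k, k \in s.
- case: s => [|k s']; [by left|right]; exists k; exact: mem_head.
- by rewrite s0.
have exk : exists k, k \in s by exists k.
pose k0 := ex_minn exk.
have [k0s k0min] : k0 \in s /\ forall l, l \in s -> (k0 <= l)%N.
  by rewrite /k0; case: ex_minnP => q qs qmin; split.
have -> : 3%N = size (iota k0 3) by rewrite size_iota.
apply: uniq_leq_size; first by rewrite filter_uniq // iota_uniq.
move=> l ls; rewrite mem_iota k0min //=.
move: k0s ls; rewrite !mem_filter => /andP[/andP[h1 _] _] /andP[/andP[_ h2] _].
by rewrite -(ltr_nat R) natrD; lra.
Qed.

Lemma bernoulli_sub (d : nat) (x : R) : 0 <= x <= 1 -> 1 - d%:R * x <= (1 - x) ^+ d.
Proof.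
move=> /andP[x0 x1]; elim: d => [|d ih]; first by rewrite mul0r subr0 expr0.
have y0 : 0 <= 1 - x by rewrite subr_ge0.
rewrite exprS; apply: le_trans (ler_wpM2l y0 ih).
rewrite -subr_ge0 -natr1 (_ : _ - _ = d%:R * (x * x)); last by ring.
by rewrite !mulr_ge0.
Qed.

End counting.

(** * Boundary and local volume of a convex set *)

Section convex_volume.
Context {R : realType} {n : nat}.
Implicit Types (C E G K : set 'rV[R]_n.+1).
Local Notation mu := (@lebesgue R n).
Local Notation meas := (@lebesgue_measurable R n).

Lemma Rintegral_divergence C xi E : meas E -> (mu E < +oo)%E -> test_field C xi ->
  \int[mu]_(x in E) divergence xi x =
  \sum_i \int[mu]_(x in E) partial i (fun y => xi y ord0 i) x.
Proof.
move=> mE Eoo txi; have [sxi _ _ _] := txi.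
have [K [cK _ xiK _]] := test_fieldE txi.
have idi i : mu.-integrable E (EFin \o partial i (fun y => xi y ord0 i)).
  have cd := Ck_continuous (Ck_partial i (sxi 1%N i)).
  have [M _ dM] := bounded_compact_support cK cd
    (partial_vanishes_off i (compact_closed_rV cK) (xiK i)).
  exact: (integrable_bounded mE Eoo (measurable_continuous cd) dM).
by have [_ ->] := @Rintegral_sum _ _ _ mu _ (index_enum 'I_n.+1) E _ mE idi.
Qed.

(* Shrinking towards an interior point maps [C] into its interior. *)
Lemma convex_boundary_null C : cvx C -> meas C -> C^° !=set0 ->
  mu (C `\` C^°) = 0%E.
Proof.
move=> cC mC [p pC].
have Cp : C p by exact: interior_subset.
have mI : meas C^° by apply: measurable_open; exact: open_interior.
pose F k := C `&` [set x | `|x - p| <= k%:R].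
have bF k : bounded_set (F k).
  exists (`|p| + k%:R); split; first exact: num_real.
  move=> y ky x [_ /= xk]; apply: le_trans (ltW ky).
  by rewrite -(subrK p x) addrC; apply: (le_trans (ler_normD _ _)); rewrite lerD2l.
have mF k : meas (F k).
  apply: measurableI; first exact: mC.
  apply: measurable_closed.
  change (closed ((fun x : 'rV[R]_n.+1 => `|x - p|) @^-1` [set t : R | t <= k%:R])).
  apply: closed_comp; last exact: closed_le.
  move=> y _.
  apply: (@continuous_comp _ _ _ (fun y : 'rV[R]_n.+1 => y - p) (fun y : 'rV[R]_n.+1 => `|y|)).
    by apply: (@continuousB _ _ _ id (cst p)) => //; exact: cst_continuous.
  exact: norm_continuous.
have F0 k : mu (F k `\` C^°) = 0%E.
  have Foo : (mu (F k) < +oo)%E by exact: lebesgue_bounded.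
  have mFI : meas (F k `&` C^°) by apply: measurableI; [exact: mF|exact: mI].
  have FIoo : (mu (F k `&` C^°) < +oo)%E by apply: le_lt_trans Foo; apply: lebesgue_le => x [].
  have Ff := lebesgue_fin Foo; have FIf := lebesgue_fin FIoo.
  have shrink l : 0 < l < 1 -> l ^+ n.+1 * fine (mu (F k)) <= fine (mu (F k `&` C^°)).
    move=> /andP[l0 l1]; rewrite -lee_fin EFinM !fineK //.
    rewrite -(lebesgue_hom_image ((1 - l) *: p)) //; apply: lebesgue_le => _ [x [Cx xk] <-].
    have I1 : C^° (hom l ((1 - l) *: p) x).
      have -> : hom l ((1 - l) *: p) x = (1 - l) *: p + (1 - (1 - l)) *: x.
        by rewrite /hom addrC opprB addrCA subrr addr0.
      apply: cvx_interior => //.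
      by rewrite subr_gt0 l1 /= lerBlDr lerDl ltW.
    split; [split; [exact: interior_subset|]|exact: I1].
    rewrite /= /hom -addrA scalerBl scale1r addrAC subrr add0r -scalerBr normrZ.
    by rewrite (gtr0_norm l0) -[leRHS]mul1r ler_pM // ltW.
  have : fine (mu (F k)) <= fine (mu (F k `&` C^°)).
    apply/ler_addgt0Pr => e e0; set M := fine (mu (F k)).
    have M0 : 0 <= M by rewrite fine_ge0 // outer_measure_ge0.
    (* The set is shrunk by 1 - x; by Bernoulli this loses at most (n + 1) x M of the volume, and
       the choice of [x] makes that at most [e]. *)
    pose x := Num.min 2^-1 (e / (n.+1%:R * M + 1)).
    have B0 : 0 < n.+1%:R * M + 1 by rewrite ltr_wpDl // mulr_ge0.
    have x0 : 0 < x by rewrite lt_min invr_gt0 ltr0n /= divr_gt0.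
    have x1 : x < 1 by rewrite gt_min invf_lt1 // ltr1n.
    have : (1 - x) ^+ n.+1 * M <= fine (mu (F k `&` C^°)).
      by apply: shrink; rewrite subr_gt0 x1 /= ltrBlDr ltrDl.
    have xx : 0 <= x <= 1 by rewrite !ltW.
    have := ler_wpM2r M0 (bernoulli_sub n.+1 xx).
    have : n.+1%:R * x * M <= e.
      apply: (@le_trans _ _ (x * (n.+1%:R * M + 1))); last first.
        by rewrite -ler_pdivlMr // ge_min lexx orbT.
      by rewrite mulrAC mulrC ler_wpM2l ?(ltW x0) // lerDl.
    rewrite mulrBl mul1r => h1 h2 h3; apply: (@le_trans _ _ ((1 - x) ^+ n.+1 * M + e)).
      by rewrite -lerBlDr; apply: le_trans h2; rewrite lerD2l lerN2.
    by rewrite lerD2r.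
  rewrite (measureD (mF k) mI Foo).
  rewrite -lee_fin !fineK // => h; apply/eqP; rewrite eq_le; apply/andP; split.
    by rewrite leeBlDr // add0e.
  by rewrite sube_ge0 ?FIf //; apply: lebesgue_le => x [].
apply/eqP; rewrite eq_le outer_measure_ge0 andbT.
apply: (@le_trans _ _ (mu (\bigcup_k (F k `\` C^°)))).
  apply: lebesgue_le => x [Cx nx]; exists (Num.truncn `|x - p|).+1 => //.
  by split=> //; split=> //=; exact/ltW/truncnS_gt.
apply: le_trans (outer_measure_sigma_subadditive _ _) _.
by rewrite eseries0 // => k _ _; exact: F0.
Qed.

(** Shrinking by h / r0 towards [x] maps the ball of radius [r0] into that of radius [h] and, by
    convexity, [C] into itself. *)
Lemma ball_volume C (r0 c0 h : R) x : cvx C -> C x -> 0 < h <= r0 ->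
  (c0%:E <= mu (C `&` closed_eball x r0))%E ->
  (((h / r0) ^+ n.+1 * c0)%:E <= mu (C `&` closed_eball x h))%E.
Proof.
move=> cC Cx /andP[h0 hr] c0C.
have r00 : 0 < r0 by exact: lt_le_trans hr.
pose l := h / r0; have l0 : 0 < l by rewrite divr_gt0.
have l1 : l <= 1 by rewrite ler_pdivrMr // mul1r.
rewrite EFinM; apply: (@le_trans _ _ ((l ^+ n.+1)%:E * mu (C `&` closed_eball x r0))%E).
  by apply: lee_wpmul2l => //; rewrite lee_fin exprn_ge0 // ltW.
rewrite -(lebesgue_hom_image ((1 - l) *: x)) //; apply: lebesgue_le => _ [y [Cy yr] <-].
split; first by apply: cC => //; rewrite (ltW l0).
rewrite /closed_eball /= /hom.
have -> : l *: y + (1 - l) *: x - x = l *: (y - x).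
  by rewrite -addrA scalerBl scale1r addrAC subrr add0r -scalerBr.
rewrite enormZ (gtr0_norm l0) /l mulrAC ler_pdivrMr //.
by rewrite ler_pM2l //; exact: yr.
Qed.

End convex_volume.

(** * Isoperimetric inequality for small volumes *)

Section isoperimetric.
Context {R : realType} {n : nat}.
Implicit Types (G K : set 'rV[R]_n.+1).
Local Notation mu := (@lebesgue R n).
Local Notation meas := (@lebesgue_measurable R n).
Variables (C : set 'rV[R]_n.+1) (r0 c0 : R).
Hypotheses (cC : cvx C) (clC : closed C) (C0 : C^° !=set0) (r00 : 0 < r0) (c00 : 0 < c0).
Hypothesis volC : forall x, C x -> (c0%:E <= mu (C `&` closed_eball x r0))%E.

(** The cube of corner [c] and side [h] is enlarged by [h] on every side so as to contain every ball
    of radius [h] centred in it. *)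
Definition cell (c : 'rV[R]_n.+1) (h : R) : set 'rV[R]_n.+1 :=
  C `&` [set x | forall i, c ord0 i - h <= x ord0 i <= c ord0 i + 2 * h].

Lemma closed_cell c h : closed (cell c h).
Proof.
have -> : cell c h = C `&` \bigcap_(i in [set: 'I_n.+1]) ((fun x : 'rV[R]_n.+1 => x ord0 i) @^-1`
   [set` `[c ord0 i - h, c ord0 i + 2 * h]]).
  apply/seteqP; split=> x /= [Cx H]; split=> // i; last by have := H i Logic.I; rewrite /= in_itv.
  by move=> _; rewrite /= in_itv /=; exact: H.
apply: closedI => //; apply: closed_bigI => i _; apply: closed_comp; last exact: itv_closed.
by move=> x _; exact: coord_continuous.
Qed.

Lemma cvx_cell c h : cvx (cell c h).
Proof.
move=> x y l [Cx Hx] [Cy Hy] l01; split; first exact: cC.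
move: l01 => /andP[l0 l1] i; rewrite !mxE.
have /andP[x1 x2] := Hx i; have /andP[y1 y2] := Hy i.
have l1' : 0 <= 1 - l by rewrite subr_ge0.
apply/andP; split.
  have := lerD (ler_wpM2l l0 x1) (ler_wpM2l l1' y1).
  by apply: le_trans; rewrite -mulrDl [l + _]addrC subrK mul1r.
have := lerD (ler_wpM2l l0 x2) (ler_wpM2l l1' y2).
by move=> /le_trans; apply; rewrite -mulrDl [l + _]addrC subrK mul1r.
Qed.

Lemma cell_diam c h x y : 0 < h -> cell c h x -> cell c h y ->
  enorm (x - y) <= n.+1%:R * (3 * h).
Proof.
move=> h0 [_ Hx] [_ Hy]; apply: (le_trans (enorm_norm_le _)); rewrite ler_wpM2l //.
apply: norm_le_coord; first by rewrite mulr_ge0 // ltW.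
move=> i; have /andP[x1 x2] := Hx i; have /andP[y1 y2] := Hy i.
by rewrite !mxE ler_norml; apply/andP; split; lra.
Qed.

Lemma cell_bounded c h : 0 < h -> bounded_set (cell c h).
Proof.
move=> h0; exists (`|c| + 2 * h); split; first exact: num_real.
move=> M hM x [_ Hx]; apply: le_trans (ltW hM); apply: norm_le_coord.
  by rewrite addr_ge0 // mulr_ge0 // ltW.
move=> i; have /andP[x1 x2] := Hx i.
have := coord_le_norm c i; rewrite !ler_norml => /andP[c1 c2].
by apply/andP; split; lra.
Qed.

Lemma interior_cellE c h : (cell c h)^° =
  C^° `&` obox (c - const_mx h, c + const_mx (2 * h)).
Proof.
apply/seteqP; split => [x Kx|].
  split; first by move: x Kx; apply: interiorS => x [].
  have [e e0 He] := interior_nbhs Kx.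
  have e2 : 0 < e / 2 by rewrite divr_gt0.
  have ne (k : R) i : `|k| <= e / 2 -> `|x - (x + k *: delta_mx ord0 i)| < e.
    move=> ke; rewrite opprD addNKr normrN normrZ.
    have h1 := @norm_delta_le1 R n i.
    apply: (@le_lt_trans _ _ (e / 2 * 1)); first by rewrite ler_pM.
    by rewrite mulr1 ltr_pdivrMr // mulr_natr mulr2n ltrDl.
  have k1 : `|e / 2| <= e / 2 by rewrite ger0_norm // ltW.
  have k2 : `|- (e / 2)| <= e / 2 by rewrite normrN.
  move=> i; rewrite !mxE.
  have [_ /(_ i)] := He (x + (e / 2) *: delta_mx ord0 i) (ne (e / 2) i k1).
  rewrite !mxE !eqxx mulr1 => /andP[_ h2].
  have [_ /(_ i)] := He (x + (- (e / 2)) *: delta_mx ord0 i) (ne (- (e / 2)) i k2).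
  rewrite !mxE !eqxx mulr1 => /andP[h1 _].
  by apply/andP; split; lra.
rewrite -open_subsetE; last by apply: openI; [exact: open_interior|exact: open_obox].
move=> x [Cx Ox]; split; first exact: interior_subset.
by move=> i; have := Ox i; rewrite !mxE => /andP[/ltW -> /ltW ->].
Qed.

Definition cube (c : 'rV[R]_n.+1) (h : R) : set 'rV[R]_n.+1 :=
  [set x : 'rV[R]_n.+1 | forall i, c ord0 i <= x ord0 i <= c ord0 i + h].

(** With this [A], |G| <= A h ^ (n + 1) makes 2 ^ (n + 1) |G| at most half of c0 (h / r0) ^ (n + 1),
    the lower bound for the volume of a cell whose cube meets [G]; [B1] collects 2 ^ n, the diameter
    bound 3 (n + 1) h up to the factor [h], and a 2 for that half. *)
Let A := c0 / (2 ^+ n.+2 * r0 ^+ n.+1).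
Let B1 := 2 ^+ n.+1 * (n.+1%:R * 3) : R.

(** Either there is nothing to estimate or [G] has a point in the cube, around which [C] has enough
    volume within the cell for the second factor in [local_isoperimetric] to be at least half the
    volume of the cell. *)
Lemma cell_estimate c h G (P : R) : 0 < h <= r0 -> meas G -> G `<=` C ->
  (mu G <= (A * h ^+ n.+1)%:E)%E -> 0 <= P ->
  (relative_perimeter (cell c h) G <= P%:E)%E ->
  fine (mu (G `&` C^° `&` cube c h)) <= B1 * h * P.
Proof.
move=> hr mG GC GA P0 GP; have /andP[h0 _] := hr.
have B10 : 0 <= B1 * h * P by rewrite !mulr_ge0 ?exprn_ge0 ?(ltW h0).
have [[x [[Gx _] Qx]]|/nonemptyPn ->] :=
  pselect ((G `&` C^° `&` cube c h) !=set0); last by rewrite measure0.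
have sub : closed_eball x h `<=` [set y | forall i, c ord0 i - h <= y ord0 i <= c ord0 i + 2 * h].
  move=> y yh i; have := le_trans (coord_le_enorm (y - x) i) yh.
  rewrite !mxE ler_norml => /andP[h1 h2]; have /andP[q1 q2] := Qx i.
  by apply/andP; split; lra.
have vol := ball_volume cC (GC x Gx) hr (volC (GC x Gx)).
set K := cell c h.
have mK : meas K by apply: measurable_closed; exact: closed_cell.
have Koo : (mu K < +oo)%E by apply: lebesgue_bounded; exact: cell_bounded.
have Goo : (mu G < +oo)%E by apply: le_lt_trans GA _; rewrite ltry.
have volK : (h / r0) ^+ n.+1 * c0 <= fine (mu K).
  rewrite -lee_fin fineK ?lebesgue_fin //; apply: le_trans vol _.
  by apply: lebesgue_le => y [Cy yh]; split => //; exact: sub.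
have vp : 0 < (h / r0) ^+ n.+1 * c0 by rewrite mulr_gt0 // exprn_gt0 // divr_gt0.
have Kp : 0 < fine (mu K) by exact: lt_le_trans volK.
have D0 : 0 < n.+1%:R * (3 * h) by rewrite !mulr_gt0.
have := local_isoperimetric (@cvx_cell c h) mK Koo D0
  (fun x y Kx Ky => cell_diam h0 Kx Ky) mG Goo P0 GP.
have half : 2 ^+ n.+1 * fine (mu G) <= fine (mu K) / 2.
  have : fine (mu G) <= A * h ^+ n.+1 by rewrite -lee_fin fineK // lebesgue_fin.
  have p0 : (0 : R) < 2 ^+ n.+1 by rewrite exprn_gt0.
  move=> /(ler_wpM2l (ltW p0)) /le_trans; apply.
  rewrite ler_pdivlMr //; apply: le_trans volK; rewrite /A exprMn exprVn.
  rewrite le_eqVlt; apply/orP; left; apply/eqP.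
  rewrite [2 ^+ n.+2]exprS; field.
  by rewrite !expf_neq0 ?gt_eqF.
set g := fine (mu (G `&` K^°)); have g0 : 0 <= g by rewrite fine_ge0 // outer_measure_ge0.
move=> H; have {}H : g <= B1 * h * P.
  rewrite -(ler_pM2l Kp); have : g * (fine (mu K) / 2) <= fine (mu K) * (2 ^+ n * (n.+1%:R * (3 * h)) * P).
    apply: le_trans H; rewrite ler_wpM2l //.
    by rewrite lerBrDr -lerBrDl; apply: le_trans half _; lra.
  rewrite /B1 exprS; move: (fine (mu K)) (2 ^+ n) => k t; lra.
apply: le_trans H; apply: fine_le.
- by apply: lebesgue_fin; apply: le_lt_trans Goo; apply: lebesgue_le => y [[]].
- by apply: lebesgue_fin; apply: le_lt_trans Goo; apply: lebesgue_le => y [].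
apply: lebesgue_le => y [[Gy Cy] Qy]; split => //; rewrite interior_cellE; split => //.
by move=> i; have /andP[q1 q2] := Qy i; rewrite !mxE; apply/andP; split; lra.
Qed.

(** [cell_estimate] by contraposition: were all fields of the cell worse, its perimeter would be too
    small. Fields are wanted rather than perimeters because they can be added over the cells. *)
Lemma cell_field c h G (e : R) : 0 < h <= r0 -> meas G -> G `<=` C ->
  (mu G <= (A * h ^+ n.+1)%:E)%E -> 0 < e ->
  exists2 xi, test_field (cell c h) xi &
   fine (mu (G `&` C^° `&` cube c h)) / (B1 * h) - e <= \int[mu]_(x in G) divergence xi x.
Proof.
move=> hr mG GC GA e0; have /andP[h0 _] := hr.
have Goo : (mu G < +oo)%E by apply: le_lt_trans GA _; rewrite ltry.
set q := fine _; apply: contrapT => nxi.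
have B1p : 0 < B1 * h by rewrite !mulr_gt0 ?exprn_gt0.
have H xi : test_field (cell c h) xi -> \int[mu]_(x in G) divergence xi x <= q / (B1 * h) - e.
  move=> txi; rewrite leNgt; apply/negP => lt; apply: nxi; exists xi => //; exact: ltW.
have P0 : 0 <= q / (B1 * h) - e.
  apply: le_trans (H _ (test_field0 _)).
  have -> : \int[mu]_(x in G) divergence (fun=> 0 : 'rV[R]_n.+1) x = \int[mu]_(x in G) 0.
    by apply: eq_Rintegral => x _; exact: divergence0.
  by rewrite Rintegral_cst // mul0r.
have HP : (relative_perimeter (cell c h) G <= (q / (B1 * h) - e)%:E)%E.
  by apply: (perimeter_le mG Goo) => xi txi; rewrite lee_fin; exact: H.
have := cell_estimate hr mG GC GA P0 HP; rewrite -/q -ler_pdivrMl // mulrC.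
by rewrite lerBrDr gerDl leNgt e0.
Qed.

(** Normalises a sum of cell fields: at most 3 ^ (n + 1) of them are nonzero at a point, and n + 1
    bounds the Euclidean norm by the sup norm. *)
Let W := n.+1%:R * 3 ^+ n.+1 : R.

(* Sum the nearly optimal fields of all cells of a grid of mesh [h]: the tripled cells overlap at
   most [3 ^+ n.+1] times. *)
Lemma grid_estimate (h : R) G (P : R) N : 0 < h <= r0 -> meas G -> G `<=` C ->
  (mu G <= (A * h ^+ n.+1)%:E)%E -> 0 <= P -> (relative_perimeter C G <= P%:E)%E ->
  (mu (G `&` C^° `&` [set x : 'rV[R]_n.+1 | (`|x| < N%:R * h)%R]) <= (B1 * h * (W * P))%:E)%E.
Proof.
move=> hr mG GC GA P0 GP; have /andP[h0 _] := hr.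
have Goo : (mu G < +oo)%E by apply: le_lt_trans GA _; rewrite ltry.
have B1p : 0 < B1 * h by rewrite !mulr_gt0 ?exprn_gt0.
have W0 : 0 < W by rewrite mulr_gt0 ?exprn_gt0.
(* The shift by [N] in the corners h (j - N) makes the cubes cover |x| < N h. *)
pose I := {ffun 'I_n.+1 -> 'I_(N + N)%N}.
pose cor (j : I) : 'rV[R]_n.+1 := \row_i (h * ((j i)%:R - N%:R)).
pose Q (j : I) := G `&` C^° `&` cube (cor j) h.
have Qoo j : (mu (Q j) < +oo)%E by apply: le_lt_trans Goo; apply: lebesgue_le => x [[]].
have cover : G `&` C^° `&` [set x : 'rV[R]_n.+1 | `|x| < N%:R * h] `<=` \big[setU/set0]_(j : I) Q j.
  move=> x [Gx xN]; rewrite -bigcup_seq.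
  have xi i : 0 <= x ord0 i / h + N%:R < (N + N)%N%:R.
    have := le_lt_trans (coord_le_norm x i) xN.
    rewrite ltr_norml -mulNr => /andP[h1 h2].
    move: h1 h2; rewrite -ltr_pdivlMr // => h1; rewrite -ltr_pdivrMr // => h2; rewrite natrD.
    by apply/andP; split; lra.
  have lt i : (Num.truncn (x ord0 i / h + N%:R) < N + N)%N.
    by have /andP[x1 x2] := xi i; rewrite truncn_lt_nat.
  exists [ffun i => Ordinal (lt i)]; first by rewrite /= mem_index_enum.
  split => // i; rewrite !mxE ffunE /=.
  have /andP[x1 _] := xi i; have /andP[t1 t2] := truncn_itv x1.
  set t := Num.truncn _ in t1 t2 *.
  have -> : x ord0 i = h * (x ord0 i / h) by rewrite mulrCA divff ?gt_eqF // mulr1.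
  rewrite -[X in _ <= _ + X](mulr1 h) -mulrDr !ler_pM2l //; move: t2; rewrite -natr1 => t2.
  by apply/andP; split; lra.
apply: le_trans (lebesgue_le cover) _.
have sumle : (mu (\big[setU/set0]_(j : I) Q j) <= (\sum_(j : I) fine (mu (Q j)))%:E)%E.
  elim/big_ind2 : _ => [|S s S' s' h1 h2|j _].
  - by rewrite measure0.
  - by apply: le_trans (outer_measureU2 _ _ _) _; rewrite EFinD; apply: leeD.
  - by rewrite fineK // lebesgue_fin.
apply: le_trans sumle _; rewrite lee_fin.
apply/ler_addgt0Pr => e e0.
(* Slack per cell: summed over the cells and multiplied by B1 h it stays below [e]. The + 1 avoids a
   division by 0. *)
pose e' := e / (B1 * h * (#|I|%:R + 1)).
have e'0 : 0 < e' by rewrite divr_gt0 // mulr_gt0 // ltr_wpDl.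
have /choice[xi xiP] : forall j : I, exists xi, test_field (cell (cor j) h) xi /\
    fine (mu (Q j)) / (B1 * h) - e' <= \int[mu]_(x in G) divergence xi x.
  by move=> j; have [xi] := cell_field (cor j) hr mG GC GA e'0; exists xi.
have sxi j : smooth (xi j) by have [[]] := xiP j.
have /choice[S SP] : forall j : I, exists S, [/\ compact S, S `<=` (cell (cor j) h)^°,
    forall i, vanishes_off S (fun x => xi j x ord0 i) & forall x i, `|xi j x ord0 i| <= 1].
  by move=> j; exact: test_fieldE (xiP j).1.
have tz : test_field C (sumfield W^-1 xi).
  apply: (@test_fieldI _ _ _ _ (\big[setU/set0]_(j : I) S j)).
  - exact: smooth_sumfield.
  - by apply: bigsetU_compact => j _; have [] := SP j.
  - move=> x; rewrite -bigcup_seq => -[j _ Sx]; have [_ + _ _] := SP j.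
    by move=> /(_ x Sx); rewrite interior_cellE => -[].
  - move=> x nx; apply/rowP => i; rewrite !mxE big1 ?mulr0 // => j _.
    have [_ _ xi0 _] := SP j; apply: xi0 => Sx; apply: nx.
    by rewrite -bigcup_seq; exists j => //=; rewrite mem_index_enum.
  - move=> x; apply: (le_trans (enorm_norm_le _)).
    rewrite mulrC -ler_pdivlMr // mul1r; apply: norm_le_coord.
      by rewrite invr_ge0.
    move=> i; rewrite mxE normrM normfV (gtr0_norm W0) /W invfM -mulrA.
    rewrite -[leRHS]mulr1 ler_pM2l ?invr_gt0 // ler_pdivrMl ?exprn_gt0 // mulr1.
    apply: (le_trans (ler_norm_sum _ _ _)).
    pose y i := x ord0 i / h + N%:R.
    (* A cell whose field is nonzero at [x] has all its indices in the windows; the sum of products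
       then factors into one count per coordinate. *)
    apply: (@le_trans _ _ (\sum_(j : I) \prod_i ((y i - 2 < (j i)%:R < y i + 1)%R : nat)%:R)).
      apply: ler_sum => j _; have [_ Sint xi0 xi1] := SP j.
      have [Sx|nSx] := pselect (S j x); last first.
        by rewrite (xi0 i x nSx) normr0; apply: prodr_ge0.
      rewrite big1 // => l _.
      have := Sint x Sx; rewrite interior_cellE => -[_ /(_ l)]; rewrite !mxE.
      have -> : x ord0 l = h * (x ord0 l / h) by rewrite mulrCA divff ?gt_eqF // mulr1.
      rewrite -[X in _ - X < _ < _](mulr1 h) [2 * h]mulrC -mulrBr -mulrDr !ltr_pM2l //.
      by move=> /andP[h1 h2]; rewrite /y; case: andP => // -[]; split; lra.
    rewrite -(bigA_distr_bigA (fun i (k : 'I_(N + N)%N) => ((y i - 2 < k%:R < y i + 1)%R : nat)%:R)) /=.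
    have -> : 3 ^+ n.+1 = \prod_(i < n.+1) (3 : R) by rewrite prodr_const card_ord.
    apply: ler_prod => l _; rewrite count_window andbT; apply: sumr_ge0 => k _.
    exact: ler0n.
have := perimeter_ge mG Goo tz; move=> /le_trans/(_ GP); rewrite lee_fin.
have ixi j : mu.-integrable G (EFin \o divergence (xi j)).
  exact: (divergence_integrable mG Goo (xiP j).1).
have [is1 is2] := @Rintegral_sum _ _ _ mu I (index_enum I) G _ mG ixi.
have -> : \int[mu]_(x in G) divergence (sumfield W^-1 xi) x =
    W^-1 * \sum_j \int[mu]_(x in G) divergence (xi j) x.
  rewrite -is2 -RintegralZl //; apply: eq_Rintegral => x _.
  exact: divergence_sumfield.
rewrite ler_pdivrMl // => H.
have {}H : \sum_j (fine (mu (Q j)) / (B1 * h) - e') <= W * P.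
  by apply: le_trans H; apply: ler_sum => j _; exact: (xiP j).2.
rewrite sumrB sumr_const -mulr_suml lerBlDr ler_pdivrMr // in H.
apply: (le_trans H); rewrite mulrDl [W * P * _]mulrC lerD2l.
rewrite -[_ *+ _]mulr_natl /e'.
have m1 : 0 < #|I|%:R + 1 :> R by rewrite ltr_wpDl.
rewrite (_ : _ * _ * _ = e * (#|I|%:R / (#|I|%:R + 1))).
  by rewrite -[leRHS]mulr1 ler_pM2l // ler_pdivrMr // mul1r lerDl.
move: (#|I|%:R : R) (B1 * h) B1p m1 => k b b0 k0.
by field; rewrite !gt_eqF.
Qed.

(** The bound of [grid_estimate] does not depend on [N]: the far part of [G] has measure at most
    [e], and its part on the boundary of [C] is null. *)
Lemma small_isoperimetric : exists A B : R, [/\ 0 < A, 0 < B &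
  forall h G (P : R), 0 < h <= r0 -> meas G -> G `<=` C ->
    (mu G <= (A * h ^+ n.+1)%:E)%E -> 0 <= P -> (relative_perimeter C G <= P%:E)%E ->
    (mu G <= (B * h * P)%:E)%E].
Proof.
have W0 : 0 < W by rewrite mulr_gt0 ?exprn_gt0.
exists A, (B1 * W); split.
- by rewrite divr_gt0 // mulr_gt0 ?exprn_gt0.
- by rewrite mulr_gt0 // mulr_gt0 ?exprn_gt0.
move=> h G P hr mG GC GA P0 GP; have /andP[h0 _] := hr.
have Goo : (mu G < +oo)%E by apply: le_lt_trans GA _; rewrite ltry.
have mC : meas C by exact: measurable_closed.
have mI : meas C^° by apply: measurable_open; exact: open_interior.
apply/lee_addgt0Pr => e e0.
have [N' FN'] := small_outside mG Goo e0.
pose N := (Num.truncn (N'%:R / h)).+1.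
have N'N : N'%:R < N%:R * h by rewrite -ltr_pdivrMr //; exact: truncnS_gt.
pose F := G `\` [set x : 'rV[R]_n.+1 | `|x| <= N'%:R].
have H := grid_estimate N hr mG GC GA P0 GP.
apply: (@le_trans _ _ (mu ((C `\` C^°) `|`
    ((G `&` C^° `&` [set x : 'rV[R]_n.+1 | (`|x| < N%:R * h)%R]) `|` F)))).
  apply: lebesgue_le => x Gx.
  have [Ix|nIx] := pselect (C^° x); last by left; split => //; exact: GC.
  right; have [xN|xN] := pselect (`|x| <= N'%:R); [left|right]; split => //=.
  exact: le_lt_trans xN N'N.
apply: le_trans (outer_measureU2 _ _ _) _.
have N0 : mu (C `\` C^°) = 0%E by exact: convex_boundary_null.
have N0' : (mu (C `\` C^°) <= 0)%E by rewrite N0.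
apply: le_trans (leeD N0' (lexx _)) _; rewrite add0e; apply: le_trans (outer_measureU2 _ _ _) _.
apply: leeD => //; apply: le_trans H _.
by rewrite lee_fin mulrA [X in _ <= X * P]mulrAC.
Qed.

End isoperimetric.

(** * Deformations *)

Section shear.
Context {R : realType} {n : nat}.
Implicit Types (A B F K L : set 'rV[R]_n.+1) (g h : 'rV[R]_n.+1 -> R).
Local Notation mu := (@lebesgue R n).
Local Notation meas := (@lebesgue_measurable R n).
Local Notation T := (caratheodory_type (@lebesgue_outer R n)).
Variables (f : 'rV[R]_n.+1 -> R) (i : 'I_n.+1) (K : set 'rV[R]_n.+1).
Hypotheses (fs : forall k, Ck k f) (cK : compact K) (fK : vanishes_off K f).

Definition shear (t : R) (x : 'rV[R]_n.+1) : 'rV[R]_n.+1 :=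
  x + (t * f x) *: delta_mx ord0 i.

(** Determinant of the differential of [shear], affine in [t] because only one coordinate moves. *)
Definition jac (t : R) (x : 'rV[R]_n.+1) : R := 1 + t * partial i f x.

Lemma shearE (t : R) x j : shear t x ord0 j = x ord0 j + t * f x * (j == i)%:R.
Proof. by rewrite !mxE eqxx. Qed.

Lemma shear_off (t : R) x : ~ K x -> shear t x = x.
Proof. by move=> nK; rewrite /shear fK // mulr0 scale0r addr0. Qed.

Lemma Ck_shear (t : R) k j : Ck k (fun x => shear t x ord0 j).
Proof.
have -> : (fun x => shear t x ord0 j) = (fun x => x ord0 j + (t * (j == i)%:R) * f x).
  by apply/funext => x; rewrite shearE mulrAC.
by apply: CkD; [exact: Ck_coord|apply: CkZ; exact: fs].
Qed.

Lemma Ck_jac (t : R) k : Ck k (jac t).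
Proof. by apply: CkD; [exact: Ck_cst|apply: CkZ; apply: Ck_partial; exact: fs]. Qed.

Lemma is_derive_shear_time (t : R) x j :
  is_derive t 1 (fun t => shear t x ord0 j) (f x * (j == i)%:R).
Proof.
have -> : (fun t => shear t x ord0 j) = (fun t => (f x * (j == i)%:R) * t + x ord0 j).
  by apply/funext => s; rewrite shearE addrC [in RHS]mulrC mulrA.
have := is_deriveD (is_deriveMl (f x * (j == i)%:R) (is_derive_id t (1 : R)))
  (is_derive_cst (x ord0 j) t (1 : R)).
by rewrite mulr1 addr0.
Qed.

Lemma sum_delta (a b : R) (l : 'I_n.+1) (c : 'I_n.+1 -> R) :
  \sum_j c j * (a * (j == l)%:R + b * (j == i)%:R) = a * c l + b * c i.
Proof.
transitivity (\sum_j (c j * a) * (j == l)%:R + \sum_j (c j * b) * (j == i)%:R).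
  by rewrite -big_split; apply: eq_bigr => j _; rewrite mulrDr !mulrA.
rewrite (bigD1 l) //= eqxx mulr1 big1 ?addr0; last by move=> j /negbTE ->; rewrite mulr0.
rewrite (bigD1 i) //= eqxx mulr1 big1 ?addr0; last by move=> j /negbTE ->; rewrite mulr0.
by rewrite mulrC [c i * b]mulrC.
Qed.

Lemma is_derive_shear (t : R) x l g : Ck 1 g ->
  is_derive x (delta_mx ord0 l) (g \o shear t)
    (partial l g (shear t x) + t * partial l f x * partial i g (shear t x)).
Proof.
move=> g1.
have dS j : is_derive x (delta_mx ord0 l : 'rV[R]_n.+1) (fun y => shear t y ord0 j)
    (1 * (j == l)%:R + t * partial l f x * (j == i)%:R).
  have -> : (fun x => shear t x ord0 j) = (fun x => x ord0 j + (t * (j == i)%:R) * f x).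
    by apply/funext => y; rewrite shearE mulrAC.
  have := is_deriveD (is_derive_coord x (delta_mx ord0 l) j)
    (is_deriveMl (t * (j == i)%:R) (Ck_is_derive x l (fs 1))).
  by rewrite mxE eqxx /= mul1r mulrAC.
have := is_derive_comp_C1 g1 dS.
by rewrite (sum_delta 1 (t * partial l f x) l (fun j => partial j g (shear t x))) mul1r.
Qed.

Lemma continuous_shear (t : R) : continuous (shear t).
Proof. by apply: continuous_rV => j; exact: (Ck_continuous (k := 0) (Ck_shear t 0 j)). Qed.

(* The derivative in [t] of the left integrand is [partial i] of [(g \o shear t) * f], whose
   integral vanishes. *)
Lemma shear_integral L g B (t : R) : compact L -> Ck 1 g -> vanishes_off L g ->
  meas B -> (mu B < +oo)%E -> K `<=` B ->
  \int[mu]_(x in B) (g (shear t x) * jac t x) = \int[mu]_(x in B) g x.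
Proof.
move=> cL g1 gL mB Boo KB.
have dgL := partial_vanishes_off i (compact_closed_rV cL) gL.
have dfK := partial_vanishes_off i (compact_closed_rV cK) fK.
have [M1 M10 gM] := bounded_compact_support cL (Ck_continuous g1) gL.
have [M2 M20 dgM] := bounded_compact_support cL (Ck_continuous (Ck_partial i g1)) dgL.
have [M3 M30 fM] := bounded_compact_support cK (Ck_continuous (fs 1)) fK.
have [M4 M40 dfM] := bounded_compact_support cK (Ck_continuous (Ck_partial i (fs 1))) dfK.
pose w (t : R) x := g (shear t x) * jac t x.
pose dw (t : R) x := partial i g (shear t x) * f x * jac t x + g (shear t x) * partial i f x.
have jacM (s : R) x : `|jac s x| <= 1 + `|s| * M4.
  apply: (le_trans (ler_normD _ _)); rewrite normr1 lerD2l normrM.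
  by rewrite ler_wpM2l.
have Cw s : Ck 1 (w s).
  by apply: CkM; [exact: (Ck_comp (Ck_shear s 1) g1)|exact: Ck_jac].
have iw s : mu.-integrable B (EFin \o w s).
  apply: (integrable_bounded (M := M1 * (1 + `|s| * M4)) mB Boo).
    exact: (measurable_continuous (Ck_continuous (Cw s))).
  by move=> x; rewrite normrM ler_pM.
have dwd (s : R) x : is_derive s 1 (w ^~ x) (dw s x).
  have d1 := is_derive_comp_C1 g1 (is_derive_shear_time s x).
  have d2 : is_derive s 1 (fun s => jac s x) (partial i f x).
    have := is_deriveD (is_derive_cst (1 : R) s (1 : R))
      (is_deriveMl (partial i f x) (is_derive_id s (1 : R))).
    rewrite mulr1 add0r; congr is_derive.
    by apply/funext => y /=; rewrite /jac mulrC.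
  have := is_deriveM d1 d2; congr is_derive.
  rewrite /dw addrC; congr (_ + _).
  have := sum_delta 0 (f x) i (fun j => partial j g (shear s x)).
  under eq_bigr do rewrite mul0r add0r.
  by rewrite mul0r add0r => ->; rewrite [RHS]mulrC [f x * _]mulrC.
have dM (s : R) : exists M, forall t x, t \in `]s - 1, s + 1[ -> `|dw t x| <= M.
  exists (M2 * M3 * (1 + (`|s| + 1) * M4) + M1 * M4) => u x.
  rewrite in_itv /= => /andP[u1 u2].
  have us : `|u| <= `|s| + 1.
    have -> : u = s + (u - s) by rewrite addrC subrK.
    apply: (le_trans (ler_normD _ _)); rewrite lerD2l ler_norml.
    by apply/andP; split; lra.
  apply: (le_trans (ler_normD _ _)); apply: lerD; rewrite !normrM; last by rewrite ler_pM.
  apply: ler_pM; rewrite ?mulr_ge0 //; first by rewrite ler_pM.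
  by apply: (le_trans (jacM u x)); rewrite lerD2l ler_wpM2r.
have dw0 (s : R) : \int[mu]_(x in B) dw s x = 0.
  have -> : \int[mu]_(x in B) dw s x = \int[mu]_(x in B) partial i (fun y => (g \o shear s) y * f y) x.
    apply: eq_Rintegral => x _.
    have := is_deriveM (is_derive_shear s x i g1) (Ck_is_derive x i (fs 1)).
    rewrite /partial => -[_ ->]; rewrite /dw /jac /=.
    have E (a b c d e : R) : a * b * (1 + c * d) + e * d = e * d + b * (a + c * d * a) by ring.
    exact: E.
  apply: (integral_partial0 (K := K)) => //.
    by apply: CkM; [exact: (Ck_comp (Ck_shear s 1) g1)|exact: fs].
  by move=> x nK; rewrite fK // mulr0.
have dI (s : R) : is_derive s 1 (fun t => \int[mu]_(x in B) w t x) 0.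
  have [M HM] := dM s; rewrite -(dw0 s).
  apply: (@is_derive_Rintegral _ _ T mu B w dw s (s - 1) (s + 1) M mB Boo).
  - by rewrite in_itv /= ltrDl gtrDl ltr01 oppr_lt0 ltr01.
  - by move=> u _; exact: iw.
  - by move=> u x; exact: HM.
have [c _] := MVT0 t dI; rewrite mul0r => /eqP; rewrite subr_eq0 => /eqP ->.
apply: eq_Rintegral => x _; rewrite /w /shear /jac !mul0r scale0r !addr0.
by rewrite mulr1.
Qed.

End shear.

Lemma Rintegral_indicM {R : realType} {d : measure_display} {T : measurableType d}
    (m : {measure set T -> \bar R}) (A S : set T) (g : T -> R) : S `<=` A ->
  \int[m]_(x in A) (\1_S x * g x) = \int[m]_(x in S) g x.
Proof.
move=> SA; transitivity (\int[m]_(x in S) (\1_S x * g x)); last first.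
  by apply: eq_Rintegral => x xS; rewrite indicE xS mul1r.
apply: Rintegral_agree => x; rewrite indicE; case: (boolP (x \in S)) => [|_].
  by rewrite inE => Sx _; split=> // _; exact: SA.
by rewrite mul0r eqxx.
Qed.

(** * Change of variables for sets *)

Section shear_sets.
Context {R : realType} {n : nat}.
Implicit Types (A B F K L : set 'rV[R]_n.+1) (g h : 'rV[R]_n.+1 -> R).
Local Notation mu := (@lebesgue R n).
Local Notation meas := (@lebesgue_measurable R n).
Local Notation T := (caratheodory_type (@lebesgue_outer R n)).

Lemma increasing_integral (A : nat -> set 'rV[R]_n.+1) g (M : R) :
  (forall k, meas (A k)) -> (forall k l, (k <= l)%N -> A k `<=` A l) ->
  (mu (\bigcup_k A k) < +oo)%E -> measurable_fun [set: T] g -> (forall x, `|g x| <= M) ->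
  \int[mu]_(x in A k) g x @[k --> \oo] --> \int[mu]_(x in \bigcup_k A k) g x.
Proof.
move=> mA incA Aoo mg gM.
have mU : meas (\bigcup_k A k) by exact: (bigcup_measurable (fun k _ => mA k)).
have M0 : 0 <= M by exact: le_trans (normr_ge0 _) (gM 0).
have H := @bounded_convergence R n (\bigcup_k A k) (fun k x => \1_(A k) x * g x) g M mU Aoo.
have -> : (fun k => \int[mu]_(x in A k) g x) =
    fun k => \int[mu]_(x in \bigcup_k A k) (\1_(A k) x * g x).
  apply/funext => k; apply/esym; apply: (@Rintegral_indicM _ _ T mu).
  by move=> x Ax; exists k.
apply: H.
- by move=> k; exact: (measurable_funM (measurable_indic (mA k)) mg).
- exact: mg.
- move=> k x; rewrite normrM -[leRHS]mul1r ler_pM // indicE.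
  by case: (x \in _); rewrite ?normr1 ?normr0.
- move=> x [k0 _ Ax]; apply: cvg_near_cst; near=> k.
  rewrite indicE mem_set ?mul1r //; apply: incA Ax.
  by near: k; exact: nbhs_infty_ge.
Unshelve. all: by end_near. Qed.

Variables (f : 'rV[R]_n.+1 -> R) (i : 'I_n.+1) (K : set 'rV[R]_n.+1) (t N : R).
Hypotheses (fs : forall k, Ck k f) (cK : compact K) (fK : vanishes_off K f).
Hypotheses (t0 : 0 <= t) (dfN : forall x, `|partial i f x| <= N) (tN : t * N <= 2^-1).
Local Notation Phi := (shear f i t).
Local Notation J := (jac f i t).

(** Points with the same image differ at most in coordinate [i], and the mean value theorem bounds
    that difference by half of itself. *)
Lemma shear_inj : injective Phi.
Proof.
move=> x y xy.
have E j : x ord0 j + t * f x * (j == i)%:R = y ord0 j + t * f y * (j == i)%:R.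
  by rewrite -!shearE xy.
have Ej j : j != i -> x ord0 j = y ord0 j.
  by move=> /negbTE ji; have := E j; rewrite ji !mulr0 !addr0.
apply/rowP => j; have [->|] := eqVneq j i; last exact: Ej.
have [z _] := C1_increment y x (fs 1).
rewrite (bigD1 i) //= big1 ?addr0 => [fd|l li]; last by rewrite Ej // subrr mulr0.
have := E i; rewrite eqxx !mulr1 => Ei.
have H : x ord0 i - y ord0 i = - (t * partial i f (z i)) * (x ord0 i - y ord0 i).
  rewrite mulNr -mulrA -fd; move: Ei; move: (f x) (f y) => a b e.
  by rewrite mulrBr opprB; apply/eqP; rewrite subr_eq [_ + y _ _]addrC addrA -e addrK.
apply/eqP; rewrite -subr_eq0 -normr_eq0.
have : `|x ord0 i - y ord0 i| <= 2^-1 * `|x ord0 i - y ord0 i|.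
  rewrite {1}H normrM normrN normrM (ger0_norm t0) ler_wpM2r //.
  by apply: le_trans tN; rewrite ler_wpM2l.
have := normr_ge0 (x ord0 i - y ord0 i).
move: (`|_|) => u u0 uh; rewrite eq_le u0 andbT; lra.
Qed.

Lemma jac_bound x : `|J x| <= 2.
Proof.
apply: (le_trans (ler_normD _ _)); rewrite normr1 -[2]/(1 + 1) lerD2l normrM (ger0_norm t0).
apply: (@le_trans _ _ (t * N)); first by rewrite ler_wpM2l.
by apply: (le_trans tN); rewrite invf_le1 // ler1n.
Qed.

Lemma continuous_jac : continuous J.
Proof. exact: (Ck_continuous (Ck_jac i fs t 0)). Qed.

Lemma compact_shear F : compact F -> compact (Phi @` F).
Proof.
move=> cF; apply: continuous_compact => //; apply: continuous_subspaceT.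
exact: continuous_shear.
Qed.

(** Apply [shear_integral] to [a k * h], where the cutoffs [a k] tend to the indicator function of
    the image [S], and pass to the limit; injectivity identifies that indicator, composed with the
    shear, with the one of [F]. *)
Lemma shear_integral_compact F h (M : R) : compact F -> Ck 1 h -> (forall x, `|h x| <= M) ->
  \int[mu]_(x in Phi @` F) h x = \int[mu]_(x in F) (h (Phi x) * J x).
Proof.
move=> cF h1 hM; set S := Phi @` F.
have cS : compact S by exact: compact_shear.
have clS := compact_closed_rV cS.
have M0 : 0 <= M by exact: le_trans (normr_ge0 _) (hM 0).
pose O (k : nat) := \bigcup_(z in S) ball (z : 'rV[R]_n.+1) (k.+1%:R^-1 : R).
have oO k : open (O k) by apply: bigcup_open => z _; apply: ball_open.
have SO k : S `<=` O k by move=> z Sz; exists z => //; apply: ballxx.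
have /choice[a aP] : forall k, exists a : 'rV[R]_n.+1 -> R, exists L,
    [/\ forall k, Ck k a, compact L, L `<=` O k,
    vanishes_off L a & (forall y, 0 <= a y <= 1) /\ (forall y, S y -> a y = 1)].
  by move=> k; exact: smooth_urysohn.
have a1 k x : `|a k x| <= 1.
  have [L [_ _ _ _ [/(_ x)/andP[u v] _]]] := aP k.
  by rewrite ger0_norm.
have acvg x : a k x @[k --> \oo] --> (\1_S x : R).
  rewrite indicE; have [Sx|nS] := pselect (S x).
    rewrite mem_set //; apply: cvg_near_cst; near=> k.
    by have [L [_ _ _ _ [_ ->]]] := aP k.
  rewrite memNset //; apply: cvg_near_cst.
  have oS : open (~` S) by exact: closed_openC.
  have [e /= e0 He] := (nbhs_ballP x (~` S)).1 (open_nbhs_nbhs (conj oS nS)).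
  near=> k; have [L [_ _ LO aL _]] := aP k.
  apply: aL => /LO [z Sz xz]; apply: (He z) => //.
  apply: ball_sym; apply: le_ball xz; apply: ltW.
  by near: k; exact: (near_infty_natSinv_lt (PosNum e0)).
have [r1 r10 Kr] := compact_in_ball cK.
have [r2 r20 Fr] := compact_in_ball cF.
have [r3 r30 Sr] := compact_in_ball cS.
pose B := [set x : 'rV[R]_n.+1 | `|x| <= r1 + r2 + r3].
have mB : meas B by exact: meas_norm_le.
have Boo : (mu B < +oo)%E by exact: fin_norm_le.
have KB : K `<=` B by move=> x /Kr xr; rewrite /B /= (le_trans xr) // -addrA lerDl addr_ge0 // ltW.
have FB : F `<=` B.
  by move=> x /Fr xr; rewrite /B /= (le_trans xr) // [r1 + r2]addrC -addrA lerDl addr_ge0 // ltW.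
have SB : S `<=` B by move=> x /Sr xr; rewrite /B /= (le_trans xr) // lerDr addr_ge0 // ltW.
have mh : measurable_fun [set: T] h by exact: (measurable_continuous (Ck_continuous h1)).
have mS : meas S by exact: measurable_compact.
have mF : meas F by exact: measurable_compact.
have mi A : meas A -> measurable_fun [set: T] (\1_A : T -> R).
  by move=> mA; exact: (measurable_indic mA).
have ca k : continuous (a k) by have [L [/(_ 0%N)/Ck_continuous ? _ _ _ _]] := aP k.
have ma k : measurable_fun [set: T] (a k) by exact: (measurable_continuous (ca k)).
have eqk k : \int[mu]_(x in B) (a k (Phi x) * (h (Phi x) * J x)) = \int[mu]_(x in B) (a k x * h x).
  have [L [ak cL _ aL _]] := aP k.
  have := @shear_integral R n f i K fs cK fK L (fun x => a k x * h x) B t cL (CkM (ak 1%N) h1) _ mB Boo KB.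
  move=> <-; last by move=> x nL; rewrite aL // mul0r.
  by apply: eq_Rintegral => x _; rewrite mulrA.
have lim1 : \int[mu]_(x in B) (a k x * h x) @[k --> \oo] --> \int[mu]_(x in S) h x.
  rewrite -(@Rintegral_indicM _ _ T mu B S h SB).
  apply: (@bounded_convergence R n B _ _ M mB Boo).
  - by move=> k; exact: measurable_funM.
  - by apply: measurable_funM => //; exact: mi.
  - by move=> k x; rewrite normrM -[leRHS]mul1r ler_pM.
  - by move=> x _; apply: cvgM; [exact: acvg|exact: cvg_cst].
have cPhi : continuous Phi by exact: continuous_shear.
have chPhi : continuous (h \o Phi).
  by move=> x; apply: continuous_comp; [exact: cPhi|exact: (Ck_continuous h1)].
have mhJ : measurable_fun [set: T] (fun x => h (Phi x) * J x).
  apply: measurable_continuous => x; apply: continuousM; first exact: chPhi.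
  exact: continuous_jac.
have lim2 : \int[mu]_(x in B) (a k (Phi x) * (h (Phi x) * J x)) @[k --> \oo] -->
    \int[mu]_(x in F) (h (Phi x) * J x).
  rewrite -(@Rintegral_indicM _ _ T mu B F (fun x => h (Phi x) * J x) FB).
  apply: (@bounded_convergence R n B _ _ (M * 2) mB Boo).
  - move=> k; apply: measurable_funM; last exact: mhJ.
    apply: measurable_continuous => x.
    by apply: continuous_comp; [exact: cPhi|exact: ca].
  - by apply: measurable_funM => //; exact: mi.
  - move=> k x; rewrite normrM -[leRHS]mul1r ler_pM // normrM ler_pM //.
    exact: jac_bound.
  - move=> x _; apply: cvgM; last exact: cvg_cst.
    have -> : \1_F x = \1_S (Phi x) :> R; last exact: acvg.
    rewrite !indicE; congr (nat_of_bool _)%:R; apply/idP/idP; rewrite !inE => H.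
      by exists x.
    by case: H => y Fy /shear_inj <-.
apply: (@cvg_unique _ (@Rhausdorff R) _ _ _ _ lim1).
by move: lim2; under eq_fun do rewrite eqk.
Unshelve. all: by end_near. Qed.

End shear_sets.

Section shear_measurable.
Context {R : realType} {n : nat}.
Implicit Types (A B F K L : set 'rV[R]_n.+1) (g h : 'rV[R]_n.+1 -> R).
Local Notation mu := (@lebesgue R n).
Local Notation meas := (@lebesgue_measurable R n).
Local Notation T := (caratheodory_type (@lebesgue_outer R n)).
Variables (f : 'rV[R]_n.+1 -> R) (i : 'I_n.+1) (K : set 'rV[R]_n.+1) (t N : R).
Hypotheses (fs : forall k, Ck k f) (cK : compact K) (fK : vanishes_off K f).
Hypotheses (t0 : 0 <= t) (dfN : forall x, `|partial i f x| <= N) (tN : t * N <= 2^-1).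
Local Notation Phi := (shear f i t).
Local Notation J := (jac f i t).

Lemma integrable_jac h (M : R) A : meas A -> (mu A < +oo)%E -> Ck 1 h -> (forall x, `|h x| <= M) ->
  mu.-integrable A (EFin \o (fun x => h (Phi x) * J x)).
Proof.
move=> mA Aoo h1 hM; apply: (integrable_bounded (M := M * 2) mA Aoo).
  apply: measurable_continuous => x; apply: continuousM; last exact: (continuous_jac fs).
  apply: continuous_comp; [exact: (continuous_shear fs)|exact: (Ck_continuous h1)].
by move=> x; rewrite normrM ler_pM //; exact: jac_bound t0 dfN tN x.
Qed.

(** Images of compact sets are compact, so the image of the sigma-compact core [F1] is measurable;
    the null remainder of [F] is dropped instead of being transported. *)
Lemma shear_measurable F : meas F -> (mu F < +oo)%E -> exists F' F1,
  [/\ meas F1, F1 `<=` F & mu (F `\` F1) = 0%E] /\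
  [/\ F' = Phi @` F1, meas F', (mu F' < +oo)%E &
    forall h (M : R), Ck 1 h -> (forall x, `|h x| <= M) ->
      \int[mu]_(x in F') h x = \int[mu]_(x in F1) (h (Phi x) * J x)].
Proof.
move=> mF Foo; have [Q [cQ incQ QF Q0]] := sigma_compact_core mF Foo.
pose F1 := \bigcup_k Q k; pose S k := Phi @` Q k.
have mQ k : meas (Q k) by exact: measurable_compact.
have mS k : meas (S k) by apply: measurable_compact; exact: compact_shear.
have mF1 : meas F1 by exact: (bigcup_measurable (fun k _ => mQ k)).
have mS1 : meas (\bigcup_k S k) by exact: (bigcup_measurable (fun k _ => mS k)).
have F1oo : (mu F1 < +oo)%E by apply: le_lt_trans Foo; exact: lebesgue_le.
have incS k l : (k <= l)%N -> S k `<=` S l.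
  by move=> kl _ [x Qx <-]; exists x => //; exact: incQ Qx.
have cst1 (x : 'rV[R]_n.+1) : `|1 : R| <= 1 by rewrite normr1.
have Qoo k : (mu (Q k) < +oo)%E.
  by apply: le_lt_trans F1oo; apply: lebesgue_le => x Qx; exists k.
(* This bound, uniform in [k] because the Jacobian is at most 2, gives the union of the images
   finite measure. *)
have Soo k : (mu (S k) <= (2 * fine (mu F))%:E)%E.
  have Skoo : (mu (S k) < +oo)%E.
    apply: lebesgue_bounded; have [r r0 Sr] := compact_in_ball (@compact_shear R n f i t fs _ (cQ k)).
    by apply: bounded_subset (bounded_closed_ball0 r) => x /Sr.
  rewrite -[leLHS]fineK ?lebesgue_fin // lee_fin -(Rintegral1 (mS k)).
  have E1 : \int[mu]_(x in S k) (1 : R) = \int[mu]_(x in Q k) (1 * J x).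
    exact: (shear_integral_compact fs cK fK t0 dfN tN (cQ k) (@Ck_cst R n 1 1) cst1).
  rewrite E1.
  apply: (@le_trans _ _ (\int[mu]_(x in Q k) (2 : R))); last first.
    rewrite (Rintegral_cst _ (mQ k)) ler_pM2l //.
    by apply: fine_lebesgue_le => //; apply: subset_trans QF => x Qx; exists k.
  apply: (le_Rintegral (mQ k)).
  - by apply: (integrable_jac (mQ k) (Qoo k) (@Ck_cst R n 1 1) cst1).
  - by apply: (integrable_bounded (M := 2) (mQ k) (Qoo k)); [exact: measurable_cst|move=> x; rewrite ger0_norm].
  - by move=> x _; rewrite mul1r; apply: le_trans (ler_norm _) _; exact: jac_bound t0 dfN tN x.
have oo : (mu (\bigcup_k S k) < +oo)%E.
  have H := @nondecreasing_cvg_mu _ _ R mu S mS mS1.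
  apply: (@le_lt_trans _ _ (2 * fine (mu F))%:E); last exact: ltry.
  rewrite -(cvg_lim (@ereal_hausdorff R) (H _)); last first.
    by move=> k l kl; apply/subsetPset; exact: incS.
  apply: lime_le; last by apply: nearW.
  by apply/cvg_ex; eexists; apply: H => k l kl; apply/subsetPset; exact: incS.
exists (\bigcup_k S k), F1; split; first by split.
split => //.
  apply/seteqP; split => [_ [k _ [x Qx <-]]|_ [x [k _ Qx] <-]].
    by exists x => //; exists k.
  by exists k => //; exists x.
move=> h M h1 hM.
have mh : measurable_fun [set: T] h by exact: (measurable_continuous (Ck_continuous h1)).
have L1 := increasing_integral mS incS oo mh hM.
have L2 := @increasing_integral R n Q (fun x => h (Phi x) * J x) (M * 2) mQ incQ F1oo.
apply: (@cvg_unique _ (@Rhausdorff R) _ _ _ _ L1).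
have -> : (fun k => \int[mu]_(x in S k) h x) = fun k => \int[mu]_(x in Q k) (h (Phi x) * J x).
  apply/funext => k; exact: (shear_integral_compact fs cK fK t0 dfN tN (cQ k) h1 hM).
apply: L2.
  apply: measurable_continuous => x; apply: continuousM; last exact: (continuous_jac fs).
  apply: continuous_comp; [exact: (continuous_shear fs)|exact: (Ck_continuous h1)].
by move=> x; rewrite normrM ler_pM //; exact: jac_bound t0 dfN tN x.
Qed.

(** By the change of variables for the constant 1, the left-hand side is the volume of the image of
    [F1]. *)
Lemma shear_volume F F1 : meas F -> (mu F < +oo)%E -> meas F1 -> F1 `<=` F ->
  mu (F `\` F1) = 0%E ->
  \int[mu]_(x in F1) (1 * J x) = fine (mu F) + t * \int[mu]_(x in F) partial i f x.
Proof.
move=> mF Foo mF1 F1F F0.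
have cst1 (x : 'rV[R]_n.+1) : `|1 : R| <= 1 by rewrite normr1.
have iJ := integrable_jac mF Foo (@Ck_cst R n 1 1) cst1.
rewrite -(Rintegral_null mF mF1 F1F F0 iJ).
have mdf : measurable_fun [set: T] (partial i f).
  by apply: measurable_continuous; exact: (Ck_continuous (Ck_partial i (fs 1))).
have idf := integrable_bounded mF Foo mdf dfN.
rewrite -Rintegral1 // -(RintegralZl t mF idf).
have i1 : mu.-integrable F (EFin \o (fun=> 1 : R)).
  by apply: (integrable_bounded (M := 1) mF Foo); [exact: measurable_cst|move=> x; rewrite normr1].
have i2 : mu.-integrable F (EFin \o (fun x => t * partial i f x)).
  apply: (integrable_bounded (M := t * N) mF Foo); first exact: measurable_funM.
  by move=> x; rewrite normrM (ger0_norm t0) ler_wpM2l.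
rewrite -(RintegralD mF i1 i2).
by apply: eq_Rintegral => x _; rewrite mul1r.
Qed.

End shear_measurable.

(** * Effect of a shear on volume and perimeter *)

Section deformation.
Context {R : realType} {n : nat}.
Implicit Types (A B C F K L : set 'rV[R]_n.+1) (g h f : 'rV[R]_n.+1 -> R).
Local Notation mu := (@lebesgue R n).
Local Notation meas := (@lebesgue_measurable R n).
Local Notation T := (caratheodory_type (@lebesgue_outer R n)).

(* Piola transform of [eta]: [eta \o shear] multiplied by the cofactors of the differential of
   [shear]. *)
Definition shearfield f i (t : R) (eta : 'rV[R]_n.+1 -> 'rV[R]_n.+1) (x : 'rV[R]_n.+1) :
    'rV[R]_n.+1 :=
  \row_j (jac f i t x * eta (shear f i t x) ord0 j -
    (j == i)%:R * (t * \sum_l partial l f x * eta (shear f i t x) ord0 l)).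

Lemma smooth_shearfield f i (t : R) eta : (forall k, Ck k f) -> smooth eta ->
  smooth (shearfield f i t eta).
Proof.
move=> fs es k j.
have Ce l : Ck k (fun x => eta (shear f i t x) ord0 l).
  exact: (Ck_comp (Ck_shear i fs t k) (es k l)).
have -> : (fun x => shearfield f i t eta x ord0 j) = fun x =>
    jac f i t x * eta (shear f i t x) ord0 j -
    (j == i)%:R * (t * \sum_l partial l f x * eta (shear f i t x) ord0 l).
  by apply/funext => x; rewrite mxE.
apply: CkB; first by apply: CkM; [exact: Ck_jac|exact: Ce].
apply: CkZ; apply: CkZ; apply: Ck_sum => l _; apply: CkM; last exact: Ce.
exact: Ck_partial.
Qed.

(** Piola identity. The second derivatives of [f] enter with opposite signs and cancel by
    [partialC]. *)
Lemma divergence_shearfield f i (t : R) eta x : (forall k, Ck k f) -> smooth eta ->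
  divergence (shearfield f i t eta) x = divergence eta (shear f i t x) * jac f i t x.
Proof.
move=> fs es; set y := shear f i t x; set J := jac f i t x.
pose e l j := partial j (fun z => eta z ord0 l) y + t * partial j f x * partial i (fun z => eta z ord0 l) y.
have de l j : is_derive x (delta_mx ord0 j) (fun z => eta (shear f i t z) ord0 l) (e l j).
  exact: (is_derive_shear i fs t x j (es 1%N l)).
have dJ j : is_derive x (delta_mx ord0 j) (jac f i t) (t * partial j (partial i f) x).
  have := is_deriveD (is_derive_cst (1 : R) x (delta_mx ord0 j : 'rV[R]_n.+1))
    (is_deriveMl t (Ck_is_derive x j (Ck_partial i (fs 2%N)))).
  by rewrite add0r.
pose Y j l := partial l f x * e l j + eta y ord0 l * partial j (partial l f) x.
have dj j : is_derive x (delta_mx ord0 j) (fun z => shearfield f i t eta z ord0 j)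
   (J * e j j + eta y ord0 j * (t * partial j (partial i f) x) - (j == i)%:R * (t * \sum_l Y j l)).
  have -> : (fun x => shearfield f i t eta x ord0 j) = fun x =>
      jac f i t x * eta (shear f i t x) ord0 j -
      (j == i)%:R * (t * \sum_l partial l f x * eta (shear f i t x) ord0 l).
    by apply/funext => z; rewrite mxE.
  have d1 : is_derive x (delta_mx ord0 j)
      (fun z => jac f i t z * eta (shear f i t z) ord0 j)
      (J * e j j + eta y ord0 j * (t * partial j (partial i f) x)).
    exact: (is_deriveM (dJ j) (de j j)).
  have d2 l : is_derive x (delta_mx ord0 j)
      (fun z => partial l f z * eta (shear f i t z) ord0 l) (Y j l).
    exact: (is_deriveM (Ck_is_derive x j (Ck_partial l (fs 2%N))) (de l j)).
  have d3 := is_derive_bigsum (index_enum 'I_n.+1) d2.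
  exact: (is_deriveB d1 (is_deriveMl (j == i)%:R (is_deriveMl t d3))).
transitivity (\sum_j (J * e j j + eta y ord0 j * (t * partial j (partial i f) x) -
    (j == i)%:R * (t * \sum_l Y j l))).
  by apply: eq_bigr => j _; have [_ H] := dj j; exact: H.
rewrite /divergence.
rewrite sumrB (bigD1 i) //= [X in _ - X](bigD1 i) //= eqxx mul1r.
rewrite [X in _ - (_ + X)]big1 ?addr0; last by move=> j /negbTE ->; rewrite mul0r.
have -> : (J * e i i + eta y ord0 i * (t * partial i (partial i f) x) +
   \sum_(j < n.+1 | j != i) (J * e j j + eta y ord0 j * (t * partial j (partial i f) x))) =
   \sum_j (J * e j j + eta y ord0 j * (t * partial j (partial i f) x)).
  by rewrite [RHS](bigD1 i).
rewrite mulr_sumr -sumrB mulr_suml; apply: eq_bigr => j _.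
rewrite /Y (partialC j i (fs 2%N)) /e /J /jac.
move: (partial i (partial j f) x) (eta y ord0 j) (partial j f x) (partial i f x) => a b c d.
move: (partial j _ y) (partial i _ y) => u v.
by ring.
Qed.

(** The transform is v + t w, with v the value of [eta] at the image point and |w_j| <= N (n + 2):
    one N comes from the Jacobian and n + 1 from the sum. Bounding the sums over coordinates
    termwise gives the factor n + 1 and completes the square. *)
Lemma shearfield_enorm f i (t N : R) eta x : 0 <= t -> (forall l, `|partial l f x| <= N) ->
  (forall y, enorm (eta y) <= 1) ->
  enorm (shearfield f i t eta x) <= 1 + t * (n.+1%:R * (N * n.+2%:R)).
Proof.
move=> t0 dN e1; set y := shear f i t x; set v := eta y.
have N0 : 0 <= N by exact: le_trans (normr_ge0 _) (dN i).
pose w j := partial i f x * v ord0 j - (j == i)%:R * \sum_l partial l f x * v ord0 l.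
have vj j : `|v ord0 j| <= 1 by exact: le_trans (coord_le_enorm _ j) (e1 y).
have pv l j : `|partial l f x * v ord0 j| <= N by rewrite normrM -[leRHS]mulr1 ler_pM.
set W := N * n.+2%:R; have W0 : 0 <= W by rewrite mulr_ge0.
have wj j : `|w j| <= W.
  rewrite /W -natr1 mulrDr mulr1 addrC; apply: (le_trans (ler_normB _ _)); apply: lerD => //.
  rewrite normrM -[leRHS]mul1r ler_pM //; first by case: (j == i); rewrite ?normr1 ?normr0.
  apply: (le_trans (ler_norm_sum _ _ _)).
  rewrite mulr_natr -[X in _ *+ X](card_ord n.+1) -sumr_const.
  by apply: ler_sum => l _; exact: pv.
have E j : shearfield f i t eta x ord0 j = v ord0 j + t * w j.
  rewrite mxE -/y -/v /jac /w; move: (\sum_l _) (partial i f x) (v ord0 j) => a b c.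
  by ring.
have b0 : 0 <= t * (n.+1%:R * W) by rewrite !mulr_ge0.
rewrite enorm_le ?addr_ge0 //.
have S1 : \sum_j v ord0 j ^+ 2 <= 1 by have := e1 y; rewrite enorm_le // expr1n.
have S2 : \sum_j v ord0 j * w j <= n.+1%:R * W.
  rewrite mulr_natl -[X in _ *+ X](card_ord n.+1) -sumr_const; apply: ler_sum => j _.
  by apply: le_trans (ler_norm _) _; rewrite normrM -[leRHS]mul1r ler_pM.
have S3 : \sum_j w j ^+ 2 <= n.+1%:R * W ^+ 2.
  rewrite mulr_natl -[X in _ *+ X](card_ord n.+1) -sumr_const; apply: ler_sum => j _.
  by rewrite -real_normK ?num_real // lerXn2r // nnegrE.
have -> : \sum_j shearfield f i t eta x ord0 j ^+ 2 =
   \sum_j v ord0 j ^+ 2 + 2 * t * \sum_j v ord0 j * w j + t ^+ 2 * \sum_j w j ^+ 2.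
  rewrite !mulr_sumr -!big_split; apply: eq_bigr => j _; rewrite E /=.
  move: (v ord0 j) (w j) => a b; ring.
have -> : (1 + t * (n.+1%:R * W)) ^+ 2 =
    1 + 2 * t * (n.+1%:R * W) + t ^+ 2 * (n.+1%:R ^+ 2 * W ^+ 2).
  have sq (s m u : R) : (1 + s * (m * u)) ^+ 2 = 1 + 2 * s * (m * u) + s ^+ 2 * (m ^+ 2 * u ^+ 2).
    by ring.
  exact: sq.
apply: lerD; first by apply: lerD => //; rewrite ler_wpM2l // mulr_ge0.
rewrite ler_wpM2l ?sqr_ge0 //; apply: (le_trans S3); rewrite ler_wpM2r ?sqr_ge0 //.
by rewrite expr2 ler_peMl // ler1n.
Qed.

Lemma partial_bounded K g : compact K -> Ck 1 g -> vanishes_off K g ->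
  exists2 N : R, 0 <= N & forall l x, `|partial l g x| <= N.
Proof.
move=> cK g1 gK.
have /choice[M HM] : forall l, exists M : R, 0 <= M /\ forall x, `|partial l g x| <= M.
  move=> l; have := bounded_compact_support cK (Ck_continuous (Ck_partial l g1))
    (partial_vanishes_off l (compact_closed_rV cK) gK).
  by move=> [M]; exists M.
exists (\sum_l M l); first by apply: sumr_ge0 => l _; have [] := HM l.
move=> l x; have [_ /(_ x)] := HM l; move=> /le_trans; apply.
rewrite (bigD1 l) //= lerDl; apply: sumr_ge0 => j _; by have [] := HM j.
Qed.

Lemma Lipschitz_compact K g : compact K -> Ck 1 g -> vanishes_off K g ->
  exists2 L : R, 0 <= L & forall x y, `|g y - g x| <= L * `|y - x|.
Proof.
move=> cK g1 gK; have [N N0 dN] := partial_bounded cK g1 gK.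
exists (n.+1%:R * N); first exact: mulr_ge0.
move=> x y; have [z _ ->] := C1_increment x y g1.
rewrite -mulrA mulr_natl -[X in _ *+ X](card_ord n.+1) -sumr_const.
apply: (le_trans (ler_norm_sum _ _ _)); apply: ler_sum => l _.
rewrite normrM ler_pM //.
by have := coord_le_norm (y - x) l; rewrite !mxE.
Qed.

(** [t0] and [M] are chosen before [F], so they serve for all truncations of [E] at once. The
    perimeter bound comes from testing [F] with the Piola transform of a field for [F'], divided by
    1 + t M. *)
Lemma deformation C K f i : compact K -> K `<=` C^° -> (forall k, Ck k f) ->
  vanishes_off K f ->
  exists t0 M : R, [/\ 0 < t0, 0 <= M & forall (t p : R) F, 0 <= t <= t0 -> meas F -> F `<=` C ->
    (mu F < +oo)%E -> 0 <= p -> (relative_perimeter C F <= p%:E)%E ->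
    exists F', [/\ meas F', F' `<=` C,
      mu F' = (fine (mu F) + t * \int[mu]_(x in F) partial i f x)%:E &
      (relative_perimeter C F' <= ((1 + t * M) * p)%:E)%E]].
Proof.
move=> cK KC fs fK.
have [N N0 dN] := partial_bounded cK (fs 1%N) fK.
have [M1 M10 fM] := bounded_compact_support cK (Ck_continuous (fs 0%N)) fK.
have oC : open C^° by exact: open_interior.
(* [a] is 1 on [K] and 0 outside a compact part [L] of the interior of [C]; its Lipschitz constant
   plays the role of the distance to the boundary: a point of [K] whose displacement times [Lip] is
   below 1 stays in [L]. *)
have [a [L [ak cL LC aL [_ a1]]]] := smooth_urysohn cK oC KC.
have [Lip Lip0 LipH] := Lipschitz_compact cL (ak 1%N) aL.
(* t c <= 1/2 gives t N <= 1/2 for the injectivity of the shear and t Lip M1 <= 1/2 for the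
   displacement; the 1 keeps [c] positive. *)
pose c := N + Lip * M1 + 1.
have c0 : 0 < c by rewrite ltr_wpDl // addr_ge0 // mulr_ge0.
pose M := n.+1%:R * (N * n.+2%:R).
exists (2^-1 / c), M; split; [by rewrite divr_gt0|by rewrite !mulr_ge0|].
move=> t p F /andP[tge tle] mF FC Foo p0 FP.
have tc : t * c <= 2^-1 by rewrite -ler_pdivlMr.
have tN : t * N <= 2^-1.
  by apply: le_trans tc; rewrite ler_wpM2l // /c -addrA lerDl addr_ge0 // mulr_ge0.
have tL : t * (Lip * M1) <= 2^-1.
  apply: le_trans tc; rewrite ler_wpM2l // /c; apply: (@le_trans _ _ (N + Lip * M1)).
    by rewrite lerDr.
  by rewrite lerDl.
have [F' [F1 [[mF1 F1F F0] [EF mF' F'oo HF]]]] := shear_measurable fs cK fK tge (dN i) tN mF Foo.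
exists F'; split => //.
- rewrite EF => _ [x /F1F Fx <-].
  have [Kx|nK] := pselect (K x); last by rewrite (shear_off i fK t nK); exact: FC.
  suff : L (shear f i t x) by move=> /LC; exact: interior_subset.
  apply: contrapT => /aL a0; have := LipH x (shear f i t x).
  rewrite a0 a1 // sub0r normrN normr1 /shear addrAC subrr add0r normrZ leNgt => /negP; apply.
  have nd := @norm_delta_le1 R n i.
  apply: (@le_lt_trans _ _ (t * (Lip * M1))); last first.
    by apply: (le_lt_trans tL); rewrite invf_lt1 // ltr1n.
  rewrite [leRHS]mulrCA ler_wpM2l // normrM (ger0_norm tge) -mulrA ler_wpM2l //.
  by rewrite -[leRHS]mulr1 ler_pM.
- rewrite -(shear_volume fs tge (dN i) tN mF Foo mF1 F1F F0) -[LHS]fineK ?lebesgue_fin //.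
  congr EFin; rewrite -(Rintegral1 mF').
  have cst1 (x : 'rV[R]_n.+1) : `|1 : R| <= 1 by rewrite normr1.
  exact: (HF _ 1 (@Ck_cst R n 1 1) cst1).
- have q0 : 0 < 1 + t * M by rewrite ltr_wpDr // !mulr_ge0.
  apply: (perimeter_le mF' F'oo) => eta teta.
  have es : smooth eta by case: teta.
  have [B _ etaB] := divergence_bounded teta.
  rewrite (HF _ B (smooth_divergence 1 es) etaB) lee_fin.
  have [S [cS SC etaS _]] := test_fieldE teta.
  have tz : test_field C (fun x => (1 + t * M)^-1 *: shearfield f i t eta x).
    apply: (@test_fieldI _ _ _ _ (K `|` S)).
    - move=> k j; have -> : (fun x => ((1 + t * M)^-1 *: shearfield f i t eta x) ord0 j) =
          fun x => (1 + t * M)^-1 * shearfield f i t eta x ord0 j.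
        by apply/funext => x; rewrite mxE.
      by apply: CkZ; exact: smooth_shearfield.
    - exact: compactU.
    - by move=> x [/KC|/SC].
    - move=> x /not_orP[nK nS]; have e0 l : eta (shear f i t x) ord0 l = 0.
        by rewrite (shear_off i fK t nK); exact: etaS.
      apply/rowP => j; rewrite !mxE e0 mulr0 big1 ?mulr0 ?subr0 ?mulr0 // => l _.
      by rewrite e0 mulr0.
    - move=> x; rewrite enormZ normfV (gtr0_norm q0) ler_pdivrMl // mulr1.
      by apply: shearfield_enorm => //; case: teta.
  have := perimeter_ge mF Foo tz; move=> /le_trans/(_ FP); rewrite lee_fin.
  rewrite (Rintegral_null mF mF1 F1F F0 (divergence_integrable mF Foo tz)).
  have E x : divergence (fun x => (1 + t * M)^-1 *: shearfield f i t eta x) x =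
      (1 + t * M)^-1 * (divergence eta (shear f i t x) * jac f i t x).
    rewrite -divergence_shearfield // /divergence mulr_sumr; apply: eq_bigr => j _.
    have := is_deriveMl (1 + t * M)^-1 (Ck_is_derive x j (smooth_shearfield i t fs es 1%N j)).
    rewrite /partial => -[_ <-]; congr ('D_ _ _ _).
    by apply/funext => z; rewrite mxE.
  have F1oo : (mu F1 < +oo)%E by apply: le_lt_trans Foo; exact: lebesgue_le.
  have iF := integrable_jac fs tge (dN i) tN mF1 F1oo (smooth_divergence 1 es) etaB.
  have -> : \int[mu]_(x in F1) divergence (fun x => (1 + t * M)^-1 *: shearfield f i t eta x) x =
      \int[mu]_(x in F1) ((1 + t * M)^-1 * (divergence eta (shear f i t x) * jac f i t x)).
    by apply: eq_Rintegral => x _; exact: E.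
  by rewrite (RintegralZl _ mF1 iF) ler_pdivrMl.
Qed.

End deformation.

(** * Sets of finite perimeter and prescribed volume *)

Section boxes.
Context {R : realType} {n : nat}.
Implicit Types (A B C E F K L : set 'rV[R]_n.+1) (g f : 'rV[R]_n.+1 -> R).
Implicit Types (p : 'rV[R]_n.+1 * 'rV[R]_n.+1).
Local Notation mu := (@lebesgue R n).
Local Notation meas := (@lebesgue_measurable R n).
Local Notation T := (caratheodory_type (@lebesgue_outer R n)).

Definition setc (a : 'rV[R]_n.+1) i (t : R) : 'rV[R]_n.+1 :=
  \row_j (if j == i then t else a ord0 j).

Definition face p (i : 'I_n.+1) : R :=
  \prod_(j | j != i) Num.max 0 (p.2 ord0 j - p.1 ord0 j).

Lemma face_ge0 p i : 0 <= face p i.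
Proof. by apply: prodr_ge0 => j _; rewrite le_max lexx. Qed.

Lemma box_volume_setc p i (u w : R) : u <= w ->
  box_volume (setc p.1 i u, setc p.2 i w) = (w - u) * face p i.
Proof.
move=> uw; rewrite /box_volume (bigD1 i) //= !mxE eqxx max_r ?subr_ge0 //; congr (_ * _).
by apply: eq_bigr => j /negbTE ji; rewrite !mxE ji.
Qed.

Lemma slab_volume p i (u w : R) A : u <= w ->
  (forall x, A x -> u < x ord0 i <= w /\
     forall j, j != i -> p.1 ord0 j < x ord0 j <= p.2 ord0 j) ->
  (mu A <= ((w - u) * face p i)%:E)%E.
Proof.
move=> uw AH; rewrite -box_volume_setc //; apply: le_trans (lebesgue_box_le _).
apply: lebesgue_le => x /AH [xi xj] j; rewrite !mxE; case: eqVneq => [->|] //.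
exact: xj.
Qed.

Lemma Rintegral_diff_le A B g : meas A -> meas B -> (mu A < +oo)%E -> (mu B < +oo)%E ->
  measurable_fun [set: T] g -> (forall x, `|g x| <= 1) ->
  `|\int[mu]_(x in A) g x - \int[mu]_(x in B) g x| <=
    fine (mu (A `\` B)) + fine (mu (B `\` A)).
Proof.
move=> mA mB Aoo Boo mg g1.
rewrite (Rintegral_split mA mB Aoo mg g1) (Rintegral_split mB mA Boo mg g1) setIC.
rewrite opprD addrACA subrr add0r; apply: (le_trans (ler_normB _ _)); apply: lerD.
- rewrite -[leRHS]mul1r; apply: Rintegral_le_measure => //; first exact: (measurableD mA mB).
  by apply: le_lt_trans Aoo; apply: lebesgue_le => x [].
- rewrite -[leRHS]mul1r; apply: Rintegral_le_measure => //; first exact: (measurableD mB mA).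
  by apply: le_lt_trans Boo; apply: lebesgue_le => x [].
Qed.

Definition boxshift p i (h : R) :=
  (p.1 + h *: delta_mx ord0 i, p.2 + h *: delta_mx ord0 i).

Lemma boxshiftE p i (h : R) x : box (boxshift p i h) x <-> box p (x - h *: delta_mx ord0 i).
Proof.
split=> H j; have := H j; rewrite !mxE; move: (h * _) => e /andP[h1 h2];
  by apply/andP; split; [move: h1|move: h2]; rewrite ?ltrBrDr ?lerBlDr.
Qed.

Lemma face_boxshift p i (h : R) : face (boxshift p i h) i = face p i.
Proof. by apply: eq_bigr => j _; rewrite !mxE opprD addrACA subrr addr0. Qed.

Lemma boxshift_diff p i (h : R) :
  (mu (box (boxshift p i h) `\` box p) <= (`|h| * face p i)%:E)%E.
Proof.
(* The shifted box protrudes through the upper face if h >= 0 and through the lower one otherwise;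
   ]u, w] is the range of coordinate [i] there. *)
pose u := if 0 <= h then p.2 ord0 i else p.1 ord0 i + h.
pose w := if 0 <= h then p.2 ord0 i + h else p.1 ord0 i.
have wu : w - u = `|h|.
  rewrite /w /u; case: (leP 0 h) => h0; first by rewrite addrC addKr ger0_norm.
  by rewrite opprD addrA subrr add0r ltr0_norm.
have uw : u <= w by rewrite -subr_ge0 wu.
rewrite -wu; apply: slab_volume => // x [Sx nx].
have off j : j != i -> p.1 ord0 j < x ord0 j <= p.2 ord0 j.
  by move=> /negbTE ji; have := Sx j; rewrite !mxE eqxx ji /= !mulr0 !addr0.
split=> //; have := Sx i; rewrite !mxE !eqxx /= !mulr1 => /andP[x1 x2].
have nxi : ~ (p.1 ord0 i < x ord0 i <= p.2 ord0 i).
  by move=> H; apply: nx => j; have [->|ji] := eqVneq j i; [exact: H|exact: off].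
rewrite /u /w; case: (leP 0 h) => h0; apply/andP; split=> //.
- rewrite ltNge; apply/negP => x3; apply: nxi; rewrite x3 andbT; apply: le_lt_trans x1.
  by rewrite lerDl.
- rewrite leNgt; apply/negP => x3; apply: nxi; rewrite x3; apply: (le_trans x2).
  by rewrite gerDl ltW.
Qed.

Lemma box_bounded p : bounded_set (box p).
Proof.
exists (`|p.1| + `|p.2|); split; first exact: num_real.
move=> M hM x Bx; apply: le_trans (ltW hM); apply: norm_le_coord; first by rewrite addr_ge0.
move=> j; have /andP[/ltW x1 x2] := Bx j; rewrite ler_norml.
have := coord_le_norm p.1 j; have := coord_le_norm p.2 j.
rewrite !ler_norml => /andP[_ u2] /andP[u1 _]; apply/andP; split.
  apply: le_trans x1; apply: le_trans u1; by rewrite lerN2 lerDl.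
by apply: (le_trans x2); apply: (le_trans u2); rewrite lerDr.
Qed.

(* Difference quotients of translates of the box. *)
Lemma box_partial_le L g i p : compact L -> Ck 1 g -> vanishes_off L g ->
  (forall x, `|g x| <= 1) -> \int[mu]_(x in box p) partial i g x <= 2 * face p i.
Proof.
move=> cL g1 gL gle.
have cg := Ck_continuous g1.
have mg : measurable_fun [set: T] g by exact: measurable_continuous.
have dgL := partial_vanishes_off i (compact_closed_rV cL) gL.
have [M M0 dgM] := bounded_compact_support cL (Ck_continuous (Ck_partial i g1)) dgL.
have mB q : meas (box q) by exact: measurable_box.
have Boo q : (mu (box q) < +oo)%E by apply: lebesgue_bounded; exact: box_bounded.
pose e : 'rV[R]_n.+1 := delta_mx ord0 i.
pose w (t : R) (x : 'rV[R]_n.+1) := g (t *: e + x).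
pose dw (t : R) (x : 'rV[R]_n.+1) := partial i g (t *: e + x).
have cw t : continuous (w t).
  move=> x; apply: (@continuous_comp _ _ _ (fun x => t *: e + x) g); last exact: cg.
  by apply: continuousD; [exact: cst_continuous|exact: cvg_id].
pose D (t : R) := \int[mu]_(x in box p) w t x.
have d1 : is_derive (0 : R) 1 D (\int[mu]_(x in box p) dw 0 x).
  apply: (@is_derive_Rintegral _ _ T mu (box p) w dw 0 (-1) 1 M (mB p) (Boo p)).
  - by rewrite in_itv /= ltr01 andbT ltrN10.
  - move=> t _; apply: (integrable_bounded (M := 1) (mB p) (Boo p)).
      exact: measurable_continuous.
    by move=> x; exact: gle.
  - by move=> t x _; apply: line_is_derive; exact: (Ck_derivable g1).
  - by move=> t x _; exact: dgM.
have DE t : D t = \int[mu]_(x in box (boxshift p i t)) g x.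
  rewrite -(Rintegral_translate (t *: e) (mB (boxshift p i t)) (Boo _) mg gle) /D.
  have -> : hom 1 (t *: e) @^-1` box (boxshift p i t) = box p.
    apply/seteqP; split => x; first by move=> /boxshiftE; rewrite /hom scale1r addrK.
    by move=> Bx; apply/boxshiftE; rewrite /hom scale1r addrK.
  by apply: eq_Rintegral => x _; rewrite /w /hom scale1r addrC.
have D0 : D 0 = \int[mu]_(x in box p) g x.
  by apply: eq_Rintegral => x _; rewrite /w scale0r add0r.
have incr t : `|D t - D 0| <= `|t| * (2 * face p i).
  rewrite DE D0.
  apply: (le_trans (Rintegral_diff_le (mB _) (mB p) (Boo _) (Boo p) mg gle)).
  rewrite mulrCA mulr_natl mulr2n; apply: lerD.
    by rewrite -lee_fin fineK ?lebesgue_fin //; [exact: boxshift_diff|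
      apply: le_lt_trans (boxshift_diff _ _ _) (ltry _)].
  have H := boxshift_diff (boxshift p i t) i (- t).
  rewrite face_boxshift normrN in H.
  have E : boxshift (boxshift p i t) i (- t) = p.
    by rewrite /boxshift /= !scaleNr !addrK -surjective_pairing.
  rewrite E in H; rewrite -lee_fin fineK ?lebesgue_fin //.
  by apply: le_lt_trans H (ltry _).
have -> : \int[mu]_(x in box p) partial i g x = \int[mu]_(x in box p) dw 0 x.
  by apply: eq_Rintegral => x _; rewrite /dw scale0r add0r.
have [dD <-] := d1.
rewrite /derive; apply: limr_le; first exact: dD.
near=> h.
have h0 : h != 0 by near: h; exact: nbhs_dnbhs_neq.
rewrite /= addr0 [h *: _]mulr1.
by apply: (le_trans (ler_norm _)); rewrite normrZ normfV ler_pdivrMl ?normr_gt0 //.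
Unshelve. all: by end_near. Qed.

(** A field supported in the interior of [C] does not see whether the box is intersected with [C],
    so only the faces of the box count. *)
Lemma box_perimeter C p : meas C ->
  (relative_perimeter C (C `&` box p) <= (\sum_i 2 * face p i)%:E)%E.
Proof.
move=> mC; have mB := measurable_box p.
have mE : meas (C `&` box p) by exact: (measurableI _ _ mC mB).
have Boo : (mu (box p) < +oo)%E by apply: lebesgue_bounded; exact: box_bounded.
have Eoo : (mu (C `&` box p) < +oo)%E.
  by apply: le_lt_trans Boo; apply: lebesgue_le => x [].
apply: (perimeter_le mE Eoo) => xi txi; rewrite lee_fin.
have [K [cK KC xiK xi1]] := test_fieldE txi.
have sxi : smooth xi by case: txi.
have dK := divergence_vanishes_off (compact_closed_rV cK) xiK.
have -> : \int[mu]_(x in C `&` box p) divergence xi x = \int[mu]_(x in box p) divergence xi x.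
  apply: (@Rintegral_agree _ _ T mu) => x /eqP d0; split=> [[]|Bx] //.
  by split=> //; apply: interior_subset; apply: KC; apply: contrapT => /dK.
rewrite (Rintegral_divergence mB Boo txi).
by apply: ler_sum => i _; exact: (box_partial_le _ _ cK (sxi 1%N i) (xiK i)).
Qed.

End boxes.

(** * Competitors of finite perimeter and a direction of volume gain *)

Section profile.
Context {R : realType} {n : nat}.
Implicit Types (A B C E F K L : set 'rV[R]_n.+1) (f : 'rV[R]_n.+1 -> R).
Local Notation mu := (@lebesgue R n).
Local Notation meas := (@lebesgue_measurable R n).
Local Notation T := (caratheodory_type (@lebesgue_outer R n)).

Lemma exhaustion C (Q : nat -> set 'rV[R]_n.+1) (v : R) : mu C = +oo%E ->
  (forall k, meas (C `&` Q k)) -> (forall k l, (k <= l)%N -> Q k `<=` Q l) ->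
  C `<=` \bigcup_k Q k -> exists k, forall l, (k <= l)%N -> (v%:E < mu (C `&` Q l))%E.
Proof.
move=> Coo mQ incQ CQ; apply: contrapT => H.
have le k : (mu (C `&` Q k) <= v%:E)%E.
  rewrite leNgt; apply/negP => lt; apply: H; exists k => l kl; apply: (lt_le_trans lt).
  by apply: lebesgue_le => x [Cx Qx]; split => //; exact: incQ Qx.
have mU : meas (\bigcup_k (C `&` Q k)) by exact: (bigcup_measurable (fun k _ => mQ k)).
have inc : {homo (fun k => C `&` Q k) : k l / (k <= l)%N >-> (k <= l)%O}.
  by move=> k l kl; apply/subsetPset => x [Cx Qx]; split => //; exact: incQ Qx.
have cv := @nondecreasing_cvg_mu _ _ R mu _ mQ mU inc.
have E : \bigcup_k (C `&` Q k) = C.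
  by rewrite -setI_bigcupr; apply/seteqP; split => [x []|x Cx] //; split => //; exact: CQ.
have : (mu (\bigcup_k (C `&` Q k)) <= v%:E)%E.
  rewrite -(cvg_lim (@ereal_hausdorff R) cv); apply: lime_le; last by apply: nearW.
  by apply/cvg_ex; eexists; exact: cv.
by rewrite E Coo.
Qed.

(** Gives a competitor of finite perimeter, whence a minimizer has finite perimeter. One side of a
    large box slides; the volume inside [C] is Lipschitz in its position, and the intermediate value
    theorem hits [v]. *)
Lemma exact_volume C (v : R) : meas C -> mu C = +oo%E -> 0 < v ->
  exists F (P : R), [/\ meas F, F `<=` C, mu F = v%:E & (relative_perimeter C F <= P%:E)%E].
Proof.
move=> mC Coo v0.
pose Q (k : nat) : set 'rV[R]_n.+1 := box (const_mx (- k%:R), const_mx k%:R).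
have [k Hk] : exists k, forall l, (k <= l)%N -> (v%:E < mu (C `&` Q l))%E.
  apply: exhaustion => //.
  - by move=> k; exact: (measurableI _ _ mC (measurable_box _)).
  - move=> k l kl x Qx j; have /andP[x1 x2] := Qx j; move: x1 x2; rewrite !mxE => x1 x2.
    apply/andP; split; first by apply: le_lt_trans x1; rewrite lerN2 ler_nat.
    by apply: (le_trans x2); rewrite ler_nat.
  - move=> x _; exists (Num.truncn `|x|).+1 => // j; rewrite !mxE.
    have xt := truncnS_gt `|x|.
    have := le_lt_trans (coord_le_norm x j) xt; rewrite ltr_norml => /andP[-> /ltW ->].
    by [].
have {Hk} Qv := Hk k (leqnn k).
pose a : 'rV[R]_n.+1 := const_mx (- k%:R); pose b : 'rV[R]_n.+1 := const_mx k%:R.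
pose S (t : R) := C `&` box (a, setc b ord0 t).
have mS t : meas (S t) by exact: (measurableI _ _ mC (measurable_box _)).
have Soo t : (mu (S t) < +oo)%E.
  apply: lebesgue_bounded; apply: bounded_subset (box_bounded (a, setc b ord0 t)) => x [].
  by [].
pose g t := fine (mu (S t)).
pose L := face (a, b) ord0.
have L0 : 0 <= L by exact: face_ge0.
have inc s t : s <= t -> S s `<=` S t.
  move=> st x [Cx Bx]; split => // j; have := Bx j; rewrite !mxE => /andP[-> x2] /=.
  by move: x2; case: (j == ord0) => // /le_trans; apply.
have mono s t : s <= t -> g s <= g t by move=> st; apply: fine_lebesgue_le; [exact: inc|exact: Soo].
have lip1 s t : s <= t -> g t - g s <= (t - s) * L.
  move=> st; rewrite lerBlDr -lee_fin EFinD fineK ?lebesgue_fin // fineK ?lebesgue_fin //.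
  apply: (@le_trans _ _ (mu ((S t `\` S s) `|` S s))).
    by apply: lebesgue_le => x Sx; have [|] := pselect (S s x); [right|left].
  apply: (le_trans (outer_measureU2 _ _ _)); apply: leeD => //.
  apply: slab_volume => // x [[Cx Bx] nx].
  have off j : j != ord0 -> a ord0 j < x ord0 j <= b ord0 j.
    by move=> /negbTE j0; have := Bx j; rewrite !mxE j0.
  split=> //; have := Bx ord0; rewrite !mxE eqxx => /andP[x1 x2]; rewrite x2 andbT ltNge.
  apply/negP => xs; apply: nx; split => // j.
  have [->|j0] := eqVneq j ord0; first by rewrite !mxE eqxx x1.
  by have := off j j0; rewrite !mxE (negbTE j0).
have lip s t : `|g s - g t| <= `|s - t| * L.
  wlog st : s t / s <= t.
    move=> H; have [|/ltW] := leP s t; first exact: H.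
    by move=> /H; rewrite distrC [`|t - s|]distrC.
  by rewrite distrC [`|s - t|]distrC !ger0_norm ?subr_ge0 ?mono // lip1.
have cg : continuous g.
  move=> s; apply/cvgrPdist_le => e e0.
  have d0 : 0 < e / (L + 1) by rewrite divr_gt0 // ltr_wpDl.
  near=> t.
  have st : `|s - t| < e / (L + 1) by near: t; exists (e / (L + 1)).
  apply: (le_trans (lip s t)).
  apply: (@le_trans _ _ (e / (L + 1) * (L + 1))); last by rewrite divfK // gt_eqF // ltr_wpDl.
  apply: ler_pM; [exact: normr_ge0|exact: L0|exact: ltW|].
  by rewrite lerDl.
have kk : - k%:R <= k%:R :> R by rewrite (@le_trans _ _ 0) ?oppr_le0.
have ga : g (- k%:R) = 0.
  rewrite /g (_ : S _ = set0) ?measure0 //.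
  apply/seteqP; split => // x [_ /(_ ord0)]; rewrite !mxE eqxx => /andP[x1 x2].
  by have := lt_le_trans x1 x2; rewrite ltxx.
have gb : v <= g k%:R.
  rewrite -lee_fin fineK ?lebesgue_fin //; apply: (le_trans (ltW Qv)).
  apply: lebesgue_le => x [Cx Bx]; split => // j; have := Bx j; rewrite !mxE.
  by case: (j == ord0).
have [t _ gt] : exists2 t, t \in `[- k%:R, (k%:R : R)] & g t = v.
  apply: IVT => //; first exact: continuous_subspaceT.
  by rewrite ga min_l ?max_r ?(le_trans (ltW v0)) // (ltW v0) gb.
exists (S t), (\sum_i 2 * face (a, setc b ord0 t) i); split => //.
- by move=> x [].
- by rewrite -gt fineK // lebesgue_fin.
- exact: box_perimeter.
Unshelve. all: by end_near. Qed.

(** Were the volume finite, at most [c0 / 2] of it would lie outside some ball, whereas a point of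
    [C] more than [r0] beyond that ball has volume [c0] around it. *)
Lemma infinite_volume C (r0 c0 : R) : closed C -> ~ bounded_set C -> 0 < c0 ->
  (forall x, C x -> (c0%:E <= mu (C `&` closed_eball x r0))%E) -> mu C = +oo%E.
Proof.
move=> clC nb c00 volC; apply/eqP; rewrite -leye_eq leNgt; apply/negP => Coo.
have mC : meas C by exact: measurable_closed.
have c2 : 0 < c0 / 2 by rewrite divr_gt0.
have [N FN] := small_outside mC Coo c2.
apply: nb; exists (N%:R + r0); split; first exact: num_real.
move=> M hM x Cx; apply: le_trans (ltW hM); rewrite leNgt; apply/negP => xN.
have : (c0%:E <= (c0 / 2)%:E)%E.
  apply: le_trans (volC x Cx) _; apply: le_trans FN; apply: lebesgue_le => y [Cy yx].
  split => //= yN; move: xN; apply/negP; rewrite -leNgt.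
  have -> : x = y - (y - x) by rewrite opprB addrC subrK.
  apply: (le_trans (ler_normB _ _)); apply: lerD => //.
  apply: norm_le_coord; first exact: le_trans (enorm_ge0 _) yx.
  by move=> j; exact: le_trans (coord_le_enorm _ _) yx.
by rewrite lee_fin ler_pdivlMr // mulr_natr mulr2n gerDl leNgt c00.
Qed.

(* Otherwise the local inequality in [C] intersected with large cubes, where [E] fills only a
   small proportion, makes [E] null. *)
Lemma positive_perimeter C E : cvx C -> closed C -> C^° !=set0 -> mu C = +oo%E ->
  meas E -> E `<=` C -> (0 < mu E < +oo)%E ->
  exists2 xi, test_field C xi & 0 < \int[mu]_(x in E) divergence xi x.
Proof.
move=> cC clC C0 Coo mE EC /andP[E0 Eoo]; apply: contrapT => nxi.
have mC : meas C by exact: measurable_closed.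
pose ball0 (N : nat) := [set x : 'rV[R]_n.+1 | `|x| <= N%:R].
have mb N : meas (ball0 N) by exact: meas_norm_le.
have incb k l : (k <= l)%N -> ball0 k `<=` ball0 l.
  by move=> kl x; rewrite /ball0 /= => /le_trans; apply; rewrite ler_nat.
have [k0 Hk0] : exists k, forall l, (k <= l)%N ->
    ((2 ^+ n.+1 * fine (mu E))%:E < mu (C `&` ball0 l))%E.
  apply: exhaustion => //; first by move=> k; exact: (measurableI _ _ mC (mb k)).
  by move=> x _; exists (Num.truncn `|x|).+1 => //; apply: ltW; exact: truncnS_gt.
have null k : (k0 <= k)%N -> mu (E `&` (C `&` ball0 k)^°) = 0%E.
  move=> kk; set K := C `&` ball0 k.
  have mK : meas K by exact: (measurableI _ _ mC (mb k)).
  have Koo : (mu K < +oo)%E.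
    by apply: le_lt_trans (fin_norm_le k%:R); apply: lebesgue_le => x [].
  have cK : cvx K.
    move=> x y l [Cx xk] [Cy yk] l01; split; first exact: cC.
    have /andP[l0 l1] := l01; rewrite /ball0 /=; apply: (le_trans (ler_normD _ _)).
    rewrite !normrZ (ger0_norm l0) (ger0_norm (_ : 0 <= 1 - l)) ?subr_ge0 //.
    have -> : (k%:R : R) = l * k%:R + (1 - l) * k%:R by rewrite -mulrDl [l + _]addrC subrK mul1r.
    by apply: lerD; apply: ler_wpM2l => //; rewrite subr_ge0.
  have D0 : 0 < n.+1%:R * (2 * k%:R + 1) :> R by rewrite mulr_gt0 // ltr_wpDl // mulr_ge0.
  have diam x y : K x -> K y -> enorm (x - y) <= n.+1%:R * (2 * k%:R + 1).
    move=> [_ xk] [_ yk]; apply: (le_trans (enorm_norm_le _)); rewrite ler_wpM2l //.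
    apply: (le_trans (ler_normB _ _)); apply: (@le_trans _ _ (2 * k%:R)); last by rewrite lerDl.
    by rewrite mulr_natl mulr2n; exact: lerD.
  have P0 : (relative_perimeter K E <= 0%:E)%E.
    apply: (perimeter_le mE Eoo) => xi [sxi cs sK xi1]; rewrite lee_fin leNgt; apply/negP => lt.
    apply: nxi; exists xi => //; split => //; apply: (subset_trans sK).
    by apply: interiorS => x [].
  have := local_isoperimetric cK mK Koo D0 diam mE Eoo (lexx 0) P0.
  rewrite !mulr0 pmulr_lle0; last first.
    rewrite subr_gt0 -lte_fin fineK ?lebesgue_fin //; exact: Hk0.
  move=> H; apply/eqP; rewrite eq_le outer_measure_ge0 andbT.
  rewrite -[leLHS]fineK ?lee_fin //; apply: lebesgue_fin.
  by apply: le_lt_trans Eoo; apply: lebesgue_le => x [].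
suff : (mu E <= 0)%E by rewrite leNgt E0.
apply/lee_addgt0Pr => e e0; rewrite add0e.
have [N FN] := small_outside mE Eoo e0.
(* [N.+1] rather than [N], so that the points with |x| <= N are interior to [ball0 k]. *)
set k := maxn k0 N.+1.
have N1 : mu (C `\` C^°) = 0%E by exact: convex_boundary_null.
have N2 : mu (E `&` (C `&` ball0 k)^°) = 0%E by apply: null; exact: leq_maxl.
apply: (@le_trans _ _ (mu ((C `\` C^°) `|` ((E `&` (C `&` ball0 k)^°) `|` (E `\` ball0 N))))).
  apply: lebesgue_le => x Ex.
  have [Ix|nIx] := pselect (C^° x); last by left; split => //; exact: EC.
  right; have [xN|xN] := pselect (ball0 N x); [left|right]; split => //.
  rewrite interiorI; split => //.
  have sub : [set y : 'rV[R]_n.+1 | `|y| < k%:R] `<=` (ball0 k)^°.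
    rewrite -open_subsetE; first by move=> y /ltW.
    change (open ((fun x : 'rV[R]_n.+1 => `|x|) @^-1` [set t : R | t < k%:R])).
    by apply: open_comp; [move=> y _; exact: norm_continuous|exact: open_lt].
  apply: sub => /=; apply: (le_lt_trans xN); rewrite ltr_nat.
  exact: leq_maxr.
apply: le_trans (outer_measureU2 _ _ _) _.
have le0 (S S' : set 'rV[R]_n.+1) (z : \bar R) : mu S = 0%E -> (mu S' <= z)%E ->
    (mu S + mu S' <= z)%E by move=> ->; rewrite add0e.
apply: (le0 _ _ _ N1); apply: le_trans (outer_measureU2 _ _ _) _.
exact: (le0 _ _ _ N2).
Qed.

(** The integral of the divergence is a sum of n + 1 terms, one of which must be positive. A single
    component is the right datum for a shear, which moves one coordinate. *)
Lemma positive_partial C E : cvx C -> closed C -> C^° !=set0 -> mu C = +oo%E ->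
  meas E -> E `<=` C -> (0 < mu E < +oo)%E ->
  exists f i K, [/\ compact K, K `<=` C^°, forall k, Ck k f, vanishes_off K f &
    0 < \int[mu]_(x in E) partial i f x].
Proof.
move=> cC clC C0 Coo mE EC E0.
have /andP[_ Eoo] := E0.
have [xi txi pos] := positive_perimeter cC clC C0 Coo mE EC E0.
have [K [cK KC xiK _]] := test_fieldE txi.
have sxi : smooth xi by case: txi.
move: pos; rewrite (Rintegral_divergence mE Eoo txi) => pos.
apply: contrapT => nf; move: pos; apply/negP; rewrite -leNgt.
apply: sumr_le0 => i _; rewrite leNgt; apply/negP => lt; apply: nf.
by exists (fun y => xi y ord0 i), i, K; split => // k; exact: sxi.
Qed.

End profile.

(** * Decay of the tails of a minimizer *)

Section tails.
Context {R : realType} {n : nat}.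
Implicit Types (A B C E F G K L : set 'rV[R]_n.+1) (f : 'rV[R]_n.+1 -> R).
Local Notation mu := (@lebesgue R n).
Local Notation meas := (@lebesgue_measurable R n).
Local Notation T := (caratheodory_type (@lebesgue_outer R n)).

(** Inserting the minimality inequality p <= (1 + tau M) al into the cut inequality leaves be <= X V
    / b + tau M al. As tau <= V / a, al <= p + X V / b and b <= 1, both terms are bounded by
    multiples of V / b. Here [a] is the first variation of volume and [b] the width of the strip. *)
Lemma tail_arith (p X al be tau M a V b : R) : 0 < a -> 0 <= M -> 0 <= p -> 0 <= be ->
  0 <= X -> tau <= V / a -> 0 <= tau -> 0 <= V -> 0 < b <= 1 ->
  al + be <= p + X * V / b -> p <= (1 + tau * M) * al -> 0 <= al ->
  be <= (X + M / a * (p + X * V)) * V / b.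
Proof.
move=> a0 M0 p0 be0 X0 tV tau0 V0 /andP[b0 b1] H1 H2 al0.
have h1 : be <= X * V / b + tau * M * al by lra.
apply: (le_trans h1); rewrite 2!mulrDl lerD2l.
have alb : al <= (p + X * V) / b.
  have -> : (p + X * V) / b = p / b + X * V / b by rewrite mulrDl.
  apply: (@le_trans _ _ (p + X * V / b)); first by lra.
  by rewrite lerD2r ler_peMr // invf_ge1.
apply: (@le_trans _ _ (V / a * M * ((p + X * V) / b))).
  by apply: ler_pM => //; [exact: mulr_ge0|exact: ler_wpM2r].
rewrite le_eqVlt; apply/orP; left; apply/eqP; field.
by rewrite !gt_eqF.
Qed.

Variables (C E : set 'rV[R]_n.+1) (p v : R).
Hypotheses (mE : meas E) (EC : E `<=` C) (Ev : mu E = v%:E).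
Hypotheses (Ep : (relative_perimeter C E <= p%:E)%E)
  (minE : forall F, meas F -> F `<=` C -> mu F = v%:E -> (p%:E <= relative_perimeter C F)%E).
Variables (f : 'rV[R]_n.+1 -> R) (i0 : 'I_n.+1) (K0 : set 'rV[R]_n.+1) (t0 M alpha Kd : R).
Hypotheses (cK0 : compact K0) (f0 : vanishes_off K0 f) (t00 : 0 < t0) (M0 : 0 <= M).
Hypotheses (fE : \int[mu]_(x in E) partial i0 f x = alpha) (alpha0 : 0 < alpha).
Hypothesis def : forall (t q : R) F, 0 <= t <= t0 -> meas F -> F `<=` C ->
    (mu F < +oo)%E -> 0 <= q -> (relative_perimeter C F <= q%:E)%E ->
    exists F', [/\ meas F', F' `<=` C,
      mu F' = (fine (mu F) + t * \int[mu]_(x in F) partial i0 f x)%:E &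
      (relative_perimeter C F' <= ((1 + t * M) * q)%:E)%E].
Hypotheses (Kd0 : 0 < Kd) (HKd : forall y, `|dstep y| <= Kd).

Definition tail (c : R) i (t : R) := E `&` [set x : 'rV[R]_n.+1 | t < c * x ord0 i].

Let Eoo : (mu E < +oo)%E. Proof. by rewrite Ev ltry. Qed.

Let subE A : A `<=` E -> (mu A < +oo)%E.
Proof. by move=> AE; apply: le_lt_trans Eoo; exact: lebesgue_le. Qed.

Lemma tail_meas c i t : meas (tail c i t).
Proof. exact: (measurableI _ _ mE (meas_gt _ _ _)). Qed.

Lemma tail_oo c i t : (mu (tail c i t) < +oo)%E.
Proof. by apply: subE => x []. Qed.

Lemma tail_mono c i s t : s <= t -> fine (mu (tail c i t)) <= fine (mu (tail c i s)).
Proof.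
move=> st; apply: fine_lebesgue_le; last exact: tail_oo.
by move=> x [Ex /= tx]; split => //=; exact: le_lt_trans tx.
Qed.

Lemma tail_ge0 c i t : 0 <= fine (mu (tail c i t)).
Proof. by rewrite fine_ge0 // outer_measure_ge0. Qed.

Let p0 : 0 <= p.
Proof. by rewrite -lee_fin; apply: le_trans Ep; exact: perimeter_ge0 _ mE Eoo. Qed.

Let v0 : 0 <= v.
Proof. by rewrite -lee_fin -Ev outer_measure_ge0. Qed.

(** The factor of [tail_arith] with the tail volume in the bracket replaced by the total volume [v],
    hence the same for all tails. *)
Definition tail_const := 2 * Kd + M / alpha * (p + 2 * Kd * v).

Lemma tail_perimeter (c a b : R) i : c != 0 -> `|c| <= 1 -> 0 < b - a <= 1 ->
  (forall x, K0 x -> c * x ord0 i <= a) -> fine (mu (tail c i a)) <= t0 * alpha ->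
  exists t be : R, [/\ a <= t <= b, 0 <= be, (relative_perimeter C (tail c i t) <= be%:E)%E &
    be <= tail_const * fine (mu (tail c i a)) / (b - a)].
Proof.
move=> c0 c1 ba K0a Va; have /andP[ba0 _] := ba.
have ab : a < b by rewrite -subr_gt0.
have [t [al [be [/andP[ta tb] Hal Hbe Hsum]]]] := cut i HKd mE Eoo c0 c1 ab Ep.
set F := E `&` [set x : 'rV[R]_n.+1 | c * x ord0 i <= t].
have mF : meas F by exact: (measurableI _ _ mE (meas_le _ _ _)).
have Foo : (mu F < +oo)%E by apply: subE => x [].
have al0 : 0 <= al by rewrite -lee_fin; apply: le_trans Hal; exact: perimeter_ge0 _ mF Foo.
have mG := tail_meas c i t; have Goo := tail_oo c i t.
have be0 : 0 <= be by rewrite -lee_fin; apply: le_trans Hbe; exact: perimeter_ge0 _ mG Goo.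
exists t, be; split => //; first by rewrite ta.
set V := fine (mu (tail c i a)); set G := fine (mu (tail c i t)).
have GV : G <= V by exact: tail_mono.
have V0 : 0 <= V by exact: tail_ge0.
have Vv : V <= v.
  by rewrite -lee_fin -Ev fineK ?lebesgue_fin //; [apply: lebesgue_le => x []|exact: tail_oo].
(* G / alpha is the time after which the shear has restored the lost volume [G]; the assumption on
   the tail keeps it at most [t0]. *)
have tau : 0 <= G / alpha <= t0.
  by rewrite divr_ge0 ?tail_ge0 ?(ltW alpha0) //= ler_pdivrMr // (le_trans GV).
have FC : F `<=` C by move=> x [/EC].
have [F' [mF' F'C volF' PF']] := def tau mF FC Foo al0 Hal.
(* [K0] lies below the level a <= t, so the cut leaves the integral of the derivative of [f]
   unchanged. *)
have intF : \int[mu]_(x in F) partial i0 f x = alpha.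
  rewrite -fE; apply: (@Rintegral_agree _ _ T mu) => x /eqP fx; split => [[]|Ex] //.
  split => //=; apply: le_trans ta; apply: K0a; apply: contrapT => nK; apply: fx.
  exact: (partial_vanishes_off i0 (compact_closed_rV cK0) f0 nK).
have volE : fine (mu F) + G = v.
  have EU : F `|` tail c i t = E.
    rewrite /F /tail -setIUr; apply/seteqP; split => [x []|x Ex] //; split => //=.
    by case: (leP (c * x ord0 i) t); [left|right].
  have disj : F `&` tail c i t = set0.
    apply/seteqP; split => // x [[_ /= h1] [_ /= h2]].
    by have := lt_le_trans h2 h1; rewrite ltxx.
  have := @measureU _ _ _ mu F (tail c i t) mF mG disj.
  rewrite EU => H; have H' : (v%:E = mu F + mu (tail c i t))%E by rewrite -Ev.
  by rewrite /G -fineD ?lebesgue_fin // -H'.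
have minF : p <= (1 + G / alpha * M) * al.
  rewrite -lee_fin; apply: le_trans PF'; apply: minE => //.
  by rewrite volF' intF divfK ?gt_eqF // volE.
have slab : fine (mu (E `&` [set x : 'rV[R]_n.+1 | (a < c * x ord0 i <= b)%R])) <= V.
  by apply: fine_lebesgue_le; [move=> x [Ex /andP[]]|exact: tail_oo].
have K20 : 0 <= 2 * Kd by rewrite mulr_ge0 // ltW.
have sum' : al + be <= p + 2 * Kd * V / (b - a).
  apply: (le_trans Hsum); rewrite lerD2l mulrAC ler_wpM2r ?invr_ge0 ?(ltW ba0) //.
  by rewrite ler_wpM2l.
have tV : G / alpha <= V / alpha by rewrite ler_pM2r // invr_gt0.
have := tail_arith alpha0 M0 p0 be0 K20 tV (andP tau).1 V0 ba sum' minF al0.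
move=> /le_trans; apply; rewrite ler_wpM2r ?invr_ge0 ?(ltW ba0) // ler_wpM2r //.
rewrite /tail_const lerD2l ler_wpM2l ?divr_ge0 ?(ltW alpha0) // lerD2l ler_wpM2l //.
Qed.

Variables (r0 A B : R).
Hypotheses (r00 : 0 < r0) (A0 : 0 < A) (B0 : 0 < B).
Hypothesis iso : forall h G (P : R), 0 < h <= r0 -> meas G -> G `<=` C ->
    (mu G <= (A * h ^+ n.+1)%:E)%E -> 0 <= P -> (relative_perimeter C G <= P%:E)%E ->
    (mu G <= (B * h * P)%:E)%E.

Lemma tail_decay (c a b h : R) i : c != 0 -> `|c| <= 1 -> 0 < b - a <= 1 -> 0 < h <= r0 ->
  (forall x, K0 x -> c * x ord0 i <= a) -> fine (mu (tail c i a)) <= t0 * alpha ->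
  fine (mu (tail c i a)) <= A * h ^+ n.+1 ->
  fine (mu (tail c i b)) <= B * h * (tail_const * fine (mu (tail c i a)) / (b - a)).
Proof.
move=> c0 c1 ba hr K0a Va Vh.
have [t [be [/andP[ta tb] be0 Pbe Hbe]]] := tail_perimeter c0 c1 ba K0a Va.
have /andP[h0 _] := hr.
apply: (le_trans (tail_mono c i tb)).
have GC : tail c i t `<=` C by move=> x [/EC].
have Gh : (mu (tail c i t) <= (A * h ^+ n.+1)%:E)%E.
  rewrite -[leLHS]fineK ?lee_fin; last by apply: lebesgue_fin; exact: tail_oo.
  by apply: le_trans Vh; exact: tail_mono.
have := iso hr (tail_meas c i t) GC Gh be0 Pbe.
rewrite -[leLHS]fineK ?lee_fin; last by apply: lebesgue_fin; exact: tail_oo.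
by move=> /le_trans; apply; rewrite ler_wpM2l // mulr_ge0 // ltW.
Qed.

Lemma tail_small c i (e : R) : 0 < e -> exists2 a, 0 <= a & fine (mu (tail c i a)) <= e.
Proof.
move=> e0; have [N HN] : exists N : nat, (mu (tail c i N%:R) <= e%:E)%E.
  apply: (@cvg_decr_set0 R n (fun N : nat => tail c i N%:R)) => //.
  - exact: tail_oo.
  - by move=> k; exact: tail_meas.
  - move=> k l kl x [Ex /= lx]; split => //=; apply: le_lt_trans lx.
    by rewrite ler_nat.
  - apply/seteqP; split => // x /(_ (Num.truncn (c * x ord0 i)).+1 Logic.I) [_ /=].
    by move=> /lt_trans/(_ (truncnS_gt _)); rewrite ltxx.
exists N%:R => //; rewrite -lee_fin fineK //; apply: lebesgue_fin; exact: tail_oo.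
Qed.

Lemma tail_null c i : c != 0 -> `|c| <= 1 -> exists2 s, 0 <= s & mu (tail c i s) = 0%E.
Proof.
move=> c0 c1.
have K'0 : 0 < tail_const.
  rewrite /tail_const ltr_wpDr ?mulr_gt0 // mulr_ge0 ?divr_ge0 ?(ltW alpha0) //.
  by rewrite addr_ge0 // !mulr_ge0 // ltW.
(* Between the levels k and k + 1, [tail_decay] gives the factor 2 B tail_const h0, the halving of
   [h k] compensating the gap 2 ^- (k + 1). With h0 <= q^-1 this is at most 2 ^- (n + 1), the ratio
   of consecutive bounds A h_k ^ (n + 1), so the smallness condition reproduces itself. *)
pose q := 2 * (B * tail_const) * 2 ^+ n.+1.
have q0 : 0 < q by rewrite !mulr_gt0 // exprn_gt0.
pose h0 := Num.min r0 q^-1.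
have h00 : 0 < h0 by rewrite lt_min r00 invr_gt0.
pose h (k : nat) := h0 / 2 ^+ k.
have p2 k : (0 : R) < 2 ^+ k by rewrite exprn_gt0.
have hk k : 0 < h k <= r0.
  rewrite divr_gt0 //= ler_pdivrMr //; apply: (@le_trans _ _ r0); first by rewrite ge_min lexx.
  by rewrite ler_peMr ?(ltW r00) // exprn_ege1 // ler1n.
have [r rr K0r] := compact_in_ball cK0.
have e0 : 0 < Num.min (t0 * alpha) (A * h0 ^+ n.+1).
  by rewrite lt_min !mulr_gt0 // exprn_gt0.
have [a0 a00 Ha0] := tail_small c i e0.
move: Ha0; rewrite le_min => /andP[Ha1 Ha2].
(* Beyond [a] the tails are small by the choice of [a0], and [K0], contained in the ball of radius
   [r], lies below; the levels [s k] increase from [a] to a + 1. *)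
pose a := a0 + r.
have a0a : a0 <= a by rewrite lerDl ltW.
pose s (k : nat) := a + 1 - (2 ^+ k)^-1.
have as_ k : a <= s k.
  by rewrite /s -addrA lerDl subr_ge0 invf_le1 // exprn_ege1 // ler1n.
have ds k : s k.+1 - s k = (2 ^+ k.+1)^-1.
  rewrite /s exprS; have := p2 k; move: (2 ^+ k) => z z0; rewrite opprB addrACA.
  by field; rewrite gt_eqF.
have K0s k x : K0 x -> c * x ord0 i <= s k.
  move=> /K0r xr; apply: le_trans (as_ k); apply: (le_trans (ler_norm _)); rewrite normrM.
  apply: (@le_trans _ _ (1 * r)); last by rewrite mul1r lerDr.
  by apply: ler_pM => //; exact: le_trans (coord_le_norm x i) xr.
have V1 k : fine (mu (tail c i (s k))) <= t0 * alpha.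
  by apply: le_trans Ha1; apply: tail_mono; exact: le_trans (as_ k).
have main k : fine (mu (tail c i (s k))) <= A * h k ^+ n.+1.
  elim: k => [|k ih].
    rewrite /h expr0 divr1; apply: le_trans Ha2; apply: tail_mono; exact: le_trans (as_ 0%N).
  have b1 : 0 < s k.+1 - s k <= 1.
    by rewrite ds invr_gt0 p2 /= invf_le1 // exprn_ege1 // ler1n.
  apply: (le_trans (tail_decay c0 c1 b1 (hk k) (K0s k) (V1 k) ih)).
  have V0 := tail_ge0 c i (s k).
  set V := fine (mu (tail c i (s k))) in ih V0 *.
  rewrite ds invrK.
  have -> : B * h k * (tail_const * V * 2 ^+ k.+1) = 2 * (B * tail_const) * h0 * V.
    rewrite /h exprS; have := p2 k; move: (2 ^+ k) => z z0.
    by field; rewrite gt_eqF.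
  have hq : 2 * (B * tail_const) * h0 <= (2 ^+ n.+1)^-1.
    have h1 : h0 <= q^-1 by rewrite ge_min lexx orbT.
    have bt : 0 < 2 * (B * tail_const) by rewrite !mulr_gt0.
    apply: (@le_trans _ _ (2 * (B * tail_const) * q^-1)); first by rewrite ler_wpM2l // ltW.
    by rewrite /q invfM mulVKf // gt_eqF.
  have -> : A * h k.+1 ^+ n.+1 = (2 ^+ n.+1)^-1 * (A * h k ^+ n.+1).
    have -> : h k.+1 = h k / 2 by rewrite /h exprSr invfM mulrA.
    by rewrite exprMn exprVn mulrA mulrC.
  by apply: ler_pM => //; rewrite !mulr_ge0 // ?(ltW B0) ?(ltW K'0) ?(ltW h00).
exists (a + 1); first by rewrite addr_ge0 // addr_ge0 // ltW.
suff H : fine (mu (tail c i (a + 1))) <= 0.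
  apply/eqP; rewrite eq_le outer_measure_ge0 andbT.
  by rewrite -[leLHS]fineK ?lee_fin //; apply: lebesgue_fin; exact: tail_oo.
apply/ler_addgt0Pr => e e1; rewrite add0r.
(* A h_k ^ (n + 1) <= D h_k since h_k <= r0, and h_k tends to 0. *)
pose D := A * r0 ^+ n.
have D0 : 0 < D by rewrite mulr_gt0 // exprn_gt0.
have [k Hk] : exists k : nat, D * h k <= e.
  exists (Num.truncn (D * h0 / e)).+1; rewrite /h mulrA ler_pdivrMr //.
  rewrite -ler_pdivrMl // mulrC; apply: ltW; apply: (lt_trans (truncnS_gt _)).
  by rewrite -natrX ltr_nat ltn_expl.
apply: (le_trans _ Hk); apply: (@le_trans _ _ (fine (mu (tail c i (s k))))).
  by apply: tail_mono; rewrite /s gerDl oppr_le0 invr_ge0 ltW.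
apply: (le_trans (main k)); rewrite /D exprSr -!mulrA ler_wpM2l ?(ltW A0) //.
have /andP[hk0 hk1] := hk k.
by rewrite ler_wpM2r ?(ltW hk0) // lerXn2r // nnegrE ltW.
Qed.

End tails.

(** * Boundedness of isoperimetric regions *)

Lemma tails_essentially_bounded {R : realType} {n : nat} (E : set 'rV[R]_n.+1) :
  (forall (c : R) i, c != 0 -> `|c| <= 1 -> exists2 s, 0 <= s & lebesgue (tail E c i s) = 0%E) ->
  essentially_bounded E.
Proof.
move=> H.
pose sg (b : bool) : R := if b then 1 else -1.
have /choice[s sP] : forall ib : 'I_n.+1 * bool, exists s, 0 <= s /\
    lebesgue (tail E (sg ib.2) ib.1 s) = 0%E.
  have c0 b : sg b != 0 by case: b; rewrite ?oppr_eq0 oner_eq0.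
  have c1 b : `|sg b| <= 1 by case: b; rewrite ?normrN normr1.
  by move=> [i b]; have [s s0 Hs] := H (sg b) i (c0 b) (c1 b); exists s.
pose S := \sum_ib s ib; have S0 : 0 <= S by apply: sumr_ge0 => ib _; have [] := sP ib.
have sS ib : s ib <= S.
  rewrite /S (bigD1 ib) //= lerDl; apply: sumr_ge0 => j _; by have [] := sP j.
(* Off the tails all coordinates are at most [S] in modulus; n + 1 passes from the sup norm to the
   Euclidean one, and the + 1 gives the strict inequality of the open ball. *)
exists 0, (n.+1%:R * S + 1); split; first by rewrite ltr_wpDl // mulr_ge0.
apply/eqP; rewrite eq_le outer_measure_ge0 andbT.
have sub : E `\` eball 0 (n.+1%:R * S + 1) `<=`
    \big[setU/set0]_(ib : 'I_n.+1 * bool) tail E (sg ib.2) ib.1 (s ib).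
  move=> x [Ex nx]; rewrite -bigcup_seq; apply: contrapT => nU; apply: nx.
  rewrite /eball /= subr0; apply: (@le_lt_trans _ _ (n.+1%:R * S)); last by rewrite ltrDl.
  apply: (le_trans (enorm_norm_le _)); rewrite ler_wpM2l //; apply: norm_le_coord => // i.
  have le b : sg b * x ord0 i <= S.
    apply: le_trans (sS (i, b)); rewrite leNgt; apply/negP => lt; apply: nU.
    by exists (i, b); rewrite /= ?mem_index_enum.
  by have := le true; have := le false; rewrite mulN1r mul1r ler_norml lerNl => -> ->.
apply: (le_trans (lebesgue_le sub)).
elim/big_ind : _ => [|A B hA hB|ib _].
- by rewrite measure0.
- by apply: le_trans (outer_measureU2 _ _ _) _; rewrite -[leRHS]adde0; apply: leeD.
- by have [_ ->] := sP ib.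
Qed.

Theorem proposition3p20 (R : realType) (n : nat) (hn : (1 <= n)%N)
    (C : set 'rV[R]_n.+1) (hC : convex_body C) (hU : uniform_geometry C)
    (E : set 'rV[R]_n.+1) (hE : isoperimetric_region C E) :
  essentially_bounded E.
Proof.
have [clC cvC C0] := hC; have cC := convex_set_cvx cvC.
have [nb [r0 r00 inf0]] := hU; have [mE EC E0 PE] := hE.
have /andP[Ep Eoo] := E0.
have mC : lebesgue_measurable C by exact: measurable_closed.
have [c0 c00 volC] : exists2 c0 : R, 0 < c0 &
    forall x, C x -> (c0%:E <= lebesgue (C `&` closed_eball x r0))%E.
  move: inf0; set m := ereal_inf _ => m0.
  have mle x : C x -> (m <= lebesgue (C `&` closed_eball x r0))%E.
    by move=> Cx; apply: ereal_inf_lbound; exists x.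
  case: m m0 mle => [c||] // c0 mle; first by exists c.
  (* The infimum is infinite here: any positive constant will do. *)
  by exists 1 => // x /mle; apply: le_trans; rewrite leey.
have Coo : lebesgue C = +oo%E by exact: (infinite_volume clC nb c00 volC).
set v := fine (lebesgue E) in PE.
have Ev : lebesgue E = v%:E by rewrite fineK // lebesgue_fin.
have v0 : 0 < v by rewrite -lte_fin -Ev.
have minE F : lebesgue_measurable F -> F `<=` C -> lebesgue F = v%:E ->
    (relative_perimeter C E <= relative_perimeter C F)%E.
  by move=> mF FC Fv; rewrite PE; apply: ereal_inf_lbound; exists F.
(* The competitor of [exact_volume] makes the minimal perimeter a real number. *)
have [p pE] : exists p : R, relative_perimeter C E = p%:E.
  have [F [P [mF FC Fv FP]]] := exact_volume mC Coo v0.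
  have := le_trans (minE F mF FC Fv) FP; have := perimeter_ge0 C mE Eoo.
  by case: (relative_perimeter C E) => [p||] //; exists p.
have {}minE F : lebesgue_measurable F -> F `<=` C -> lebesgue F = v%:E ->
    (p%:E <= relative_perimeter C F)%E by rewrite -pE; exact: minE.
have Ple : (relative_perimeter C E <= p%:E)%E by rewrite pE.
have [f [i0 [K0 [cK0 K0C fs f0 alpha0]]]] := positive_partial cC clC C0 Coo mE EC E0.
have [t0 [M [t00 M0 def]]] := deformation i0 cK0 K0C fs f0.
have [Kd Kd0 HKd] := @dstep_bounded R.
have [A [B [A0 B0 iso]]] := small_isoperimetric cC clC C0 r00 c00 volC.
apply: tails_essentially_bounded => c i cn0 c1.
exact: (tail_null mE EC Ev Ple minE cK0 f0 t00 M0 erefl alpha0 def Kd0 HKd r00 A0 B0 iso i cn0 c1).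
Qed.
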